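(* Let $\Gamma$ be a finite group and $\xi\in R(\Gamma)$ a self-dual class function. For any $\gamma\in R(\Gamma)$, the following identities hold between formal series of operators on $S_\Gamma$: \begin{align*} \mathrm{ch}\bigl(H_+(\gamma,z)\bigr)&=\exp\Bigl(\sum_{n\ge1}\tfrac1n\,a_{-n}(\gamma)z^n\Bigr),\\ \mathrm{ch}\bigl(E_+(\gamma,z)\bigr)&=\exp\Bigl(-\sum_{n\ge1}\tfrac1n\,a_{-n}(\gamma)z^n\Bigr),\\ \mathrm{ch}\bigl(H_-(\gamma,z)\bigr)&=\exp\Bigl(\sum_{n\ge1}\tfrac1n\,a_{n}(\gamma)z^{-n}\Bigr),\\ \mathrm{ch}\bigl(E_-(\gamma,z)\bigr)&=\exp\Bigl(-\sum_{n\ge1}\tfrac1n\,a_{n}(\gamma)z^{-n}\Bigr). \end{align*}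
   Context: $\Gamma$ is a finite group; $\Gamma^*=\{\gamma_0,\dots,\gamma_r\}$ is its set of complex irreducible characters ($\gamma_0$ trivial); $\Gamma_*$ is its set of conjugacy classes; $c^{-1}=\{x^{-1}:x\in c\}$; $\zeta_c$ is the order of the centralizer of an element of $c$; $R(\Gamma)=\bigoplus_i\mathbb C\gamma_i$ is the space of class functions. For a finite group $G$ the standard bilinear form on class functions is $\langle f,g\rangle_G=\frac1{|G|}\sum_{x\in G}f(x)g(x^{-1})$; $*$ denotes pointwise multiplication. $\xi$ is self-dual if $\xi(x)=\xi(x^{-1})$ for all $x$. The weighted form on $R(\Gamma)$ is $\langle f,g\rangle_\xi=\langle\xi*f,g\rangle_\Gamma$. Wreath products: $\Gamma_n=\Gamma^n\rtimes S_n$ with $(g,\sigma)(h,\tau)=(g\,\sigma(h),\sigma\tau)$, where $\sigma(g_1,\dots,g_n)=(g_{\sigma^{-1}(1)},\dots,g_{\sigma^{-1}(n)})$. $\mathcal P_n(\Gamma_* )$ is the set of families $\rho=(\rho(c))_{c\in\Gamma_*}$ of partitions of total size $n$. The type of $(g,\sigma)\in\Gamma_n$ is the $\rho$ for which the number of parts equal to $i$ in $\rho(c)$ is the number of $i$-cycles $(i_1\,i_2\cdots i_k)$ ($k=i$) of $\sigma$ whose cycle-product $g_{i_k}\cdots g_{i_1}$ lies in $c$. Conjugacy classes of $\Gamma_n$ correspond to types; $Z_\rho=\prod_c z_{\rho(c)}\zeta_c^{l(\rho(c))}$ is the centralizer order, with $l$ the length and $z_\lambda=\prod_i i^{m_i}m_i!$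 for $\lambda=(1^{m_1}2^{m_2}\cdots)$. $R(\Gamma_n)$ is the space of complex class functions on $\Gamma_n$ and $R_\Gamma=\bigoplus_{n\ge0}R(\Gamma_n)$. For a representation $V$ of $\Gamma$ with character $\gamma$, $\eta_n(\gamma)$ is the character of the $\Gamma_n$-module $V^{\otimes n}$ ($\Gamma^n$ acting factor by factor, $S_n$ permuting factors), and $\varepsilon_n(\gamma)$ is the character of $V^{\otimes n}$ tensored with the sign representation of $S_n$. The map $\eta_n$ is extended to virtual characters by $\eta_n(\beta-\gamma)=\sum_{m=0}^n(-1)^m\mathrm{Ind}_{\Gamma_{n-m}\times\Gamma_m}^{\Gamma_n}[\eta_{n-m}(\beta)\otimes\varepsilon_m(\gamma)]$, and to all of $R(\Gamma)$ as the unique map polynomial in the coordinates with respect to the $\gamma_i$; $\varepsilon_n(\gamma)$ for $\gamma\in R(\Gamma)$ is $\eta_n(\gamma)$ times the sign character of $S_n$. The weighted form on $R(\Gamma_n)$ is $\langle f,g\rangle_\xi=\langle\eta_n(\xi)*f,g\rangle_{\Gamma_n}$. Operators on $R_\Gamma$, for $n\ge0$ and $\gamma\in R(\Gamma)$: $H_{-n}(\gamma)$ (resp. $E_{-n}(\gamma)$) sends $f\in R(\Gamma_m)$ to $\mathrm{Ind}_{\Gamma_n\times\Gamma_m}^{\Gamma_{n+m}}(\eta_n(\gamma)\otimes f)$ (resp. $\mathrm{Ind}(\varepsilon_n(\gamma)\otimes f)$). $H_n(\gamma)$ (resp. $E_n(\gamma)$) sends $f\in R(\Gamma_m)$ to the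 element of $R(\Gamma_{m-n})$ obtained by restricting $f$ to $\Gamma_n\times\Gamma_{m-n}$, i.e. to $R(\Gamma_n)\otimes R(\Gamma_{m-n})$, and applying $\langle\eta_n(\gamma),\cdot\rangle_\xi$ (resp. $\langle\varepsilon_n(\gamma),\cdot\rangle_\xi$) to the first factor (zero if $n>m$). For $n=0$ all of these are the identity. Generating series: $H_+(\gamma,z)=\sum_{n\ge0}H_{-n}(\gamma)z^n$, $E_+(\gamma,z)=\sum_{n\ge0}E_{-n}(\gamma)(-z)^n$, $E_-(\gamma,z)=\sum_{n\ge0}E_n(\gamma)(-z)^{-n}$, $H_-(\gamma,z)=\sum_{n\ge0}H_n(\gamma)z^{-n}$. $S_\Gamma$ is the symmetric algebra over $\mathbb C$ on generators $a_{-n}(\gamma)$, $n\ge1$, $\gamma\in\Gamma^*$, extended linearly to $\gamma\in R(\Gamma)$. For $n>0$, $a_{-n}(\gamma)$ acts on $S_\Gamma$ by multiplication and $a_n(\gamma)$ acts as the derivation with $a_n(\gamma)\cdot a_{-m}(\beta)=n\,\delta_{n,m}\langle\gamma,\beta\rangle_\xi$. For $c\in\Gamma_*$, $a_{-n}(c)=\sum_{\gamma\in\Gamma^*}\gamma(c^{-1})a_{-n}(\gamma)$; $a'_{-\rho}=\prod_c\prod_i a_{-\rho(c)_i}(c)$. The characteristic map $\mathrm{ch}:R_\Gamma\to S_\Gamma$ is the linear isomorphism with $\mathrm{ch}(f)=\sum_{\rho\in\mathcal P_n(\Gamma_* )}Z_\rho^{-1}f_\rho\,a'_{-\rho}$ for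 $f\in R(\Gamma_n)$ ($f_\rho$ the value at type $\rho$). For an operator $T$ on $R_\Gamma$, $\mathrm{ch}(T)$ denotes the operator $\mathrm{ch}\circ T\circ\mathrm{ch}^{-1}$ on $S_\Gamma$ (coefficientwise for series). *)

(* Defs.v *)
From HB Require Import structures.
From mathcomp Require Import all_boot all_order all_fingroup all_algebra.
From mathcomp Require Import mxrepresentation.
From mathcomp Require Import finmap monalg.
From mathcomp Require mpoly.
From mathcomp Require Import boolp classical_sets fsbigop reals complex.

Set Implicit Arguments.
Unset Strict Implicit.
Unset Printing Implicit Defensive.

Import GroupScope GRing.Theory Num.Theory.
Local Open Scope ring_scope.

Section ClassFunctions.

Variables (C : numClosedFieldType) (G : finGroupType).

Definition is_class_fun (f : {ffun G -> C^o}) : bool :=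
  [forall x, forall y, f (x ^ y)%g == f x].

Record cfun := Cfun { cfval :> {ffun G -> C^o}; _ : is_class_fun cfval }.

HB.instance Definition _ := [isSub for cfval].
HB.instance Definition _ := [Choice of cfun by <:].

Lemma is_class_funP (f : {ffun G -> C^o}) :
  reflect (forall x y, f (x ^ y)%g = f x) (is_class_fun f).
Proof.
by apply: (iffP forallP) => H x; [move=> y; apply/eqP/(forallP (H x))|
  apply/forallP => y; rewrite H].
Qed.

Lemma cfunJ (f : cfun) (x y : G) : f (x ^ y)%g = f x.
Proof. by case: f => f /= /is_class_funP. Qed.

Lemma cfunP (f g : cfun) : (forall x, f x = g x) -> f = g.
Proof. by move=> H; apply/val_inj/ffunP. Qed.

Fact is_class_fun_submod : submod_closed is_class_fun.
Proof.
split=> [|a f g /is_class_funP Hf /is_class_funP Hg]; apply/is_class_funP => x y.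
  by rewrite !ffunE.
by rewrite !ffunE Hf Hg.
Qed.

HB.instance Definition _ :=
  GRing.isSubmodClosed.Build C {ffun G -> C^o} is_class_fun is_class_fun_submod.
HB.instance Definition _ := [SubChoice_isSubLmodule of cfun by <:].

Fact mk_cfun_subproof (f : G -> C) (fJ : forall x y, f (x ^ y)%g = f x) :
  is_class_fun [ffun x => f x].
Proof. by apply/is_class_funP => x y; rewrite !ffunE fJ. Qed.
Definition mk_cfun (f : G -> C) (fJ : forall x y, f (x ^ y)%g = f x) : cfun :=
  Cfun (mk_cfun_subproof fJ).

Fact cfMul_subproof (f g : cfun) x y : f (x ^ y)%g * g (x ^ y)%g = f x * g x.
Proof. by rewrite !cfunJ. Qed.
Definition cfMul (f g : cfun) : cfun := mk_cfun (cfMul_subproof f g).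

(* bilinear, without complex conjugation *)
Definition cfForm (f g : cfun) : C :=
  #|G|%:R^-1 * \sum_(x : G) f x * g x^-1%g.

Definition self_dual (f : cfun) := forall x : G, f x = f x^-1%g.

Fact mx_char_subproof d (rG : mx_representation C [set: G]%G d) (x y : G) :
  \tr (rG (x ^ y)%g) = \tr (rG x).
Proof.
rewrite conjgE -?mulgA repr_mxM ?inE // mxtrace_mulC -repr_mxM ?inE //.
by rewrite mulgK.
Qed.
Definition mx_char d (rG : mx_representation C [set: G]%G d) : cfun :=
  mk_cfun (mx_char_subproof rG).

(* The irreducible representations of G over C, up to isomorphism, are indexed
   by the Wedderburn components of the group algebra, as for 'Chi_i in
   mathcomp.character. *)
Definition Irr := DecSocleType (regular_repr C [set: G]%G).

Definition chi (i : Irr) : cfun := mx_char (irr_repr i).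

Definition irr_tuple : #|Irr|.-tuple {ffun G -> C^o} :=
  [tuple cfval (chi (enum_val k)) | k < #|Irr|].

(* the coordinates of f in the basis of irreducible characters *)
Definition irr_coord (f : cfun) (k : 'I_#|Irr|) : C := coord irr_tuple k (cfval f).
Definition irr_coef (f : cfun) (i : Irr) : C := irr_coord f (enum_rank i).

End ClassFunctions.

Section Induction.

Variables (C : numClosedFieldType) (G H : finGroupType).

(* Frobenius' formula, for iota an embedding of H into G. *)
Fact cfInd_subproof (iota : H -> G) (phi : cfun C H) (x y : G) :
  #|H|%:R^-1 * \sum_(z : G) \sum_(h : H | iota h == ((x ^ y) ^ z)%g) phi h
    = #|H|%:R^-1 * \sum_(z : G) \sum_(h : H | iota h == (x ^ z)%g) phi h.
Proof.
congr (_ * _); rewrite [RHS](reindex_inj (mulgI y)) /=.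
by apply: eq_bigr => z _; apply: eq_bigl => h; rewrite conjgM.
Qed.
Definition cfInd (iota : H -> G) (phi : cfun C H) : cfun C G :=
  mk_cfun (cfInd_subproof iota phi).

Fact cfRes_subproof (iota : H -> G) (iotaM : {morph iota : x y / (x * y)%g})
  (f : cfun C G) (x y : H) : f (iota (x ^ y)%g) = f (iota x).
Proof.
have iota1 : iota 1%g = 1%g by apply: (mulgI (iota 1%g)); rewrite -iotaM !mulg1.
have iotaV z : iota z^-1%g = (iota z)^-1%g.
  by apply: (mulgI (iota z)); rewrite -iotaM !mulgV.
by rewrite conjgE !iotaM iotaV -conjgE cfunJ.
Qed.
Definition cfRes (iota : H -> G) (iotaM : {morph iota : x y / (x * y)%g})
  (f : cfun C G) : cfun C H := mk_cfun (cfRes_subproof iotaM f).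

Lemma conj_pair (x y : G * H) : (x ^ y)%g = (x.1 ^ y.1, x.2 ^ y.2)%g.
Proof. by rewrite /conjg /=. Qed.

Fact cfExt_subproof (f : cfun C G) (g : cfun C H) (x y : G * H) :
  f (x ^ y)%g.1 * g (x ^ y)%g.2 = f x.1 * g x.2.
Proof. by rewrite conj_pair /= !cfunJ. Qed.
(* R(G) (x) R(H) -> R(G x H) *)
Definition cfExt (f : cfun C G) (g : cfun C H) : cfun C (G * H)%type :=
  mk_cfun (cfExt_subproof f g).

Fact cfSlice_subproof (phi : cfun C (G * H)%type) (y : H) (x z : G) :
  phi ((x ^ z)%g, y) = phi (x, y).
Proof.
by rewrite -(cfunJ phi (x, y) (z, 1%g)) conj_pair /= conjg1.
Qed.
Definition cfSlice (phi : cfun C (G * H)%type) (y : H) : cfun C G :=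
  mk_cfun (cfSlice_subproof phi y).

Fact cfContract_subproof (f : cfun C G) (phi : cfun C (G * H)%type) (x y : H) :
  cfForm f (cfSlice phi (x ^ y)%g) = cfForm f (cfSlice phi x).
Proof.
congr cfForm; apply: cfunP => z; rewrite !ffunE.
by rewrite -(cfunJ phi (z, x) (1%g, y)) conj_pair /= conjg1.
Qed.
(* cfForm f applied to the first factor: maps g (x) h to cfForm f g *: h *)
Definition cfContract (f : cfun C G) (phi : cfun C (G * H)%type) : cfun C H :=
  mk_cfun (cfContract_subproof f phi).

End Induction.

(** Wreath products.  In mathcomp the product s * t of permutations is
    "s, then t", so that the composite of functions "sigma o tau" is
    tau * sigma. *)

Section Wreath.

Variables (gT : finGroupType) (n : nat).

Record wreath := Wreath { wbase : {ffun 'I_n -> gT}; wperm : 'S_n }.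

Definition wreath_pair (x : wreath) := (wbase x, wperm x).
Definition pair_wreath (p : {ffun 'I_n -> gT} * 'S_n) := Wreath p.1 p.2.
Fact wreath_pairK : cancel wreath_pair pair_wreath. Proof. by case. Qed.

HB.instance Definition _ := Finite.copy wreath (can_type wreath_pairK).

Definition wreath_one := Wreath [ffun=> 1%g] 1%g.
Definition wreath_mul (x y : wreath) :=
  Wreath [ffun i => wbase x i * wbase y ((wperm x)^-1 i)]%g
         (wperm y * wperm x)%g.
Definition wreath_inv (x : wreath) :=
  Wreath [ffun i => (wbase x (wperm x i))^-1]%g (wperm x)^-1%g.

Lemma wreathP (x y : wreath) :
  wbase x =1 wbase y -> wperm x = wperm y -> x = y.
Proof. by case: x y => [f s] [g t] /= /ffunP-> ->. Qed.

Fact wreath_mulA : associative wreath_mul.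
Proof.
move=> x y z; apply: wreathP => [i|] /=; last by rewrite mulgA.
by rewrite !ffunE /= ?ffunE mulgA invMg permM.
Qed.

Fact wreath_mul1 : left_id wreath_one wreath_mul.
Proof.
move=> x; apply: wreathP => [i|] /=; last by rewrite mulg1.
by rewrite !ffunE mul1g invg1 perm1.
Qed.

Fact wreath_mulV : left_inverse wreath_one wreath_inv wreath_mul.
Proof.
move=> x; apply: wreathP => [i|] /=; last by rewrite mulgV.
by rewrite !ffunE invgK mulVg.
Qed.

HB.instance Definition _ :=
  Finite_isGroup.Build wreath wreath_mulA wreath_mul1 wreath_mulV.

End Wreath.

Section Young.

Variables (gT : finGroupType) (p q k : nat) (e : (p + q = k)%N).

Definition young_split (i : 'I_k) : 'I_p + 'I_q := split (cast_ord (esym e) i).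
Definition young_unsplit (u : 'I_p + 'I_q) : 'I_k := cast_ord e (unsplit u).

Lemma young_splitK : cancel young_split young_unsplit.
Proof. by move=> i; rewrite /young_unsplit splitK cast_ordKV. Qed.
Lemma young_unsplitK : cancel young_unsplit young_split.
Proof. by move=> u; rewrite /young_split cast_ordK unsplitK. Qed.

Definition sum_map (s : 'S_p) (t : 'S_q) (u : 'I_p + 'I_q) : 'I_p + 'I_q :=
  match u with inl a => inl (s a) | inr b => inr (t b) end.

Fact young_perm_subproof s t :
  injective (fun i => young_unsplit (sum_map s t (young_split i))).
Proof.
apply: (inj_comp (can_inj young_unsplitK)).
apply: inj_comp (can_inj young_splitK).
by move=> [a|b] [a'|b'] //= [] /perm_inj ->.
Qed.
Definition young_perm s t : 'S_k := perm (@young_perm_subproof s t).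

(* Gamma_p x Gamma_q in Gamma_k: the first factor acts on the first p points. *)
Definition young (x : wreath gT p * wreath gT q) : wreath gT k :=
  Wreath [ffun i => match young_split i with
                    | inl a => wbase x.1 a
                    | inr b => wbase x.2 b
                    end]
         (young_perm (wperm x.1) (wperm x.2)).

Lemma young_permM s s' t t' :
  young_perm (s * s')%g (t * t')%g = (young_perm s t * young_perm s' t')%g.
Proof.
apply/permP => i; rewrite permM !permE young_unsplitK.
by case: (young_split i) => a /=; rewrite permM.
Qed.

Lemma young_perm1 : young_perm 1%g 1%g = 1%g.
Proof.
apply/permP => i; rewrite permE perm1 -[RHS]young_splitK; congr young_unsplit.
by case: (young_split i) => a /=; rewrite perm1.
Qed.

Lemma young_permV s t : (young_perm s t)^-1%g = young_perm s^-1%g t^-1%g.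
Proof.
by apply: (mulgI (young_perm s t)); rewrite -young_permM !mulgV young_perm1.
Qed.

Lemma youngM : {morph young : x y / (x * y)%g}.
Proof.
move=> [x1 x2] [y1 y2]; apply: wreathP => [i|] /=; last exact: young_permM.
rewrite !ffunE young_permV permE young_unsplitK.
by case: (young_split i) => a /=; rewrite !ffunE.
Qed.

End Young.

Section TensorPower.

Variables (C : numClosedFieldType) (gT : finGroupType).
Variables (d : nat) (V : mx_representation C [set: gT]%G d) (n : nat).

(* The basis e_b = e_(b 0) (x) ... (x) e_(b (n-1)) of the n-th tensor power of
   V is indexed by the maps b; as V is given by matrices acting on column
   vectors, the matrix of (g, s) is that of
   v_1 (x) ... (x) v_n |-> g_1 v_(s^-1 1) (x) ... (x) g_n v_(s^-1 n). *)
Definition tens_idx (k : 'I_#|{ffun 'I_n -> 'I_d}|) : {ffun 'I_n -> 'I_d} :=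
  enum_val k.
Definition tens_mx (x : wreath gT n) : 'M[C]_#|{ffun 'I_n -> 'I_d}| :=
  \matrix_(k, l) \prod_(i < n)
    V (wbase x i) (tens_idx k i) (tens_idx l ((wperm x)^-1%g i)).

Fact tens_repr_subproof : mx_repr [set: wreath gT n]%G tens_mx.
Proof.
split=> [|x y _ _]; apply/matrixP => k l; rewrite !mxE.
  rewrite -(inj_eq enum_val_inj) -!/(tens_idx _).
  have [->|neq_kl] := eqVneq (tens_idx k) (tens_idx l).
    by apply: big1 => i _; rewrite ffunE repr_mx1 mxE invg1 perm1 eqxx.
  have [i Hi|eq_kl] := pickP (fun i => tens_idx k i != tens_idx l i).
    by rewrite (bigD1 i) //= ffunE repr_mx1 mxE invg1 perm1 (negPf Hi) mul0r.
  by case/eqP: neq_kl; apply/ffunP => i; apply/eqP/negbFE/eq_kl.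
under eq_bigr => i _ do rewrite ffunE repr_mxM ?inE // mxE.
rewrite bigA_distr_bigA /=.
rewrite [RHS](reindex (fun b : {ffun 'I_n -> 'I_d} =>
  enum_rank [ffun j => b (wperm x j)])) /=; last first.
  exists (fun k : 'I_#|{ffun 'I_n -> 'I_d}| =>
    [ffun i => tens_idx k ((wperm x)^-1 i)%g]) => [b _|j _].
    by apply/ffunP => i; rewrite ffunE /tens_idx enum_rankK ffunE permKV.
  rewrite -[RHS]enum_valK; congr enum_rank; apply/ffunP => i.
  by rewrite !ffunE permK.
apply: eq_bigr => b _; rewrite !mxE big_split /=; congr (_ * _).
  by apply: eq_bigr => i _; rewrite /tens_idx enum_rankK ffunE permKV.
rewrite [RHS](reindex_inj (@perm_inj _ (wperm x)^-1%g)) /=.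
apply: eq_bigr => i _; rewrite /tens_idx enum_rankK !ffunE permKV.
by rewrite invMg permM.
Qed.

Definition tens_repr := MxRepresentation tens_repr_subproof.

Definition tens_char : cfun C (wreath gT n) := mx_char tens_repr.

End TensorPower.

Section EtaEps.

Variables (C : numClosedFieldType) (gT : finGroupType).

Lemma wperm_conj n (x y : wreath gT n) :
  odd_perm (wperm (x ^ y)%g) = odd_perm (wperm x).
Proof.
by rewrite /conjg /= !odd_permM odd_permV addbC addbA addbb addFb.
Qed.

Fact cfSgn_subproof n (x y : wreath gT n) :
  (-1) ^+ wperm (x ^ y)%g = (-1) ^+ wperm x :> C.
Proof. by rewrite wperm_conj. Qed.
Definition cfSgn n : cfun C (wreath gT n) := mk_cfun (@cfSgn_subproof n).

(* A virtual character is a difference of two characters; the summands below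
   are Ind(eta_(n-m)(beta) (x) eps_m(gamma)), for beta, gamma the characters
   of V and W. *)
Definition eta_spec n (F : cfun C gT -> cfun C (wreath gT n)) : Prop :=
  (forall x, exists P : mpoly.mpoly #|Irr C gT| C,
     forall f, F f x = mpoly.meval (irr_coord f) P)
  /\
  (forall d d' (V : mx_representation C [set: gT]%G d)
               (W : mx_representation C [set: gT]%G d'),
     F (mx_char V - mx_char W) =
       \sum_(m < n.+1) (-1) ^+ m *:
         cfInd (young (subnK (leq_ord m)))
           (cfExt (tens_char V (n - m)) (cfMul (tens_char W m) (cfSgn m)))).

(* The extension of eta_n from virtual characters to R(Gamma) is the unique map
   satisfying eta_spec. *)
Definition cf_eta n : cfun C gT -> cfun C (wreath gT n) :=
  xget (fun=> 0) [set F | eta_spec F]%classic.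

Definition cf_eps n (f : cfun C gT) : cfun C (wreath gT n) :=
  cfMul (cf_eta n f) (cfSgn n).

End EtaEps.

Section RGamma.

Variables (C : numClosedFieldType) (gT : finGroupType).

(* the direct sum over n of the spaces R(Gamma_n) *)
Record RGamma := MkRGamma {
  RGcomp :> forall n, cfun C (wreath gT n);
  RGfin : exists N, forall n, (N <= n)%N -> RGcomp n = 0 }.

HB.instance Definition _ := gen_eqMixin RGamma.
HB.instance Definition _ := gen_choiceMixin RGamma.

Lemma RGammaP (F F' : RGamma) : (forall n, F n = F' n) -> F = F'.
Proof.
case: F F' => [F finF] [F' finF'] /= H.
have eqF : F = F' by apply: functional_extensionality_dep.
by move: finF'; rewrite -eqF => finF'; congr MkRGamma; apply: Prop_irrelevance.
Qed.

Fact RGzero_fin : exists N, forall n, (N <= n)%N ->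
  (0 : cfun C (wreath gT n)) = 0.
Proof. by exists 0. Qed.
Definition RGzero := MkRGamma RGzero_fin.

Fact RGadd_fin (F F' : RGamma) :
  exists N, forall n, (N <= n)%N -> F n + F' n = 0.
Proof.
case: (RGfin F) (RGfin F') => [N HN] [N' HN']; exists (maxn N N') => n.
by rewrite geq_max => /andP[/HN-> /HN'->]; rewrite addr0.
Qed.
Definition RGadd F F' := MkRGamma (RGadd_fin F F').

Fact RGscale_fin (a : C) (F : RGamma) :
  exists N, forall n, (N <= n)%N -> a *: F n = 0.
Proof. by case: (RGfin F) => N HN; exists N => n /HN->; rewrite scaler0. Qed.
Definition RGscale a F := MkRGamma (RGscale_fin a F).

Fact RGopp_fin (F : RGamma) : exists N, forall n, (N <= n)%N -> - F n = 0.
Proof. by case: (RGfin F) => N HN; exists N => n /HN->; rewrite oppr0. Qed.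
Definition RGopp F := MkRGamma (RGopp_fin F).

Fact RGaddA : associative RGadd.
Proof. by move=> F F' F''; apply: RGammaP => n /=; rewrite addrA. Qed.
Fact RGaddC : commutative RGadd.
Proof. by move=> F F'; apply: RGammaP => n /=; rewrite addrC. Qed.
Fact RGadd0 : left_id RGzero RGadd.
Proof. by move=> F; apply: RGammaP => n /=; rewrite add0r. Qed.
Fact RGaddN : left_inverse RGzero RGopp RGadd.
Proof. by move=> F; apply: RGammaP => n /=; rewrite addNr. Qed.

HB.instance Definition _ :=
  GRing.isZmodule.Build RGamma RGaddA RGaddC RGadd0 RGaddN.

Fact RGscaleA a b F : RGscale a (RGscale b F) = RGscale (a * b) F.
Proof. by apply: RGammaP => n /=; rewrite scalerA. Qed.
Fact RGscale1 : left_id 1 RGscale.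
Proof. by move=> F; apply: RGammaP => n /=; rewrite scale1r. Qed.
Fact RGscaleDr : right_distributive RGscale +%R.
Proof. by move=> a F F'; apply: RGammaP => n /=; rewrite scalerDr. Qed.
Fact RGscaleDl F : {morph RGscale^~ F : a b / a + b}.
Proof. by move=> a b; apply: RGammaP => n /=; rewrite scalerDl. Qed.

HB.instance Definition _ :=
  GRing.Zmodule_isLmodule.Build C RGamma RGscaleA RGscale1 RGscaleDr RGscaleDl.

(* the component in R(Gamma_k) of Ind (f (x) F), for f in R(Gamma_n) *)
Definition ind_comp n (f : cfun C (wreath gT n)) (F : RGamma) k :
    cfun C (wreath gT k) :=
  if @idP (n <= k)%N is ReflectT le_nk then
    cfInd (young (subnKC le_nk)) (cfExt f (F (k - n)%N))
  else 0.

Fact cfExt0 (G H : finGroupType) (f : cfun C G) : cfExt f (0 : cfun C H) = 0.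
Proof. by apply: cfunP => x; rewrite !ffunE mulr0. Qed.

Fact cfInd0 (G H : finGroupType) (iota : H -> G) : cfInd iota (0 : cfun C H) = 0.
Proof.
apply: cfunP => x; rewrite !ffunE big1 ?mulr0 // => z _.
by rewrite big1 // => h _; rewrite ffunE.
Qed.

Fact ind_op_fin n (f : cfun C (wreath gT n)) (F : RGamma) :
  exists N, forall k, (N <= k)%N -> ind_comp f F k = 0.
Proof.
case: (RGfin F) => N HN; exists (n + N)%N => k le_k; rewrite /ind_comp.
case: {-}_ / idP => // le_nk; rewrite HN ?cfExt0 ?cfInd0 //.
by rewrite leq_subRL // (leq_trans _ le_k) ?leq_addr.
Qed.
Definition ind_op n (f : cfun C (wreath gT n)) (F : RGamma) : RGamma :=
  MkRGamma (ind_op_fin f F).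

(* For n >= 0, H_cre n and E_cre n are the operators H_{-n} and E_{-n}, while
   H_ann n and E_ann n below are H_n and E_n. *)
Definition H_cre n (gamma : cfun C gT) := ind_op (cf_eta n gamma).
Definition E_cre n (gamma : cfun C gT) := ind_op (cf_eps n gamma).

Section Weighted.

Variable xi : cfun C gT.

Definition form_xi (f g : cfun C gT) : C := cfForm (cfMul xi f) g.

(* the component in R(Gamma_k) of the restriction of F to Gamma_n x Gamma_k
   paired with f on the first factor by <f, g>_xi = <eta_n(xi) * f, g> *)
Definition res_comp n (f : cfun C (wreath gT n)) (F : RGamma) k :
    cfun C (wreath gT k) :=
  cfContract (cfMul (cf_eta n xi) f)
    (cfRes (@youngM gT n k (n + k) erefl) (F (n + k)%N)).

Fact res_op_fin n (f : cfun C (wreath gT n)) (F : RGamma) :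
  exists N, forall k, (N <= k)%N -> res_comp f F k = 0.
Proof.
case: (RGfin F) => N HN; exists N => k le_k.
have -> : res_comp f F k = cfContract (cfMul (cf_eta n xi) f) 0.
  rewrite /res_comp HN; last by rewrite (leq_trans le_k) ?leq_addl.
  by congr cfContract; apply: cfunP => x; rewrite !ffunE.
apply: cfunP => x; rewrite !ffunE /cfForm big1 ?mulr0 // => z _.
by rewrite !ffunE mulr0.
Qed.
Definition res_op n (f : cfun C (wreath gT n)) (F : RGamma) : RGamma :=
  MkRGamma (res_op_fin f F).

Definition H_ann n (gamma : cfun C gT) := res_op (cf_eta n gamma).
Definition E_ann n (gamma : cfun C gT) := res_op (cf_eps n gamma).

End Weighted.

End RGamma.

Section SGamma.

Variables (C : numClosedFieldType) (gT : finGroupType).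

(* The variable (k, i) stands for a_{-(k+1)}(gamma_i). *)
Definition SVar := (nat * Irr C gT)%type.
Definition SGamma := {malg C[{cmonom SVar}]}.

Definition Smon (m : {cmonom SVar}) : SGamma := mkmalgU m 1.

(* a_{-n}(gamma_i), for n >= 1 *)
Definition a_gen (n : nat) (i : Irr C gT) : SGamma :=
  Smon (ucm ((n.-1, i) : SVar)).

Definition a_lin (n : nat) (gamma : cfun C gT) : SGamma :=
  \sum_(i : Irr C gT) irr_coef gamma i *: a_gen n i.

Definition a_cre (n : nat) (gamma : cfun C gT) (v : SGamma) : SGamma :=
  a_lin n gamma * v.

(* Sderiv d is the derivation of S_Gamma mapping each variable v to d v. *)
Definition Smderiv (d : SVar -> SGamma) (m : {cmonom SVar}) : SGamma :=
  \sum_(v <- finsupp m) (m v)%:R *: (d v * Smon (divcm m (ucm v))).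

Definition Sderiv (d : SVar -> SGamma) (p : SGamma) : SGamma :=
  \sum_(m <- msupp p) p@_m *: Smderiv d m.

Section SderivTheory.

Variable d : SVar -> SGamma.

Let SderivE : Sderiv d =1 mmap (malgC : C -> SGamma) (Smderiv d).
Proof.
by move=> p; rewrite /Sderiv mmapE; apply: eq_bigr => m _; rewrite mul_malgC.
Qed.

Lemma SderivD : {morph Sderiv d : p q / p + q}.
Proof. by move=> p q; rewrite !SderivE mmapD. Qed.

Lemma SderivZ a : {morph Sderiv d : p / a *: p}.
Proof.
move=> p; have -> : Sderiv d (a *: p) =
    \sum_(m <- msupp p) (a *: p)@_m *: Smderiv d m.
  rewrite /Sderiv (big_fset_incl _ (msuppZ_le a p)) //= => m _.
  by move=> /mcoeff_outdom->; rewrite scale0r.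
rewrite /Sderiv scaler_sumr; apply: eq_bigr => m _.
rewrite mcoeffZ; exact: (esym (scalerA a p@_m (Smderiv d m))).
Qed.

Let Sderiv_mon m : Sderiv d (Smon m) = Smderiv d m.
Proof. by rewrite SderivE mmapU mul1r. Qed.

Lemma Sderiv_var v : Sderiv d (Smon (ucm v)) = d v.
Proof.
rewrite Sderiv_mon /Smderiv mdomU big_seq_fset1 cmUU scale1r.
suff -> : divcm (ucm v) (ucm v) = onecm _ by rewrite mulr1.
by apply/eqP/cmP => i; rewrite divcmE onecmE subnn.
Qed.

Let SmonM (m1 m2 : {cmonom SVar}) : Smon m1 * Smon m2 = Smon (mulcm m1 m2).
Proof. by rewrite /Smon malgM_def fgmulUU mulr1. Qed.

Let SmderivEw (m : {cmonom SVar}) (e : {fset SVar}) : (finsupp m `<=` e)%fset ->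
  Smderiv d m = \sum_(v <- e) (m v)%:R *: (d v * Smon (divcm m (ucm v))).
Proof.
move=> le_me; rewrite /Smderiv (big_fset_incl _ le_me) //= => v _.
by rewrite -cmE_eq0 => /eqP->; rewrite scale0r.
Qed.

Let Smderiv_half (m1 m2 : {cmonom SVar}) v :
  (m1 v)%:R *: (d v * Smon (divcm (mulcm m1 m2) (ucm v)))
    = (m1 v)%:R *: (d v * Smon (divcm m1 (ucm v))) * Smon m2.
Proof.
case: (posnP (m1 v)) => [->|m1v].
  rewrite mulr0n [LHS]scale0r (scale0r (d v * Smon (divcm m1 (ucm v)))).
  by rewrite (mul0r (Smon m2)).
rewrite -scalerAl -mulrA SmonM; congr (_ *: (_ * Smon _)).
apply/eqP/cmP => i; rewrite divcmE !mulcmE divcmE ucmE.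
by have [<-|_] := eqVneq v i; rewrite ?subn0 // addnBAC.
Qed.

Let SmderivM (m1 m2 : {cmonom SVar}) :
  Smderiv d (mulcm m1 m2) = Smderiv d m1 * Smon m2 + Smon m1 * Smderiv d m2.
Proof.
have mulC m m' : mulcm m m' = mulcm m' m :> {cmonom SVar} by exact: mulcmC.
set e := (finsupp m1 `|` finsupp m2)%fset.
have E1 : Smderiv d m1 * Smon m2 = \sum_(v <- e)
    (m1 v)%:R *: (d v * Smon (divcm m1 (ucm v))) * Smon m2.
  rewrite (@SmderivEw m1 e); first exact: mulr_suml.
  exact: fsubsetUl.
have E2 : Smon m1 * Smderiv d m2 = \sum_(v <- e)
    (m2 v)%:R *: (d v * Smon (divcm m2 (ucm v))) * Smon m1.
  rewrite (mulrC (Smon m1) (Smderiv d m2)) (@SmderivEw m2 e); first exact: mulr_suml.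
  exact: fsubsetUr.
rewrite E1 E2 (@SmderivEw _ e); last by rewrite /e -(mdomD m1 m2).
rewrite -big_split; apply: eq_bigr => v _ /=.
rewrite mulcmE natrD; apply: etrans (scalerDl _ _ _) _; congr (_ + _).
  exact: Smderiv_half.
by rewrite mulC; exact: Smderiv_half.
Qed.

Lemma SderivM p q : Sderiv d (p * q) = Sderiv d p * q + p * Sderiv d q.
Proof.
have sumD (e : seq {cmonom SVar}) (F : {cmonom SVar} -> SGamma) :
    Sderiv d (\sum_(m <- e) F m) = \sum_(m <- e) Sderiv d (F m).
  by apply: (big_morph _ SderivD); rewrite SderivE mmap0.
have monE (r : SGamma) : r = \sum_(m <- msupp r) r@_m *: Smon m.
  rewrite {1}[r]monalgE; apply: eq_bigr => m _.
  apply/malgP => k; rewrite (mcoeffU m r@_m k) (mcoeffZ r@_m (Smon m) k).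
  by rewrite (mcoeffU m 1 k) mulr_natr.
pose L p q := Sderiv d (p * q) = Sderiv d p * q + p * Sderiv d q.
have LC p1 q1 : L p1 q1 -> L q1 p1.
  move=> E; have Epq := congr1 (Sderiv d) (mulrC q1 p1).
  apply: (etrans Epq (etrans E _)); apply: (etrans (addrC _ _)).
  exact: (congr2 +%R (mulrC p1 (Sderiv d q1)) (mulrC (Sderiv d p1) q1)).
have L0 q1 : L 0 q1.
  have D0 : Sderiv d 0 = 0 by rewrite SderivE mmap0.
  by rewrite /L D0 !mul0r D0 addr0.
have LD p1 p2 q1 : L p1 q1 -> L p2 q1 -> L (p1 + p2) q1.
  move=> E1 E2; have EM := congr1 (Sderiv d) (mulrDl p1 p2 q1).
  apply: (etrans EM); apply: (etrans (SderivD _ _)).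
  apply: (etrans (congr2 +%R E1 E2)); apply: (etrans (addrACA _ _ _ _)).
  rewrite SderivD; apply/esym.
  exact: (congr2 +%R (mulrDl (Sderiv d p1) (Sderiv d p2) q1)
    (mulrDl p1 p2 (Sderiv d q1))).
have LZ a p1 q1 : L p1 q1 -> L (a *: p1) q1.
  move=> E; have EM := congr1 (Sderiv d) (esym (scalerAl a p1 q1)).
  apply: (etrans EM); apply: (etrans (SderivZ _ _)).
  apply: (etrans (congr1 ( *:%R a) E)); apply: (etrans (scalerDr _ _ _)).
  rewrite SderivZ.
  exact: (congr2 +%R (scalerAl a (Sderiv d p1) q1)
    (scalerAl a p1 (Sderiv d q1))).
have Lmon q1 : (forall m, L (Smon m) q1) -> forall p1, L p1 q1.
  move=> H p1; rewrite [p1]monE; elim/big_ind: _ => [|p2 p3|m _].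
  - exact: L0.
  - exact: LD.
  - exact/LZ/H.
apply: (Lmon) => m; apply: LC; apply: (Lmon) => m'.
apply: (etrans (congr1 (Sderiv d) (SmonM m' m))).
apply: (etrans (Sderiv_mon _)); apply: (etrans (SmderivM m' m)); apply/esym.
exact: (congr2 +%R (congr1 ( *%R^~ (Smon m)) (Sderiv_mon m'))
  (congr1 ( *%R (Smon m')) (Sderiv_mon m))).
Qed.

End SderivTheory.

Definition a_ann (xi : cfun C gT) (n : nat) (gamma : cfun C gT) :
    SGamma -> SGamma :=
  Sderiv (fun v => if v.1.+1 == n then (n%:R * form_xi xi gamma (chi v.2))%:A
                   else 0).

Definition Cls := {c : {set gT} | c \in classes [set: gT]}.

Definition cls_rep (c : Cls) : gT := repr (val c).

(* a_{-n}(c) *)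
Definition a_cls (n : nat) (c : Cls) : SGamma :=
  \sum_(i : Irr C gT) chi i (cls_rep c)^-1%g *: a_gen n i.

(* A family of partitions rho is given by multiplicities: rho c i is the number
   of parts of rho(c) that are equal to i + 1.  The families of total size n are
   the rho : pfam n with pfam_size rho = n. *)
Definition pfam n := {ffun Cls -> {ffun 'I_n -> 'I_n.+1}}.

Definition pfam_size n (rho : pfam n) : nat :=
  (\sum_c \sum_(i < n) i.+1 * rho c i)%N.

Definition plength n (l : {ffun 'I_n -> 'I_n.+1}) : nat := (\sum_(i < n) l i)%N.
Definition pz n (l : {ffun 'I_n -> 'I_n.+1}) : nat :=
  (\prod_(i < n) (i.+1 ^ l i * (l i)`!))%N.

Definition Zrho n (rho : pfam n) : nat :=
  (\prod_c (pz (rho c) * #|'C[cls_rep c]%g| ^ plength (rho c)))%N.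

Definition a_rho n (rho : pfam n) : SGamma :=
  \prod_c \prod_(i < n) a_cls i.+1 c ^+ rho c i.

(* g_(i_k) ... g_(i_1) for the cycle (i_1 ... i_k) of wperm x with i_1 = j *)
Definition cycle_prod n (x : wreath gT n) (j : 'I_n) : gT :=
  (\prod_(i <- rev (traject (wperm x) j #|porbit (wperm x) j|)) wbase x i)%g.

Definition has_type n (x : wreath gT n) (rho : pfam n) : bool :=
  [forall c : Cls, forall i : 'I_n,
    #|[set A in porbits (wperm x) | (#|A| == i.+1) &&
        [exists j in A, cycle_prod x j \in val c]]| == rho c i].

(* the value of f at type rho *)
Definition at_type n (f : cfun C (wreath gT n)) (rho : pfam n) : C :=
  if [pick x | has_type x rho] is Some x then f x else 0.

Definition ch_hom n (f : cfun C (wreath gT n)) : SGamma :=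
  \sum_(rho : pfam n | pfam_size rho == n)
    ((Zrho rho)%:R^-1 * at_type f rho) *: a_rho rho.

Definition ch (F : RGamma C gT) : SGamma :=
  \sum_(n \in [set: nat]%classic) ch_hom (F n).

(* the inverse of the bijection ch *)
Definition ch_inv (v : SGamma) : RGamma C gT :=
  xget 0 [set F | ch F = v]%classic.

(* ch (T) for an operator T on R_Gamma *)
Definition ch_op (T : RGamma C gT -> RGamma C gT) : SGamma -> SGamma :=
  fun v => ch (T (ch_inv v)).

End SGamma.

(** Formal power series whose coefficients are operators on V: A n is the
    coefficient of w^n, where the variable w is z for the series with index +
    and z^-1 for those with index -. *)

Section OpSeries.

Variables (C : numClosedFieldType) (V : lmodType C).

Definition opser := nat -> V -> V.

Definition opser_one : opser := fun n v => if n == 0%N then v else 0.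

Definition opser_opp (A : opser) : opser := fun n v => - A n v.

Definition opser_mul (A B : opser) : opser :=
  fun n v => \sum_(i < n.+1) A i (B (n - i)%N v).

Definition opser_pow (A : opser) (k : nat) : opser :=
  iter k (opser_mul A) opser_one.

(* For A with zero constant term, A^k does not contribute to w^n if k > n. *)
Definition opser_exp (A : opser) : opser :=
  fun n v => \sum_(k < n.+1) (k`!)%:R^-1 *: opser_pow A k n v.

End OpSeries.

Section VertexSeries.

Variables (C : numClosedFieldType) (gT : finGroupType).
Variables (xi gamma : cfun C gT).

Definition H_plus : opser (RGamma C gT) := fun n => H_cre n gamma.
Definition E_plus : opser (RGamma C gT) :=
  fun n F => (-1) ^+ n *: E_cre n gamma F.
Definition H_minus : opser (RGamma C gT) := fun n => H_ann xi n gamma.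
Definition E_minus : opser (RGamma C gT) :=
  fun n F => (-1) ^+ n *: E_ann xi n gamma F.

Definition ch_ser (A : opser (RGamma C gT)) : opser (SGamma C gT) :=
  fun n => ch_op (A n).

(* sum_(n >= 1) n^-1 a_{-n}(gamma) z^n and sum_(n >= 1) n^-1 a_n(gamma) z^-n *)
Definition a_plus : opser (SGamma C gT) :=
  fun n v => if n == 0%N then 0 else n%:R^-1 *: a_cre n gamma v.
Definition a_minus : opser (SGamma C gT) :=
  fun n v => if n == 0%N then 0 else n%:R^-1 *: a_ann xi n gamma v.

End VertexSeries.

(* Main.v *)
(** For a class function [f] on Gamma_n, ch (f) is the mean over [x] in Gamma_n of
    [f x] times the product, over the cycles of [x], of the power sums
    a_{-k}(c), for [k] the length of the cycle and [c] the class of its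
    cycle-product; this holds because elements of the same type are conjugate and
    the number of elements of type rho is |Gamma_n| / Z_rho.  By Frobenius
    reciprocity ch then turns induction products into products.

    A double count of the pairs (x, S), with [S] a union of cycles of [x], against
    the elements of Young subgroups, gives all other identities: marking a single
    cycle yields the recursion n h_n = sum_k p_k h_{n-k} for the means h_n of a
    multiplicative function, which characterizes the exponential; marking a set of
    cycles identifies H_n(gamma) with the z^n-coefficient of the multiplicative
    function taking the value a_{-k}(c) + (xi * gamma)(c^{-1}) z^k on the cycles,
    and this coefficient satisfies the same recursion for the derivations
    a_k(gamma).

    That eta_n(f) is the multiplicative function with value f on cycle-products
    follows from the trace of a tensor power, the expansion of prod (a + b) over
    the cycles, and the Zariski density of natural coordinates. *)

Require Import Defs.
From mathcomp Require Import all_boot all_fingroup all_algebra reals complex.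
From mathcomp Require Import mxrepresentation pgroup zify ring.
From mathcomp Require character mpoly finmap monalg classical_sets fsbigop.

Set Implicit Arguments.
Unset Strict Implicit.
Unset Printing Implicit Defensive.

Import GroupScope GRing.Theory Num.Theory.
Local Open Scope ring_scope.

(** * Cycle products in wreath products *)

(** Working with means over the group removes partitions from the argument: types return only in
    [mean_wtype], which matches the mean with the definition of ch. A set of cycles is encoded by
    the points that it covers, a subset stable under the permutation, so that conjugations and both
    halves of a Young embedding are instances of one notion, [wreath_emb]. The exponentials are
    never manipulated as such: for T = exp(A), the Euler operator gives n T_n = sum_i i A_i T_{n-i},
    and since n is invertible this recursion and T_0 determine T. On the annihilation side, the
    exponential of sum_k z^k delta_k / k, with delta_k a derivation, is formally the algebra
    morphism that translates the power sum psi_k(g) by theta(g^-1) z^k, where theta = xi gamma; this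
    is the origin of [cycle_poly]. The series E are the series H of -gamma, because (-1)^n
    eps_n(gamma) = eta_n(-gamma). *)

Section CycleProducts.

Variable gT : finGroupType.

Lemma wpermX n (x : wreath gT n) l : wperm (x ^+ l)%g = (wperm x ^+ l)%g.
Proof.
elim: l => [|l IHl]; first by rewrite !expg0.
by rewrite expgS expgSr -IHl.
Qed.

Lemma wbase_conj_fix n (w z : wreath gT n) (i : 'I_n) :
    wperm w (wperm z i) = wperm z i ->
  wbase (w ^ z)%g i = (wbase w (wperm z i) ^ wbase z (wperm z i))%g.
Proof.
move=> fix_i; have fixV : (wperm w)^-1%g (wperm z i) = wperm z i.
  by rewrite -{1}fix_i permK.
by rewrite /conjg /= !ffunE /= ?ffunE /= invgK fixV.
Qed.

(** A cycle-product becomes one base entry of a power of [x], so conjugation and inversion act on it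
    through the group law instead of through its list of factors. *)
Lemma cycle_prod_wbaseX n (x : wreath gT n) j :
  cycle_prod x j =
    wbase (x ^+ #|porbit (wperm x) j|)%g ((wperm x)^-1%g j).
Proof.
(* Rewriting [j] as the end of its own orbit gives a statement that makes sense for trajectories of
   any positive length, on which induction works. *)
rewrite /cycle_prod -[X in _ = wbase _ (_ X)](iter_porbit (wperm x)).
case: #|_| (card_porbit_neq0 (wperm x) j) => // l _.
elim: l => [|l IHl]; first by rewrite /= big_seq1 permK.
rewrite trajectSr rev_rcons big_cons IHl [in RHS]expgS /= ffunE.
by rewrite !permK.
Qed.

(** The cycle-products need only be conjugate, with a conjugator depending on the point, because
    conjugation by [z] twists each of them by an entry of its base. *)
Definition wreath_emb m n (f : 'I_m -> 'I_n) (x : wreath gT m)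
    (y : wreath gT n) :=
  [/\ injective f, forall a, f (wperm x a) = wperm y (f a) &
      forall a, exists g, cycle_prod y (f a) = (cycle_prod x a ^ g)%g].

Lemma porbit_emb m n (f : 'I_m -> 'I_n) (s : 'S_m) (t : 'S_n) a :
  (forall a, f (s a) = t (f a)) -> porbit t (f a) = f @: porbit s a.
Proof.
move=> fM; have fX k b : f ((s ^+ k)%g b) = (t ^+ k)%g (f b).
  by rewrite !permX; elim: k => //= k IHk; rewrite fM IHk.
apply/setP => i; apply/porbitP/imsetP => [[k ->]|[b /porbitP[k ->] ->]].
  by exists ((s ^+ k)%g a); rewrite ?fX // mem_porbit.
by exists k; rewrite fX.
Qed.

(** With [l] the length of a cycle, [x ^+ l] fixes its points, and at a fixed point the base entry
    is just conjugated ([wbase_conj_fix]). Since [x ^ z] is z^-1 x z with permutations composed as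
    functions, [wperm z] carries the cycles of [x ^ z] to those of [x]. *)
Lemma wreath_emb_conj n (x z : wreath gT n) :
  wreath_emb (wperm z) (x ^ z)%g x.
Proof.
have zM a : wperm z (wperm (x ^ z)%g a) = wperm x (wperm z a).
  by rewrite /conjg /= !permM permKV.
split=> // [|a]; first exact: perm_inj.
have Eorb := porbit_emb a zM.
have Ecard : #|porbit (wperm x) (wperm z a)| = #|porbit (wperm (x ^ z)%g) a|.
  by rewrite Eorb card_imset //; apply: perm_inj.
set b := (wperm (x ^ z)%g)^-1%g a.
have Eb : (wperm x)^-1%g (wperm z a) = wperm z b.
  by apply: (@perm_inj _ (wperm x)); rewrite permKV -zM permKV.
exists (wbase z (wperm z b))^-1%g; rewrite !cycle_prod_wbaseX Eb Ecard -conjXg.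
rewrite [in RHS]wbase_conj_fix ?conjgK //.
rewrite wpermX -Ecard -Eb; apply: (@perm_inj _ (wperm x)).
by rewrite -permM -expgSr expgS permM permKV permX iter_porbit.
Qed.

(** Conjugating [x] by itself leaves it unchanged but moves the starting point one step along the
    cycle. *)
Lemma cycle_prod_perm n (x : wreath gT n) a :
  exists g, cycle_prod x (wperm x a) = (cycle_prod x a ^ g)%g.
Proof. by case: (wreath_emb_conj x x) => _ _ /(_ a); rewrite conjgE mulKg. Qed.

Lemma cycle_prod_porbit n (x : wreath gT n) a b :
  b \in porbit (wperm x) a -> exists g, cycle_prod x b = (cycle_prod x a ^ g)%g.
Proof.
case/porbitP => k ->; elim: k => [|k [g IHk]].
  by exists 1%g; rewrite expg0 perm1 conjg1.
have [h Eh] := cycle_prod_perm x ((wperm x ^+ k)%g a).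
by exists (g * h)%g; rewrite expgSr permM Eh IHk conjgM.
Qed.

(** These sets are the unions of cycles, the marked sets of the double count. *)
Definition stab n (x : wreath gT n) (S : {set 'I_n}) :=
  [forall i, (wperm x i \in S) == (i \in S)].

Lemma stabP n (x : wreath gT n) (S : {set 'I_n}) :
  reflect (forall i, (wperm x i \in S) = (i \in S)) (stab x S).
Proof. by apply: (iffP forallP) => H i; apply/eqP. Qed.

Lemma stab_sub n (x : wreath gT n) (S : {set 'I_n}) :
  (forall i, i \in S -> wperm x i \in S) -> stab x S.
Proof.
move=> H; have sub : wperm x @: S \subset S.
  by apply/subsetP => _ /imsetP[i /H iS ->].
have E : wperm x @: S = S.
  by apply/eqP; rewrite eqEcard sub card_imset ?leqnn //; apply: perm_inj.
by apply/stabP => i; rewrite -{1}E mem_imset //; apply: perm_inj.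
Qed.

Lemma stabC n (x : wreath gT n) S : stab x (~: S) = stab x S.
Proof.
apply/stabP/stabP => H i; last by rewrite !in_setC H.
by apply: negb_inj; rewrite -!in_setC.
Qed.

Lemma stab_porbit n (x : wreath gT n) (S : {set 'I_n}) i j :
  stab x S -> j \in porbit (wperm x) i -> (j \in S) = (i \in S).
Proof.
move/stabP => H /porbitP[k ->]; elim: k => [|k IHk]; first by rewrite perm1.
by rewrite expgSr permM H.
Qed.

Lemma stab_porbits n (x : wreath gT n) A :
  A \in porbits (wperm x) -> stab x A.
Proof.
case/imsetP => i _ ->; apply: stab_sub => j.
case/porbitP => k ->; rewrite -permM -expgSr; exact: mem_porbit.
Qed.

Lemma stab_emb m n (f : 'I_m -> 'I_n) x y (S : {set 'I_m}) :
  wreath_emb f x y -> stab y (f @: S) = stab x S.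
Proof.
case=> injf fM _; apply/idP/idP => /stabP H.
  by apply/stabP => i; move: (H (f i)); rewrite -fM !mem_imset.
by apply: stab_sub => _ /imsetP[i iS ->]; rewrite -fM imset_f // H.
Qed.

Section Weights.

(* The default [d] is the value at the empty set only. *)
Variables (T : Type) (d : T) (phi : nat -> gT -> T).

Definition cyc_val n (x : wreath gT n) (A : {set 'I_n}) : T :=
  oapp (fun j => phi #|A| (cycle_prod x j)) d [pick j in A].

Hypothesis phiJ : forall k g h, phi k (g ^ h)%g = phi k g.

(** Another starting point only conjugates the cycle-product, which [phiJ] ignores. *)
Lemma cyc_valE n (x : wreath gT n) A j :
  A \in porbits (wperm x) -> j \in A -> cyc_val x A = phi #|A| (cycle_prod x j).
Proof.
case/imsetP => i _ -> ji; rewrite /cyc_val; case: pickP => [k|/(_ j)] /=.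
  move=> ki; have [g ->] := cycle_prod_porbit ki.
  by have [h ->] := cycle_prod_porbit ji; rewrite !phiJ.
by rewrite ji.
Qed.

Lemma cyc_val_emb m n (f : 'I_m -> 'I_n) x y (A : {set 'I_m}) :
  wreath_emb f x y -> A \in porbits (wperm x) ->
  cyc_val y (f @: A) = cyc_val x A.
Proof.
move=> embf; have [injf fM Hf] := embf; case/imsetP=> i _ ->.
rewrite (@cyc_valE _ y _ (f i)); last 2 first.
- by rewrite -(porbit_emb i fM) imset_f.
- by rewrite imset_f ?porbit_id.
rewrite (@cyc_valE _ x _ i) ?imset_f ?porbit_id //.
by have [g ->] := Hf i; rewrite phiJ card_imset.
Qed.

End Weights.

Lemma porbits_emb m n (f : 'I_m -> 'I_n) (x : wreath gT m) y (A : {set 'I_m}) :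
  wreath_emb f x y ->
  (f @: A \in porbits (wperm y)) = (A \in porbits (wperm x)).
Proof.
case=> injf fM _; apply/imsetP/imsetP => [[i _ E]|[i _ ->]].
  have /imsetP[a _ Ea] : i \in f @: A by rewrite E porbit_id.
  by exists a => //; apply: (imset_inj injf); rewrite E Ea (porbit_emb a fM).
by exists (f i); rewrite ?(porbit_emb i fM).
Qed.

Lemma porbits_emb_sub m n (f : 'I_m -> 'I_n) (x : wreath gT m) y (S : {set 'I_m})
  B :
    wreath_emb f x y -> B \in porbits (wperm y) -> B \subset f @: S ->
  exists2 A, A \in porbits (wperm x) & (A \subset S) && (B == f @: A).
Proof.
move=> embf By sub; have [injf fM _] := embf.
have EB : B = f @: (f @^-1: B).
  apply/setP => b; apply/idP/imsetP => [bB|[a]]; last by rewrite inE => ? ->.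
  by have /imsetP[a aS Eb] := subsetP sub _ bB; exists a; rewrite ?inE -?Eb.
exists (f @^-1: B); first by rewrite -(porbits_emb _ embf) -EB.
rewrite -EB eqxx andbT; apply/subsetP => a; rewrite inE => /(subsetP sub).
by rewrite mem_imset.
Qed.

Lemma big_porbits_emb (R : Type) (idx : R) (op : Monoid.com_law idx)
    m n (f : 'I_m -> 'I_n) (x : wreath gT m) y (S : {set 'I_m}) F :
  wreath_emb f x y ->
  \big[op/idx]_(B in porbits (wperm y) | B \subset f @: S) F B =
  \big[op/idx]_(A in porbits (wperm x) | A \subset S) F (f @: A).
Proof.
move=> embf; have [injf _ _] := embf.
rewrite (eq_bigl (mem ((fun A : {set 'I_m} => f @: A) @:
    [pred A : {set 'I_m} | (A \in porbits (wperm x)) && (A \subset S)]))).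
  by rewrite big_imset //= => A B _ _; apply: imset_inj.
move=> B; apply/idP/imsetP => [/andP[By]|[A]].
  by case/(porbits_emb_sub embf By) => A Ax /andP[AS /eqP->]; exists A;
    rewrite // inE Ax.
by rewrite inE => /andP[Ax AS] ->; rewrite (porbits_emb _ embf) Ax imsetS.
Qed.

End CycleProducts.

(** * Young subgroups *)

Section YoungSubgroup.

Variables (gT : finGroupType) (p q k : nat) (e : (p + q = k)%N).

Local Notation yg := (young (gT := gT) e).

Definition ylft (a : 'I_p) : 'I_k := young_unsplit e (inl a).
Definition yrgt (b : 'I_q) : 'I_k := young_unsplit e (inr b).

Lemma ylft_inj : injective ylft.
Proof. by move=> a b /(can_inj (young_unsplitK e)) []. Qed.

Lemma yrgt_inj : injective yrgt.
Proof. by move=> a b /(can_inj (young_unsplitK e)) []. Qed.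

Lemma ysplitP i : (exists a, i = ylft a) \/ (exists b, i = yrgt b).
Proof.
rewrite -(young_splitK e i).
by case: (young_split e i) => a; [left|right]; exists a.
Qed.

Lemma ylft_neq a b : ylft a != yrgt b.
Proof. by apply/eqP => /(can_inj (young_unsplitK e)). Qed.

Definition yset : {set 'I_k} := ylft @: [set: 'I_p].

Lemma mem_yset_lft a : ylft a \in yset.
Proof. exact: imset_f. Qed.

Lemma mem_yset_rgt b : (yrgt b \in yset) = false.
Proof. by apply/imsetP => -[a _ /eqP]; rewrite eq_sym (negPf (ylft_neq _ _)). Qed.

Lemma ysetC : ~: yset = yrgt @: [set: 'I_q].
Proof.
apply/setP => i; rewrite in_setC; have [[a ->]|[b ->]] := ysplitP i.
  rewrite mem_yset_lft; apply/esym/imsetP => -[b _ /eqP].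
  by rewrite (negPf (ylft_neq _ _)).
by rewrite mem_yset_rgt imset_f.
Qed.

Lemma card_yset : #|yset| = p.
Proof. by rewrite card_imset ?cardsT ?card_ord //; apply: ylft_inj. Qed.

Lemma wperm_young_lft h a : wperm (yg h) (ylft a) = ylft (wperm h.1 a).
Proof. by rewrite permE young_unsplitK. Qed.

Lemma wperm_young_rgt h b : wperm (yg h) (yrgt b) = yrgt (wperm h.2 b).
Proof. by rewrite permE young_unsplitK. Qed.

Lemma wbase_young_lft h a : wbase (yg h) (ylft a) = wbase h.1 a.
Proof. by rewrite ffunE young_unsplitK. Qed.

Lemma wbase_young_rgt h b : wbase (yg h) (yrgt b) = wbase h.2 b.
Proof. by rewrite ffunE young_unsplitK. Qed.

Lemma cycle_prod_map m n (f : 'I_m -> 'I_n) (x : wreath gT m)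
    (y : wreath gT n) a :
    injective f -> (forall a, f (wperm x a) = wperm y (f a)) ->
    (forall a, wbase y (f a) = wbase x a) ->
  cycle_prod y (f a) = cycle_prod x a.
Proof.
move=> injf fM fb; rewrite /cycle_prod (porbit_emb a fM) card_imset //.
have -> l : traject (wperm y) (f a) l = map f (traject (wperm x) a l).
  by elim: l a => //= l IHl a; rewrite -fM IHl.
by rewrite -map_rev big_map; apply: eq_bigr => i _; apply: fb.
Qed.

Lemma wreath_emb_lft h : wreath_emb ylft h.1 (yg h).
Proof.
have H a : ylft (wperm h.1 a) = wperm (yg h) (ylft a).
  by rewrite wperm_young_lft.
split=> // [|a]; first exact: ylft_inj.
exists 1%g; rewrite conjg1; apply: cycle_prod_map => //; first exact: ylft_inj.
by move=> b; rewrite wbase_young_lft.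
Qed.

Lemma wreath_emb_rgt h : wreath_emb yrgt h.2 (yg h).
Proof.
have H a : yrgt (wperm h.2 a) = wperm (yg h) (yrgt a).
  by rewrite wperm_young_rgt.
split=> // [|a]; first exact: yrgt_inj.
exists 1%g; rewrite conjg1; apply: cycle_prod_map => //; first exact: yrgt_inj.
by move=> b; rewrite wbase_young_rgt.
Qed.

Lemma young_inj : injective yg.
Proof.
move=> h h' E; have E1 a : ylft (wperm h.1 a) = ylft (wperm h'.1 a).
  by rewrite -!wperm_young_lft E.
have E2 b : yrgt (wperm h.2 b) = yrgt (wperm h'.2 b).
  by rewrite -!wperm_young_rgt E.
rewrite [h]surjective_pairing [h']surjective_pairing; congr (_, _).
  apply: wreathP => [a|]; first by rewrite -!wbase_young_lft E.
  by apply/permP => a; apply: ylft_inj.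
apply: wreathP => [a|]; first by rewrite -!wbase_young_rgt E.
by apply/permP => a; apply: yrgt_inj.
Qed.

Lemma stab_young h : stab (yg h) yset.
Proof.
apply: stab_sub => _ /imsetP[a _ ->].
by rewrite wperm_young_lft mem_yset_lft.
Qed.

(** The Young subgroup is the full setwise stabilizer of its first block: permutation and base
    restrict to the two blocks, and the base is unconstrained. *)
Lemma stab_youngP (z : wreath gT k) :
  stab z yset -> exists h, yg h = z.
Proof.
move=> Sz; have SzC := Sz; rewrite -stabC ysetC in SzC.
have Hl a : {b | wperm z (ylft a) == ylft b}.
  apply: sigW; have : wperm z (ylft a) \in yset.
    by rewrite (stabP _ _ Sz) mem_yset_lft.
  by case/imsetP => b _ ->; exists b.
have Hr a : {b | wperm z (yrgt a) == yrgt b}.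
  apply: sigW; have : wperm z (yrgt a) \in yrgt @: [set: 'I_q].
    by rewrite (stabP _ _ SzC) imset_f.
  by case/imsetP => b _ ->; exists b.
pose fl a := sval (Hl a); pose fr a := sval (Hr a).
have flE a : wperm z (ylft a) = ylft (fl a) by apply/eqP/(svalP (Hl a)).
have frE a : wperm z (yrgt a) = yrgt (fr a) by apply/eqP/(svalP (Hr a)).
have fl_inj : injective fl.
  by move=> a b E; apply/ylft_inj/(@perm_inj _ (wperm z)); rewrite !flE E.
have fr_inj : injective fr.
  by move=> a b E; apply/yrgt_inj/(@perm_inj _ (wperm z)); rewrite !frE E.
exists (Wreath [ffun a => wbase z (ylft a)] (perm fl_inj),
        Wreath [ffun b => wbase z (yrgt b)] (perm fr_inj)).
apply: wreathP => [i|].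
  have [[a ->]|[b ->]] := ysplitP i.
    by rewrite wbase_young_lft ffunE.
  by rewrite wbase_young_rgt ffunE.
apply/permP => i; have [[a ->]|[b ->]] := ysplitP i.
  by rewrite wperm_young_lft permE flE.
by rewrite wperm_young_rgt permE frE.
Qed.

Lemma card_stab_yset :
  #|[set z : wreath gT k | stab z yset]| = (#|{: wreath gT p * wreath gT q}|)%N.
Proof.
rewrite -(card_codom young_inj); apply: eq_card => z; rewrite inE.
by apply/idP/codomP => [/stab_youngP[h <-]|[h ->]]; [exists h|apply: stab_young].
Qed.

Lemma stab_imset n (z : wreath gT n) (S : {set 'I_n}) :
  stab z S = (wperm z @: S == S).
Proof.
apply/idP/eqP => [H|E]; last first.
  by apply: stab_sub => i iS; rewrite -E imset_f.
apply/eqP; rewrite eqEcard card_imset ?leqnn ?andbT; last exact: perm_inj.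
by apply/subsetP => _ /imsetP[i iS ->]; rewrite (stabP _ _ H).
Qed.

Lemma exists_perm_imset n (A B : {set 'I_n}) :
  #|A| = #|B| -> exists s : 'S_n, s @: A = B.
Proof.
move=> EAB; have ECAB : #|~: A| = #|~: B|.
  by apply: (@addnI #|A|); rewrite cardsC EAB cardsC.
(* Each set is listed before its complement, and the permutation matches positions in the two lists;
   equal cardinals make the initial segments correspond. *)
pose sA := enum A ++ enum (~: A); pose sB := enum B ++ enum (~: B).
have uniqs (D : {set 'I_n}) : uniq (enum D ++ enum (~: D)).
  rewrite cat_uniq !enum_uniq /= andbT; apply/hasPn => i.
  by rewrite !mem_enum in_setC.
have mems (D : {set 'I_n}) i : i \in enum D ++ enum (~: D).
  by rewrite mem_cat !mem_enum in_setC orbN.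
have sz (D : {set 'I_n}) : size (enum D ++ enum (~: D)) = n.
  by rewrite size_cat -!cardE cardsC card_ord.
pose f i := nth i sB (index i sA).
have ltB i : (index i sA < size sB)%N by have -> : size sB = size sA;
  rewrite ?index_mem ?mems // !sz.
have injf : injective f.
  move=> i j; rewrite /f (set_nth_default i j) // => /eqP.
  rewrite nth_uniq ?uniqs // => /eqP E.
  by move: (nth_index i (mems A i)); rewrite E nth_index ?mems.
exists (perm injf); apply/eqP; rewrite eqEcard card_imset ?EAB ?leqnn ?andbT;
  last exact: perm_inj.
apply/subsetP => _ /imsetP[i iA ->]; rewrite permE /f.
rewrite index_cat mem_enum iA nth_cat.
have lt : (index i (enum A) < size (enum B))%N by rewrite -cardE -EAB cardE
  index_mem mem_enum.
by rewrite lt -mem_enum mem_nth.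
Qed.

(** These elements form a left coset of the stabilizer of [yset]. *)
Lemma card_wperm_imset (S : {set 'I_k}) : #|S| = p ->
  #|[set z : wreath gT k | wperm z @: yset == S]| =
    #|{: wreath gT p * wreath gT q}|.
Proof.
move=> cS; have [s Es] : exists s : 'S_k, s @: yset = S.
  by apply: exists_perm_imset; rewrite card_yset.
rewrite -card_stab_yset; pose z0 : wreath gT k := Wreath [ffun=> 1%g] s.
apply/esym.
rewrite -(card_imset _ (mulgI z0)); apply: eq_card => z.
have EI w : wperm (z0 * w)%g @: yset = s @: (wperm w @: yset).
  rewrite -[RHS](imset_comp s (wperm w)); apply: eq_imset => i; rewrite /= permM //.
rewrite inE; apply/imsetP/eqP => [[w]|Ez].
  by rewrite inE stab_imset => /eqP Ew ->; rewrite EI Ew Es.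
exists (z0^-1 * z)%g; last by rewrite mulKVg.
rewrite inE stab_imset; apply/eqP/(imset_inj (@perm_inj _ s)).
by rewrite -EI mulKVg Ez Es.
Qed.

Section Averages.

Variables (V : zmodType) (U : wreath gT k -> {set 'I_k} -> V).

Hypothesis UJ : forall x z S, U (x ^ z)%g S = U x (wperm z @: S).

(** The conjugate [x ^ z] lies in the Young subgroup exactly when [x] stabilizes the image of [yset]
    under [wperm z], and every [S] of size [p] is this image for as many [z] as the Young subgroup
    has elements. *)
Lemma sum_young_conj x :
  \sum_(z : wreath gT k) \sum_(h | yg h == (x ^ z)%g) U (yg h) yset
   = (\sum_(S : {set 'I_k} | (#|S| == p) && stab x S) U x S)
       *+ #|{: wreath gT p * wreath gT q}|.
Proof.
transitivity (\sum_(z : wreath gT k | stab x (wperm z @: yset))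
                U x (wperm z @: yset)).
  rewrite [RHS]big_mkcond /=; apply: eq_bigr => z _.
  rewrite (stab_emb _ (wreath_emb_conj x z)).
  case: ifP => [/stab_youngP[h Eh]|nS].
    rewrite (big_pred1 h) => [|h']; first by rewrite Eh UJ.
    by rewrite -Eh (inj_eq young_inj).
  by rewrite big_pred0 // => h; apply/eqP => E; rewrite -E stab_young in nS.
rewrite (partition_big (fun z : wreath gT k => wperm z @: yset)
   (fun S : {set 'I_k} => (#|S| == p) && stab x S)) /=; last first.
  by move=> z ->; rewrite card_imset ?card_yset ?eqxx //; apply: perm_inj.
rewrite -sumrMnl; apply: eq_bigr => S /andP[/eqP cS stS].
rewrite -(card_wperm_imset cS) -sumr_const.
apply: eq_big => [z|z /andP[_ /eqP ->] //]; rewrite inE.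
by case: eqP => [->|]; rewrite ?stS ?andbF.
Qed.

(** After [sum_young_conj] and an exchange of sums, fixed [z] and [h] leave a single [x], the
    conjugate of [young e h] by the inverse of [z]. *)
Lemma sum_young :
  (\sum_(x : wreath gT k) \sum_(S : {set 'I_k} | (#|S| == p) && stab x S) U x S)
     *+ #|{: wreath gT p * wreath gT q}|
  = (\sum_h U (yg h) yset) *+ #|{: wreath gT k}|.
Proof.
rewrite -sumrMnl; under eq_bigr do rewrite -sum_young_conj.
rewrite exchange_big /= -sumr_const; apply: eq_bigr => z _.
rewrite (exchange_big_dep xpredT) //=; apply: eq_bigr => h _.
rewrite (big_pred1 (yg h ^ z^-1)%g) // => x.
by rewrite eq_sym -[RHS](inj_eq (conjg_inj z)) conjgKV.
Qed.

End Averages.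

End YoungSubgroup.

(** * Means of multiplicative functions *)

Lemma prodrD_subset (A : comNzRingType) (I : finType) (P : {set I})
    (a b : I -> A) :
  \prod_(i in P) (a i + b i) =
  \sum_(B : {set I} | B \subset P)
     (\prod_(i in B) a i) * (\prod_(i in P :\: B) b i).
Proof.
(* With the defaults 0 and 1 outside [P], the added factors are 1 and every [B] not contained in [P]
   contributes 0. *)
pose a' i := if i \in P then a i else 0; pose b' i := if i \in P then b i else 1.
transitivity (\prod_i (a' i + b' i)).
  rewrite [LHS]big_mkcond; apply: eq_bigr => i _.
  by rewrite /a' /b'; case: ifP => //; rewrite add0r.
rewrite bigA_distr [RHS]big_mkcond; apply: eq_bigr => B _.
case: ifP => [sBP|/subsetPn[i iB iP]]; last first.
  by rewrite (bigD1 i) //= iB /a' (negPf iP) mul0r.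
rewrite (bigID (mem B)) /=; congr (_ * _).
  by apply: eq_bigr => i iB; rewrite iB /a' (subsetP sBP).
rewrite [LHS]big_mkcond [RHS]big_mkcond; apply: eq_bigr => i _.
by rewrite in_setD /b'; case: (i \in B) => //=; case: ifP.
Qed.

Lemma sum_card_porbits n (s : 'S_n) : (\sum_(A in porbits s) #|A|)%N = n.
Proof.
rewrite -[RHS]card_ord -sum1_card (partition_big (porbit s) (mem (porbits s))) /=.
  apply: eq_bigr => A /imsetP[i _ ->]; rewrite -sum1_card.
  by apply: eq_bigl => j; rewrite eq_porbit_mem.
by move=> i _; apply: imset_f.
Qed.

(** * Sets of cycles as stable sets of points *)

Section CycleExpansion.

Variables (gT : finGroupType) (n : nat) (x : wreath gT n).

Local Notation P := (porbits (wperm x)).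

Lemma porbits_eq (A B : {set 'I_n}) i :
  A \in P -> B \in P -> i \in A -> i \in B -> A = B.
Proof.
case/imsetP=> a _ -> /imsetP[b _ ->].
by rewrite -!eq_porbit_mem => /eqP <- /eqP <-.
Qed.

Lemma cover_stab (S : {set 'I_n}) :
  stab x S -> cover [set A in P | A \subset S] = S.
Proof.
move=> stS; apply/setP => i; apply/bigcupP/idP => [[A]|iS].
  by rewrite inE => /andP[_ /subsetP AS] /AS.
exists (porbit (wperm x) i); last exact: porbit_id.
rewrite inE imset_f //=; apply/subsetP => j ij.
by rewrite (stab_porbit stS ij).
Qed.

(** [cover] is a bijection from the sets of cycles to the stable sets of points; it reindexes the
    expansion of [prodrD_subset]. *)
Lemma prodrD_porbits (A : comNzRingType) (a b : {set 'I_n} -> A) :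
  \prod_(B in P) (a B + b B) =
  \sum_(S : {set 'I_n} | stab x S)
     (\prod_(B in P | B \subset S) a B) * (\prod_(B in P | B \subset ~: S) b B).
Proof.
rewrite prodrD_subset [RHS](reindex_onto (@cover _)
  (fun S => [set B in P | B \subset S])) /=; last exact: cover_stab.
have coverP (Q : {set {set 'I_n}}) B : Q \subset P -> B \in P ->
    ((B \subset cover Q) = (B \in Q)) * ((B \subset ~: cover Q) = (B \notin Q)).
  move=> sQ BP; have [i _ EB] := imsetP BP.
  have iB : i \in B by rewrite EB porbit_id.
  case: (boolP (B \in Q)) => BQ; split.
  - exact: (bigcup_sup B).
  - apply/negbTE/subsetPn; exists i; rewrite // in_setC negbK.
    by apply/bigcupP; exists B.
  - apply/negbTE/subsetPn; exists i => //; apply/bigcupP => -[D DQ iD].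
    by rewrite (porbits_eq BP (subsetP sQ _ DQ) iB iD) DQ in BQ.
  - apply/subsetP => j jB; rewrite in_setC; apply/bigcupP => -[D DQ jD].
    by rewrite (porbits_eq BP (subsetP sQ _ DQ) jB jD) DQ in BQ.
apply: eq_big => [Q|Q sQ]; last first.
  congr (_ * _); apply: eq_bigl => B.
    apply/idP/andP => [BQ|[BP]]; last by rewrite coverP.
    by rewrite (subsetP sQ _ BQ) coverP // (subsetP sQ).
  rewrite in_setD andbC; case: (boolP (B \in P)) => //= BP.
  by rewrite coverP.
apply/idP/andP => [sQ|[_ /eqP <-]]; last first.
  by apply/subsetP => B; rewrite inE => /andP[].
split.
  apply: stab_sub => i /bigcupP[B BQ iB]; apply/bigcupP; exists B => //.
  by rewrite (stabP _ _ (stab_porbits (subsetP sQ _ BQ))).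
apply/eqP/setP => B; rewrite inE; apply/andP/idP => [[BP]|BQ].
  by rewrite coverP.
by rewrite (subsetP sQ _ BQ) coverP // (subsetP sQ).
Qed.

Lemma big_porbits_split (R : Type) (idx : R) (op : Monoid.com_law idx) S
    (F : {set 'I_n} -> R) :
  stab x S ->
  \big[op/idx]_(B in P) F B =
  op (\big[op/idx]_(B in P | B \subset S) F B)
     (\big[op/idx]_(B in P | B \subset ~: S) F B).
Proof.
move=> stS; rewrite (bigID (fun B : {set _} => B \subset S)) /=.
congr (op _ _); apply: eq_bigl => B; case: (boolP (B \in _)) => //= BP.
have [i _ EB] := imsetP BP; have iB : i \in B by rewrite EB porbit_id.
apply/idP/idP => [/subsetPn[j jB jS]|/subsetP/(_ i iB)]; last first.
  by rewrite in_setC => iS; apply/subsetPn; exists i.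
apply/subsetP => l lB; rewrite in_setC.
rewrite (_ : (l \in S) = (j \in S)) //; apply: (stab_porbit stS).
by move: jB lB; rewrite EB porbit_sym -eq_porbit_mem => /eqP <-.
Qed.

End CycleExpansion.

Section CycleProd.

Variables (gT : finGroupType) (A : comNzRingType) (phi : nat -> gT -> A).

Definition cprod n (x : wreath gT n) (S : {set 'I_n}) : A :=
  \prod_(B in porbits (wperm x) | B \subset S) cyc_val 1 phi x B.

Definition cprodT n (x : wreath gT n) : A :=
  \prod_(B in porbits (wperm x)) cyc_val 1 phi x B.

Lemma cprod_setT n (x : wreath gT n) : cprod x [set: 'I_n] = cprodT x.
Proof. by apply: eq_bigl => B; rewrite subsetT andbT. Qed.

Hypothesis phiJ : forall k g h, phi k (g ^ h)%g = phi k g.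

Lemma cprod_emb m n (f : 'I_m -> 'I_n) x y (S : {set 'I_m}) :
  wreath_emb f x y -> cprod y (f @: S) = cprod x S.
Proof.
move=> embf; rewrite /cprod (big_porbits_emb _ _ _ embf).
by apply: eq_bigr => B /andP[Bx _]; apply: cyc_val_emb.
Qed.

Lemma cprodJ n (x z : wreath gT n) S :
  cprod (x ^ z)%g S = cprod x (wperm z @: S).
Proof. by rewrite (cprod_emb _ (wreath_emb_conj x z)). Qed.

Lemma cprodCJ n (x z : wreath gT n) (S : {set 'I_n}) :
  cprod (x ^ z)%g (~: S) = cprod x (~: (wperm z @: S)).
Proof.
rewrite cprodJ; congr cprod; apply/setP => i; have <- := permKV (wperm z) i.
by rewrite in_setC !mem_imset ?in_setC //; apply: perm_inj.
Qed.

Lemma cprodTJ n (x z : wreath gT n) : cprodT (x ^ z)%g = cprodT x.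
Proof.
rewrite -!cprod_setT cprodJ; congr cprod; apply/eqP.
by rewrite -stab_imset; apply: stab_sub => i; rewrite !inE.
Qed.

Lemma cprod_split n (x : wreath gT n) S :
  stab x S -> cprodT x = cprod x S * cprod x (~: S).
Proof. exact: big_porbits_split. Qed.

Section Young.

Variables (p q k : nat) (e : (p + q = k)%N) (h : wreath gT p * wreath gT q).

Lemma cprod_young_lft : cprod (young e h) (yset e) = cprodT h.1.
Proof. by rewrite (cprod_emb _ (wreath_emb_lft e h)) cprod_setT. Qed.

Lemma cprod_young_rgt : cprod (young e h) (~: yset e) = cprodT h.2.
Proof. by rewrite ysetC (cprod_emb _ (wreath_emb_rgt e h)) cprod_setT. Qed.

Lemma cprodT_young : cprodT (young e h) = cprodT h.1 * cprodT h.2.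
Proof.
by rewrite (cprod_split (stab_young e h)) cprod_young_lft cprod_young_rgt.
Qed.

End Young.

End CycleProd.

Section Mean.

Variables (C : numFieldType) (gT : finGroupType).

Definition mean (V : lmodType C) n (f : wreath gT n -> V) : V :=
  #|{: wreath gT n}|%:R^-1 *: \sum_x f x.

Lemma card_wreath_neq0 n : #|{: wreath gT n}|%:R != 0 :> C.
Proof. by rewrite pnatr_eq0 -lt0n; apply/card_gt0P; exists 1%g. Qed.

Lemma meanZ (V : lmodType C) n a (f : wreath gT n -> V) :
  mean (fun x => a *: f x) = a *: mean f.
Proof. by rewrite /mean -scaler_sumr !scalerA mulrC. Qed.

Lemma mean_cst (V : lmodType C) n (v : V) : mean (fun _ : wreath gT n => v) = v.
Proof.
by rewrite /mean sumr_const -scaler_nat scalerA mulVf ?scale1r ?card_wreath_neq0.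
Qed.

Lemma meanM (A : comAlgType C) p q (f : wreath gT p -> A) (g : wreath gT q -> A) :
  #|{: wreath gT p * wreath gT q}|%:R^-1 *: \sum_h f h.1 * g h.2 =
  mean f * mean g.
Proof.
rewrite card_prod natrM invfM /mean -scalerAl -scalerAr scalerA; congr (_ *: _).
rewrite mulr_suml (eq_bigr (fun x => \sum_y f x * g y)); last first.
  by move=> x _; rewrite mulr_sumr.
by rewrite pair_big.
Qed.

(** Normalizing both sides of [sum_young] absorbs the index of the Young subgroup, so no binomial
    coefficient enters the recursions. *)
Lemma mean_young (V : lmodType C) p q k (e : (p + q = k)%N)
    (U : wreath gT k -> {set 'I_k} -> V) :
    (forall x z S, U (x ^ z)%g S = U x (wperm z @: S)) ->
  mean (fun x => \sum_(S : {set 'I_k} | (#|S| == p) && stab x S) U x S) =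
  #|{: wreath gT p * wreath gT q}|%:R^-1 *: \sum_h U (young e h) (yset e).
Proof.
move=> UJ; have c_neq0 : #|{: wreath gT p * wreath gT q}|%:R != 0 :> C.
  by rewrite card_prod natrM mulf_neq0 ?card_wreath_neq0.
apply: (scalerI c_neq0); rewrite [RHS]scalerA mulfV // scale1r /mean scalerA
  mulrC -scalerA.
rewrite scaler_nat (sum_young e UJ) -scaler_nat scalerA.
by rewrite mulVf ?scale1r ?card_wreath_neq0.
Qed.

Definition single n (x : wreath gT n) := [set: 'I_n] \in porbits (wperm x).

Section Recursion.

Variables (A : comAlgType C) (phi : nat -> gT -> A).
Hypothesis phiJ : forall k g h, phi k (g ^ h)%g = phi k g.

(** The coefficient p_n of the recursion. The factor n is the length of the marked cycle; for n = 0
    there is no cycle and the value is 0. *)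
Definition single_mean n : A :=
  mean (fun x : wreath gT n =>
    if single x then n%:R *: cyc_val 1 phi x [set: 'I_n] else 0).

(** The cycle lengths of [x] add up to [n], so [n] times the product is a sum over one marked cycle
    weighted by its length; [mean_young] then separates the marked cycle from the other [n - k]
    points. *)
Lemma mean_cprodT_rec n :
  n%:R *: mean (cprodT phi (n := n)) =
  \sum_(k < n.+1) single_mean k * mean (cprodT phi (n := n - k)).
Proof.
pose U (x : wreath gT n) (S : {set 'I_n}) :=
  if S \in porbits (wperm x) then
    #|S|%:R *: (cyc_val 1 phi x S * cprod phi x (~: S)) else 0.
have UJ x z S : U (x ^ z)%g S = U x (wperm z @: S).
  have ez := wreath_emb_conj x z.
  rewrite /U (porbits_emb _ ez) card_imset; last exact: perm_inj.
  by case: ifP => // SP; rewrite (cyc_val_emb _ phiJ ez SP) cprodCJ.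
have pointwise x : n%:R *: cprodT phi x =
    \sum_(k < n.+1) \sum_(S : {set 'I_n} | (#|S| == k) && stab x S) U x S.
  rewrite -{1}(sum_card_porbits (wperm x)) natr_sum scaler_suml.
  transitivity (\sum_(S : {set 'I_n} | stab x S) U x S).
    rewrite [LHS]big_mkcond [RHS]big_mkcond; apply: eq_bigr => S _; rewrite /U.
    case: ifP => [SP|_]; last by case: ifP.
    have stS := stab_porbits SP; rewrite stS (cprod_split phi stS).
    congr (_ *: (_ * _)); rewrite /cprod (big_pred1 S) // => B /=.
    apply/andP/eqP => [[BP /subsetP sBS]|-> //].
    have [i _ EB] := imsetP BP; have iB : i \in B by rewrite EB porbit_id.
    exact: (porbits_eq BP SP iB (sBS _ iB)).
  rewrite (partition_big (fun S : {set 'I_n} => inord #|S| : 'I_n.+1) xpredT) //=.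
  apply: eq_bigr => k _; apply: eq_bigl => S; rewrite andbC; congr (_ && _).
  rewrite -(inj_eq val_inj) /= inordK // ltnS.
  by rewrite (leq_trans (max_card _)) ?card_ord.
transitivity (mean (fun x : wreath gT n => \sum_(k < n.+1)
    \sum_(S : {set 'I_n} | (#|S| == k) && stab x S) U x S)).
  by rewrite -meanZ /mean; congr (_ *: _); apply: eq_bigr => x _; apply: pointwise.
rewrite /mean exchange_big scaler_sumr; apply: eq_bigr => k _.
rewrite -meanM -/(mean _) (mean_young (subnKC (ltnSE (ltn_ord k))) UJ).
congr (_ *: _); apply: eq_bigr => h _.
set e := subnKC _; have el := wreath_emb_lft e h.
rewrite /U card_yset cprod_young_rgt // /yset (porbits_emb _ el) -/(single _).
case: ifP => sh; last by rewrite mul0r.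
by rewrite (cyc_val_emb _ phiJ el) // scalerAl.
Qed.

End Recursion.

End Mean.

(** * Elements with a single cycle *)

Section SingleCycles.

Variable gT : finGroupType.

Lemma singleP n (x : wreath gT n) i j : single x -> j \in porbit (wperm x) i.
Proof.
case/imsetP => a _ E; have H k : k \in porbit (wperm x) a by rewrite -E inE.
by have := H i; rewrite -eq_porbit_mem => /eqP ->.
Qed.

Lemma porbit_single n (x : wreath gT n) i :
  single x -> porbit (wperm x) i = [set: 'I_n].
Proof. by move=> sx; apply/setP => j; rewrite inE singleP. Qed.

(** Starting from [wperm x i] puts [i] last in the trajectory, hence leftmost in the cycle-product,
    where the inserted [g] comes out as a left factor. *)
Lemma cycle_prod_mulc n (x : wreath gT n) (g : gT) i :
  cycle_prod (Wreath [ffun j => if j == i then g else 1%g] 1%g * x)%g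
    (wperm x i) = (g * cycle_prod x (wperm x i))%g.
Proof.
rewrite /cycle_prod [wperm (_ * _)%g]mulg1.
have := uniq_traject_porbit (wperm x) (wperm x i).
have := iter_porbit (wperm x) (wperm x i).
case: #|_| (card_porbit_neq0 (wperm x) (wperm x i)) => // l _.
rewrite iterS => /perm_inj E.
rewrite trajectSr rcons_uniq => /andP[ni _].
rewrite rev_rcons !big_cons /= mulgA; congr (_ * _)%g.
  by rewrite !ffunE /= ?ffunE E eqxx invg1 perm1.
apply: eq_big_seq => j; rewrite mem_rev => jt.
rewrite !ffunE /= ?ffunE; case: eqP => [Ej|_]; last by rewrite mul1g invg1 perm1.
by case/negP: ni; rewrite E -{1}Ej.
Qed.

Section SingleMean.

Variable n : nat.
Local Notation G1 := (wreath gT n.+1).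

(* Marking a cycle in the constant function 1 gives n = s_1 + ... + s_n, where s_k
   is k times the proportion of single k-cycles in Gamma_k. *)
Lemma card_single : (n.+1 * #|[set x : G1 | single x]|)%N = #|{: G1}|.
Proof.
pose phi (_ : nat) (_ : gT) : rat^o := 1.
have cval m (x : wreath gT m) B : cyc_val 1 phi x B = 1.
  by rewrite /cyc_val; case: pickP.
have cT m : mean (cprodT phi (n := m)) = 1 :> rat^o.
  rewrite -[RHS](mean_cst gT m); congr (_ *: _); apply: eq_bigr => x _.
  by apply: big1 => B _; apply: cval.
have rec m : \sum_(k < m.+1) single_mean phi k = m%:R.
  have := @mean_cprodT_rec _ _ _ phi (fun _ _ _ => erefl) m.
  rewrite cT => E; transitivity (m%:R *: (1 : rat^o)); last exact: mulr1.
  by rewrite E; apply: eq_bigr => k _; rewrite cT mulr1.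
have := rec n.+1; rewrite big_ord_recr /= rec -[in RHS]natr1 => /addrI.
rewrite /single_mean /mean -big_mkcond /= => E.
have {E}E : #|{: G1}|%:R^-1 * (n.+1%:R * #|[set x : G1 | single x]|%:R) = 1 :> rat.
  rewrite -[RHS]E; congr (_ * _); rewrite cardsE mulr_natr -sumr_const.
  by apply: eq_big => // x _; rewrite cval; apply/esym/mulr1.
apply/eqP; rewrite -(eqr_nat rat) natrM; apply/eqP.
have N_neq0 := card_wreath_neq0 rat gT n.+1.
by apply: (mulfI (invr_neq0 N_neq0)); rewrite E mulVf.
Qed.

(** Left multiplication by [t g] permutes the single cycles and translates their cycle-products by
    [g], so these are equidistributed in the group. *)
Lemma sum_single (V : zmodType) (u : gT -> V) :
  (\sum_(x : G1 | single x) u (cycle_prod x (wperm x ord0))) *+ #|gT| =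
  (\sum_g u g) *+ #|[set x : G1 | single x]|.
Proof.
pose t (g : gT) : G1 := Wreath [ffun j => if j == ord0 then g else 1%g] 1%g.
have st g x : single (t g * x)%g = single x by rewrite /single [wperm (_ *
  _)%g]mulg1.
rewrite -!sumr_const; transitivity (\sum_(g : gT) \sum_(x : G1 | single x)
    u (g * cycle_prod x (wperm x ord0))%g).
  apply: eq_bigr => g _; rewrite (reindex_inj (mulgI (t g))) /=.
  apply: eq_big => [x|x _]; first exact: st.
  by rewrite mulg1 cycle_prod_mulc.
rewrite exchange_big /=; apply: eq_big => [x|x _]; first by rewrite inE.
by rewrite [RHS](reindex_inj (mulIg (cycle_prod x (wperm x ord0)))).
Qed.

End SingleMean.

(** By [card_single] the single cycles are a fraction 1 / (n + 1) of the group, which cancels the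
    length in [single_mean]; equidistribution of the cycle-products does the rest. *)
Lemma single_meanE (C : numFieldType) (A : comAlgType C) (phi : nat -> gT -> A) n :
    (forall k g h, phi k (g ^ h)%g = phi k g) ->
  single_mean phi n.+1 = #|gT|%:R^-1 *: \sum_g phi n.+1 g.
Proof.
move=> phiJ; have gT_neq0 : #|gT|%:R != 0 :> C.
  by rewrite pnatr_eq0 -lt0n; apply/card_gt0P; exists 1%g.
apply: (scalerI gT_neq0); rewrite [RHS]scalerA mulfV // scale1r.
apply: (scalerI (card_wreath_neq0 C gT n.+1)).
rewrite /single_mean /mean -big_mkcond /= scalerA mulrC -scalerA.
rewrite [X in _ *: X]scalerA mulfV ?card_wreath_neq0 // scale1r -scaler_sumr.
rewrite (eq_bigr (fun x => phi n.+1 (cycle_prod x (wperm x ord0)))); last first.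
  by move=> x sx; rewrite (cyc_valE _ phiJ sx (in_setT (wperm x ord0))) cardsT
    card_ord.
rewrite scalerA mulrC -scalerA (scaler_nat #|gT|) sum_single.
rewrite -[X in _ *: X]scaler_nat scalerA.
by rewrite -natrM card_single.
Qed.

Lemma conj_single n (x y : wreath gT n) a b g :
    single x -> single y -> cycle_prod y b = (cycle_prod x a ^ g)%g ->
  exists z, (x ^ z)%g = y.
Proof.
move=> sx sy Eg; set s := wperm x; set t := wperm y.
have orb_n i (w : wreath gT n) : single w -> #|porbit (wperm w) i| = n.
  by move=> sw; rewrite porbit_single // cardsT card_ord.
have iter_n i (w : wreath gT n) : single w -> iter n (wperm w) i = i.
  by move=> sw; have := iter_porbit (wperm w) i; rewrite orb_n.
(* [z] maps [t^j b] to [s^j a], with base [X j * u0 * (Y j)^-1] there; this is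
   n-periodic in [j] because [Y n = X n ^ u0]. *)
pose X j := wbase (x ^+ j)%g (iter j s a).
pose Y j := wbase (y ^+ j)%g (iter j t b).
have XS (w : wreath gT n) i j : wbase (w ^+ j.+1)%g (iter j.+1 (wperm w) i) =
    (wbase w (iter j.+1 (wperm w) i) * wbase (w ^+ j)%g (iter j (wperm w) i))%g.
  by rewrite expgS /= ffunE permK.
have cpn (w : wreath gT n) i : single w -> exists h,
    wbase (w ^+ n)%g (iter n (wperm w) i) = (cycle_prod w i ^ h)%g.
  move=> sw; have [h Eh] := cycle_prod_perm w i; exists h.
  by rewrite -Eh cycle_prod_wbaseX orb_n // permK iter_n.
have [u0 Eu0] : exists u, Y n = (X n ^ u)%g.
  have [h1 E1] := cpn x a sx; have [h2 E2] := cpn y b sy.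
  exists (h1^-1 * g * h2)%g; rewrite /X /Y E1 E2 Eg -!conjgM; congr (_ ^ _)%g.
  by rewrite !mulgA mulgV mul1g.
pose u j := (X j * u0 * (Y j)^-1)%g.
have u_n : u n = u 0%N.
  have X0 : X 0%N = 1%g by rewrite /X expg0 ffunE.
  have Y0 : Y 0%N = 1%g by rewrite /Y expg0 ffunE.
  by rewrite /u Eu0 X0 Y0 conjgE !invMg invgK invg1 mulg1 mul1g !mulgA mulgK
    mulgV mul1g.
pose idx k := index k (traject t b n).
have mem_t k : k \in traject t b n.
  by have := singleP b k sy; rewrite porbit_traject orb_n.
have idx_lt k : (idx k < n)%N by have := mem_t k; rewrite -index_mem size_traject.
have idxK k : iter (idx k) t b = k.
  by rewrite -(nth_traject t (idx_lt k)) nth_index.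
have uniq_t : uniq (traject t b n) by have := uniq_traject_porbit t b;
  rewrite orb_n.
have Kidx j : (j < n)%N -> idx (iter j t b) = j.
  by move=> lt_jn; rewrite /idx -(nth_traject t lt_jn) index_uniq ?size_traject.
(* [t] raises the index by one except at the last point, where it drops from n - 1 to 0; the
   condition on [F] makes both cases agree. *)
have idxS (T : Type) (F : nat -> T) k : F n = F 0%N -> F (idx (t k)) = F (idx k).+1.
  move=> Fn; rewrite -{1}(idxK k) -iterS.
  have := idx_lt k; rewrite leq_eqVlt => /orP[/eqP->|/Kidx->//].
  by rewrite iter_n // Fn; congr F; apply: (Kidx 0%N);
    apply: leq_ltn_trans (idx_lt k).
pose p k := iter (idx k) s a.
have pM k : p (t k) = s (p k).
  by rewrite /p (idxS _ (fun j => iter j s a)) // iter_n.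
have p_inj : injective p.
  have uniq_s : uniq (traject s a n) by have := uniq_traject_porbit s a;
    rewrite orb_n.
  move=> k l; rewrite /p -(nth_traject s (idx_lt k)) -(nth_traject s (idx_lt l)).
  move/eqP.
  rewrite (set_nth_default a) ?size_traject // nth_uniq ?size_traject // => /eqP E.
  by rewrite -[k]idxK E idxK.
pose z : wreath gT n := Wreath [ffun i => u (idx ((perm p_inj)^-1%g i))] (perm
  p_inj).
exists z; apply: (mulgI z); rewrite conjgE mulKVg.
apply: wreathP => [i|] /=; last first.
  by apply/permP => k; rewrite !permM !permE pM.
have [l El] : exists l, i = p (t l).
  exists (t^-1 ((perm p_inj)^-1 i))%g; rewrite permKV.
  by have := permKV (perm p_inj) i; rewrite permE.
have pV k : ((perm p_inj)^-1)%g (p k) = k by rewrite -(permE p_inj) permK.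
have sV : s^-1%g i = p l by rewrite El pM permK.
rewrite !ffunE -/s sV El !pV (idxS _ u) // pM /u /X /Y.
by rewrite !XS !iterS -/s -/t idxK !invMg !mulgA mulgKV.
Qed.

End SingleCycles.

(** * Types and conjugacy *)

Section Types.

Variable gT : finGroupType.

Definition cls_of (g : gT) : Cls gT :=
  exist (fun c => c \in classes [set: gT]) (g ^: [set: gT])%g
    (mem_classes (in_setT g)).

Lemma ClsJ (c : Cls gT) g h : ((g ^ h)%g \in val c) = (g \in val c).
Proof. by case: c => _ /= /imsetP[a _ ->];
  rewrite !(class_sym _ _ a) classGidl ?inE. Qed.

Lemma mem_cls_of g : g \in val (cls_of g).
Proof. exact: class_refl. Qed.

Lemma cls_ofP (c : Cls gT) g : (g \in val c) = (c == cls_of g).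
Proof.
case: c => c cP; rewrite -val_eqE /=; apply/idP/eqP => [|->];
  last exact: class_refl.
by case/imsetP: (cP) => a _ -> /class_eqP.
Qed.

Lemma cls_conj (c : Cls gT) g h : g \in val c -> h \in val c ->
  exists a, h = (g ^ a)%g.
Proof.
rewrite !cls_ofP => /eqP -> /eqP/(congr1 val)/= E.
by have := class_refl [set: gT] h; rewrite -E => /imsetP[a _ ->]; exists a.
Qed.

Lemma cls_rep_mem (c : Cls gT) : cls_rep c \in val c.
Proof. exact: mem_repr_classes (valP c). Qed.

Definition kind (k : nat) (c : Cls gT) (k' : nat) (g : gT) : bool
  := (k' == k) && (g \in val c).

Lemma kindJ k c k' g h : kind k c k' (g ^ h)%g = kind k c k' g.
Proof. by rewrite /kind ClsJ. Qed.

Definition mult n (x : wreath gT n) k (c : Cls gT) : nat :=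
  (\sum_(A in porbits (wperm x)) cyc_val false (kind k c) x A)%N.

Lemma mult_emb_sub m n (f : 'I_m -> 'I_n) x y (S : {set 'I_m}) k c :
  wreath_emb f x y ->
  (\sum_(A in porbits (wperm y) | A \subset f @: S) cyc_val false (kind k c) y A =
   \sum_(A in porbits (wperm x) | A \subset S) cyc_val false (kind k c) x A)%N.
Proof.
move=> embf; rewrite (big_porbits_emb _ _ _ embf).
by apply: eq_bigr => B /andP[Bx _]; rewrite (cyc_val_emb _ _ embf Bx) //;
  apply: kindJ.
Qed.

Lemma multT n (x : wreath gT n) k c :
  mult x k c = (\sum_(A in porbits (wperm x) | A \subset [set: 'I_n])
    cyc_val false (kind k c) x A)%N.
Proof. by apply: eq_bigl => A; rewrite subsetT andbT. Qed.

Lemma multJ n (x z : wreath gT n) k c : mult (x ^ z)%g k c = mult x k c.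
Proof.
rewrite !multT -(mult_emb_sub _ _ _ (wreath_emb_conj x z)).
have -> // : wperm z @: [set: 'I_n] = [set: 'I_n].
by apply/eqP; rewrite -stab_imset; apply: stab_sub => i; rewrite !inE.
Qed.

Lemma mult_young p q n (e : (p + q = n)%N) (h : wreath gT p * wreath gT q) k c :
  mult (young e h) k c = (mult h.1 k c + mult h.2 k c)%N.
Proof.
rewrite {1}/mult (big_porbits_split _ _ (stab_young e h)) ysetC.
rewrite (mult_emb_sub _ _ _ (wreath_emb_lft e h)).
by rewrite (mult_emb_sub _ _ _ (wreath_emb_rgt e h)) -!multT.
Qed.

Lemma mult_single n (x : wreath gT n) a k c :
  single x -> mult x k c = kind k c n (cycle_prod x a).
Proof.
move=> sx; rewrite /mult (big_pred1 [set: 'I_n]) => [|B /=]; last first.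
  apply/idP/eqP => [BP|-> //]; have [i _ ->] := imsetP BP.
  exact: porbit_single.
by rewrite (@cyc_valE _ _ _ _ (@kindJ k c) _ _ _ a) ?inE // cardsT card_ord.
Qed.

Lemma mult_gt0P n (x : wreath gT n) k (c : Cls gT) :
  reflect (exists A i, [/\ A \in porbits (wperm x), i \in A, #|A| = k &
                           cycle_prod x i \in val c])
          (0 < mult x k c)%N.
Proof.
have E (A : {set 'I_n}) i : A \in porbits (wperm x) -> i \in A ->
    cyc_val false (kind k c) x A = (#|A| == k) && (cycle_prod x i \in val c).
  by move=> AP iA; rewrite (cyc_valE false _ AP iA) //; apply: kindJ.
rewrite lt0n; apply: (iffP idP) => [|[A [i [AP iA Ak ic]]]].
  rewrite sum_nat_eq0 negb_forall => /existsP[A]; rewrite negb_imply => /andP[AP].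
  have [i _ EA] := imsetP AP; have iA : i \in A by rewrite EA porbit_id.
  rewrite (E A i) // eqb0 negbK => /andP[/eqP Ak ic].
  by exists A, i.
by rewrite -lt0n /mult (bigD1 A) //= (E A i) // Ak eqxx ic.
Qed.

(** A permutation carrying the first block onto [A], with trivial base, conjugates [x] into the
    Young subgroup; the last clause keeps track of the class that was split off. *)
Lemma split_cycle n p q (e : (p + q = n)%N) (x : wreath gT n)
    (A : {set 'I_n}) i :
    A \in porbits (wperm x) -> i \in A -> #|A| = p ->
  exists z h, [/\ (x ^ z)%g = young e h, single h.1 &
    exists a g, cycle_prod x i = (cycle_prod h.1 a ^ g)%g].
Proof.
move=> AP iA cA; have [s Es] : exists s : 'S_n, s @: yset e = A.
  by apply: exists_perm_imset; rewrite card_yset.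
pose z : wreath gT n := Wreath [ffun=> 1%g] s; have ez := wreath_emb_conj x z.
have [h Eh] : exists h, young e h = (x ^ z)%g.
  by apply: stab_youngP; rewrite -(stab_emb _ ez) Es stab_porbits.
have el := wreath_emb_lft e h; exists z, h; split=> //.
  by rewrite /single -(porbits_emb _ el) -/(yset e) Eh -(porbits_emb _ ez) Es.
have /imsetP[_ /imsetP[a _ ->] ->] : i \in s @: yset e by rewrite Es.
have [_ _ /(_ (ylft e a))[g1 ->]] := ez; rewrite -Eh.
have [_ _ /(_ a)[g2 ->]] := el.
by exists a, (g2 * g1)%g; rewrite conjgM.
Qed.

(** By induction on the size: the cycle of [x] through [ord0] has a counterpart of the same kind in
    [y]. Both are moved to the first block and matched by [conj_single]; the multiplicities of the
    remainders agree by cancellation. *)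
Lemma conj_mult n (x y : wreath gT n) :
  (forall k c, mult x k c = mult y k c) -> exists z, (x ^ z)%g = y.
Proof.
elim/ltn_ind: n => -[|n] IHn in x y * => Exy.
  by exists 1%g; apply: wreathP => [[]|] //; apply/permP => -[].
pose A := porbit (wperm x) ord0;
  have AP : A \in porbits (wperm x) by apply: imset_f.
have iA : ord0 \in A by apply: porbit_id.
pose c := cls_of (cycle_prod x ord0).
have A_gt0 : (0 < #|A|)%N by rewrite lt0n card_porbit_neq0.
have le_A : (#|A| <= n.+1)%N by rewrite (leq_trans (max_card _)) ?card_ord.
have e := subnKC le_A; set q := (n.+1 - _)%N in e.
have : (0 < mult x #|A| c)%N.
  by apply/mult_gt0P; exists A, ord0; rewrite mem_cls_of.
rewrite Exy => /mult_gt0P[B [j [BP jB BA jc]]].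
have [z [h [Ez sh [a [g Ea]]]]] := split_cycle e AP iA erefl.
have [z' [h' [Ez' sh' [a' [g' Ea']]]]] := split_cycle e BP jB BA.
have [b Eb] := cls_conj (mem_cls_of (cycle_prod x ord0)) jc.
have [z1 E1] : exists z1, (h.1 ^ z1)%g = h'.1.
  apply: (@conj_single _ _ _ _ a a' (g * b * g'^-1)) => //.
  by rewrite !conjgM -Ea -Eb Ea' conjgK.
have [z2 E2] : exists z2, (h.2 ^ z2)%g = h'.2.
  apply: IHn => [|k d]; first by rewrite /q ltn_subrL A_gt0.
  have := Exy k d; rewrite -(multJ x z) -(multJ y z') Ez Ez' !mult_young.
  by rewrite -E1 multJ => /addnI.
exists (z * young e (z1, z2) * z'^-1)%g; rewrite !conjgM Ez.
have youngJ u v : young e (u ^ v)%g = (young e u ^ young e v)%g.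
  have V : young e v^-1%g = (young e v)^-1%g.
    apply: (mulgI (young e v)); rewrite -youngM !mulgV.
    by apply: (mulgI (young e 1%g)); rewrite -youngM !mulg1.
  by rewrite /conjg !youngM V.
rewrite -youngJ; have -> : (h ^ (z1, z2))%g = h'.
  by rewrite conj_pair /= E1 E2 -surjective_pairing.
by rewrite -Ez' conjgK.
Qed.

End Types.

(** * Number of elements of a given type *)

Section CountTypes.

Variable gT : finGroupType.

Lemma kindE k c k' (g : gT) : kind k c k' g = (k' == k) && (c == cls_of g).
Proof. by congr andb; apply: cls_ofP. Qed.

Lemma cyc_val_kind n (x : wreath gT n) (A : {set 'I_n}) i k c :
  A \in porbits (wperm x) -> i \in A ->
  cyc_val false (kind k c) x A = (#|A| == k) && (c == cls_of (cycle_prod x i)).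
Proof.
by move=> AP iA; rewrite (cyc_valE false _ AP iA) /kind ?cls_ofP //; apply: kindJ.
Qed.

Lemma porbits_card_bound n (x : wreath gT n) (A : {set 'I_n}) :
  A \in porbits (wperm x) -> (0 < #|A| <= n)%N.
Proof.
case/imsetP => i _ ->; rewrite lt0n card_porbit_neq0 /=.
by rewrite (leq_trans (max_card _)) ?card_ord.
Qed.

Lemma mult_out n (x : wreath gT n) k c : ~~ (0 < k <= n)%N -> mult x k c = 0%N.
Proof.
move=> nk; apply/eqP; rewrite -leqn0 leqNgt;
  apply/mult_gt0P => -[A [i [AP _ Ak _]]].
by have := porbits_card_bound AP; rewrite Ak (negPf nk).
Qed.

(** A cycle has exactly one kind, of length between 1 and [n], so a single term survives; this
    trades products over kinds for products over cycles. *)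
Lemma big_kind (R : Type) (idx : R) (op : Monoid.com_law idx) n (x : wreath gT n)
    (F : nat -> Cls gT -> R) (A : {set 'I_n}) i :
    A \in porbits (wperm x) -> i \in A ->
  \big[op/idx]_c \big[op/idx]_(j < n)
     (if cyc_val false (kind j.+1 c) x A then F j.+1 c else idx) =
  F #|A| (cls_of (cycle_prod x i)).
Proof.
move=> AP iA; have /andP[A_gt0 A_le] := porbits_card_bound AP.
have lt_A : (#|A|.-1 < n)%N by rewrite prednK.
rewrite (bigD1 (cls_of (cycle_prod x i))) //= [X in op _ X]big1 => [|c nc].
  rewrite Monoid.mulm1 (bigD1 (Ordinal lt_A)) //= [X in op _ X]big1 => [|j nj].
    by rewrite Monoid.mulm1 (cyc_val_kind _ _ AP iA) prednK // !eqxx.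
  rewrite (cyc_val_kind _ _ AP iA); case: eqP => // E.
  by case/eqP: nj; apply: val_inj; rewrite /= E.
by apply: big1 => j _; rewrite (cyc_val_kind _ _ AP iA) (negPf nc) andbF.
Qed.

Lemma sum_mult n (x : wreath gT n) :
  (\sum_c \sum_(j < n) j.+1 * mult x j.+1 c)%N = n.
Proof.
rewrite -[RHS](sum_card_porbits (wperm x)).
transitivity (\sum_(A in porbits (wperm x)) \sum_c \sum_(j < n)
   if cyc_val false (kind j.+1 c) x A then j.+1 else 0)%N.
  rewrite [RHS]exchange_big; apply: eq_bigr => c _ /=.
  rewrite [RHS]exchange_big; apply: eq_bigr => j _ /=.
  rewrite /mult big_distrr; apply: eq_bigr => A _ /=.
  by case: ifP => _; rewrite ?muln1 ?muln0.
apply: eq_bigr => A AP; have [i _ EA] := imsetP AP.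
have iA : i \in A by rewrite EA porbit_id.
exact: (@big_kind _ _ addn n x (fun k _ => k) A i AP iA).
Qed.

Lemma cprodT_mult (A : comNzRingType) (phi : nat -> Cls gT -> A) n (x : wreath gT
  n) :
  cprodT (fun k g => phi k (cls_of g)) x =
  \prod_c \prod_(j < n) phi j.+1 c ^+ mult x j.+1 c.
Proof.
transitivity (\prod_(B in porbits (wperm x)) \prod_c \prod_(j < n)
   if cyc_val false (kind j.+1 c) x B then phi j.+1 c else 1).
  apply: eq_bigr => B BP; have [i _ EB] := imsetP BP.
  have iB : i \in B by rewrite EB porbit_id.
  rewrite (@big_kind _ _ *%R n x phi B i BP iB) (cyc_valE _ _ BP iB) //.
  move=> k g h; congr phi; apply/val_inj/class_eqP.
  by rewrite /= memJ_class ?inE.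
rewrite exchange_big; apply: eq_bigr => c _ /=.
rewrite exchange_big; apply: eq_bigr => j _ /=.
rewrite /mult -prodrXr; apply: eq_bigr => B _.
by case: ifP => _; rewrite ?expr1 ?expr0.
Qed.

Definition same n (x y : wreath gT n) :=
  [forall c, forall j : 'I_n, mult x j.+1 c == mult y j.+1 c].

Lemma sameP n (x y : wreath gT n) :
  reflect (forall k c, mult x k c = mult y k c) (same x y).
Proof.
apply: (iffP 'forall_forallP) => [H k c|H c j]; last by rewrite H.
case: (boolP (0 < k <= n)%N) => [|nk]; last by rewrite !mult_out.
by case: k => // k; rewrite /= => lt_kn; apply/eqP: (H c (Ordinal lt_kn)).
Qed.

Definition zfac k (c : Cls gT) m : nat :=
  (k ^ m * m`! * #|'C[cls_rep c]| ^ m)%N.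

Lemma zfacS k c m :
  zfac k c m.+1 = (zfac k c m * (k * #|'C[cls_rep c]%g| * m.+1))%N.
Proof. by rewrite /zfac !expnS factS; ring. Qed.

(** [Zrho] at the type of [x], with the powers of the centralizer orders distributed over the
    lengths, so that adding one cycle changes a single factor. *)
Definition ztype n (x : wreath gT n) : nat :=
  (\prod_c \prod_(j < n) zfac j.+1 c (mult x j.+1 c))%N.

Lemma ztype_widen n N (x : wreath gT n) : (n <= N)%N ->
  ztype x = (\prod_c \prod_(j < N) zfac j.+1 c (mult x j.+1 c))%N.
Proof.
move=> le_nN; apply: eq_bigr => c _.
rewrite (big_ord_widen N (fun j => zfac j.+1 c (mult x j.+1 c)) le_nN).
rewrite [LHS]big_mkcond; apply: eq_bigr => j _; case: ltnP => // le_nj.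
by rewrite mult_out //= -ltnNge ltnS.
Qed.

Lemma ztypeJ n (x z : wreath gT n) : ztype (x ^ z)%g = ztype x.
Proof. by apply: eq_bigr => c _; apply: eq_bigr => j _; rewrite multJ. Qed.

(** Only the factor at length [p] and class [c] sees the cycle [h.1], and [zfacS] gives its growth;
    [ztype_widen] makes both products range over the same lengths. *)
Lemma ztype_young p q n (e : (p + q = n)%N) (h : wreath gT p * wreath gT q) a :
  single h.1 -> let c := cls_of (cycle_prod h.1 a) in
  ztype (young e h) =
    (ztype h.2 * (p * #|'C[cls_rep c]%g| * mult (young e h) p c))%N.
Proof.
move=> sh c; have le_qn : (q <= n)%N by rewrite -e leq_addl.
have p_gt0 : (0 < p)%N by apply: leq_ltn_trans (ltn_ord a).
have lt_pn : (p.-1 < n)%N by rewrite prednK // -e leq_addr.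
have mE k d : mult (young e h) k d = ((p == k) && (d == c) + mult h.2 k d)%N.
  by rewrite mult_young (mult_single a _ _ sh) /kind cls_ofP.
rewrite (ztype_widen h.2 le_qn) /ztype !pair_bigA /=.
rewrite (bigD1 (c, Ordinal lt_pn)) //= [in RHS](bigD1 (c, Ordinal lt_pn)) //=.
rewrite prednK // mE !eqxx /= add1n zfacS.
rewrite [in LHS](eq_bigr (fun d : Cls gT * 'I_n => zfac d.2.+1 d.1 (mult h.2
  d.2.+1 d.1))).
  exact: mulnAC.
move=> -[d j] /= ndj; rewrite mE; case: eqP => // Ep.
case: eqP => // Ed; case/eqP: ndj; congr (_, _) => //.
by apply: val_inj; rewrite /= Ep.
Qed.

(** By [sum_single] the class [c] has the same proportion among single cycles as in the group,
    namely the inverse of the order of the centralizer. *)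
Lemma card_single_kind n (c : Cls gT) :
  (#|[set x : wreath gT n.+1 | single x & (0 < mult x n.+1 c)]|
     * (n.+1 * #|'C[cls_rep c]%g|))%N = #|{: wreath gT n.+1}|.
Proof.
set s := #|_|.
have E1 : ((\sum_(x : wreath gT n.+1 | single x)
     ((cycle_prod x (wperm x ord0) \in val c)%:R : int)) *+ #|gT| =
     (\sum_g (g \in val c)%:R) *+ #|[set x : wreath gT n.+1 | single x]|).
  exact: (sum_single n (fun g => (g \in val c)%:R : int)).
have E2 : \sum_g (g \in val c)%:R = #|val c|%:R :> int.
  by rewrite -sum1_card natr_sum [RHS]big_mkcond; apply: eq_bigr => g _; case: ifP.
have E3 : \sum_(x : wreath gT n.+1 | single x)
     ((cycle_prod x (wperm x ord0) \in val c)%:R : int) = s%:R.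
  rewrite /s -sum1_card natr_sum [LHS]big_mkcond [RHS]big_mkcond.
  apply: eq_bigr => x _; rewrite inE; case: ifP => //= sx.
  rewrite (mult_single (wperm x ord0) _ _ sx) /kind eqxx lt0b /=.
  by case: (_ \in _).
have E4 : (#|val c| * #|'C[cls_rep c]%g|)%N = #|gT|.
  have [a _ Ec] := imsetP (valP c).
  have /class_eqP Er : cls_rep c \in (a ^: [set: gT])%g by rewrite -Ec cls_rep_mem.
  have -> : val c = (cls_rep c ^: [set: gT])%g by rewrite Ec Er.
  by rewrite -index_cent1 setTI mulnC Lagrange ?subsetT // cardsT.
move: E1; rewrite E2 E3 -[LHS]mulr_natr -[RHS]mulr_natr -!natrM => /eqP;
  rewrite eqr_nat => /eqP E1.
have gT_gt0 : (0 < #|gT|)%N by apply/card_gt0P; exists 1%g.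
rewrite -(card_single gT n); apply/eqP; rewrite -(eqn_pmul2r gT_gt0); apply/eqP.
have -> t u : (s * (t * u) * #|gT| = t * u * (s * #|gT|))%N by ring.
by rewrite E1 -E4; ring.
Qed.

(* Induction on [n], double counting the pairs (y, S) with [y] of the type of [x]
   and [S] a cycle of [y] of the same kind as a given cycle of [x]. *)
Lemma count_type n (x : wreath gT n) :
  (#|[set y | same x y]| * ztype x)%N = #|{: wreath gT n}|.
Proof.
elim/ltn_ind: n => -[|n] IHn in x *.
  have all1 (y : wreath gT 0) : y = 1%g.
    by apply: wreathP => [[]|] //; apply/permP => -[].
  rewrite /ztype big1 ?muln1 => [|c _]; last by rewrite big_ord0.
  apply: eq_card => y; rewrite !inE (all1 x) (all1 y).
  exact/sameP.
pose A := porbit (wperm x) ord0.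
have AP : A \in porbits (wperm x) by apply: imset_f.
have iA : ord0 \in A by apply: porbit_id.
have [A_gt0 le_A] := andP (porbits_card_bound AP).
have e := subnKC le_A; set q := (n.+1 - _)%N in e.
have [z [h0 [Ez sh0 [a _]]]] := split_cycle e AP iA erefl.
set p := #|A| in A_gt0 le_A q e h0 a Ez sh0 *.
pose c := cls_of (cycle_prod h0.1 a); set m := mult x p c.
have mE : m = (mult h0.2 p c).+1.
  rewrite /m -(multJ x z) Ez mult_young (mult_single a _ _ sh0) /kind eqxx.
  by rewrite mem_cls_of.
have Zx : ztype x = (ztype h0.2 * (p * #|'C[cls_rep c]%g| * m))%N.
  by rewrite -(ztypeJ x z) Ez (ztype_young e a sh0) -Ez multJ.
have lt_q : (q < n.+1)%N by rewrite ltn_subrL A_gt0.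
have IH := IHn q lt_q h0.2.
pose U (y : wreath gT n.+1) (S : {set 'I_n.+1}) : int :=
  ([&& same x y, S \in porbits (wperm y) & cyc_val false (kind p c) y S])%:R.
have UJ y w S : U (y ^ w)%g S = U y (wperm w @: S).
  have ew := wreath_emb_conj y w; rewrite /U (porbits_emb _ ew).
  have -> : same x (y ^ w)%g = same x y.
    by apply/sameP/sameP => H k d; rewrite H multJ.
  case: (boolP (S \in _)) => [SP|]; last by rewrite !andbF.
  by rewrite (cyc_val_emb _ (@kindJ _ p c) ew SP).
have := sum_young e UJ.
have -> : \sum_y \sum_(S : {set 'I_n.+1} | (#|S| == p) && stab y S) U y S =
    (#|[set y | same x y]| * m)%N%:R.
  rewrite natrM mulr_natl -sumr_const [RHS]big_mkcond; apply: eq_bigr => y _.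
  rewrite inE; case: (boolP (same x y)) => sxy; last first.
    by rewrite big1 // => S _; rewrite /U (negPf sxy).
  rewrite /m (sameP _ _ sxy) /mult natr_sum.
  rewrite [LHS]big_mkcond [RHS]big_mkcond; apply: eq_bigr => S _.
  rewrite /U sxy /=; case: (boolP (S \in _)) => [SP|_]; last by case: ifP.
  rewrite (stab_porbits SP) andbT; have [i _ ES] := imsetP SP.
  have iS : i \in S by rewrite ES porbit_id.
  by rewrite (cyc_val_kind _ _ SP iS); case: (_ == p).
have -> : \sum_h U (young e h) (yset e) =
    (#|[set y : wreath gT p | single y & (0 < mult y p c)%N]| *
     #|[set y | same h0.2 y]|)%N%:R.
  rewrite -cardsX -sum1_card natr_sum [RHS]big_mkcond; apply: eq_bigr => h _.
  have el := wreath_emb_lft e h; rewrite /U !inE (porbits_emb _ el).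
  rewrite -/(single h.1) /=; case: (boolP (single h.1)) => [sh|];
    last by rewrite andbF.
  rewrite (cyc_val_emb _ (@kindJ _ p c) el sh) (cyc_valE _ (@kindJ _ p c) sh
    (in_setT a)).
  rewrite cardsT card_ord (mult_single a _ _ sh) lt0b.
  case: (boolP (kind _ _ _ _)) => [kh|_]; last by rewrite /= andbF.
  (* [h.1] now has the kind of the cycle split off from [x], so it cancels when multiplicities are
     compared. *)
  rewrite /= andbT; suff -> : same x (young e h) = same h0.2 h.2 by case: ifP.
  have Ek k (d : Cls gT) : mult h.1 k d = mult h0.1 k d.
    by rewrite !(mult_single a) // !kindE; move: kh; rewrite kindE eqxx => /eqP <-.
  apply/sameP/sameP => H k d; last by rewrite -(multJ x z) Ez !mult_young Ek H.
  by have := H k d; rewrite -(multJ x z) Ez !mult_young Ek => /addnI.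
rewrite -[LHS]mulr_natr -[RHS]mulr_natr -!natrM => /eqP;
  rewrite eqr_nat card_prod => /eqP E.
have Es : (#|[set y : wreath gT p | single y & (0 < mult y p c)%N]| *
    (p * #|'C[cls_rep c]%g|))%N = #|{: wreath gT p}|.
  by case: (p) A_gt0 (c) => // p' _ c'; apply: card_single_kind.
have c_gt0 k : (0 < #|{: wreath gT k}|)%N by apply/card_gt0P; exists 1%g.
apply/eqP; rewrite -(eqn_pmul2r (c_gt0 q)) -(eqn_pmul2r (c_gt0 p)); apply/eqP.
rewrite Zx; set N := #|[set y | same x y]| in E *; set Nq
  := #|[set y | same _ y]| in E IH *.
set s := #|_| in E Es.
transitivity (N * m * (#|{: wreath gT p}| * #|{: wreath gT q}|) * (p *
  #|'C[cls_rep c]%g|)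
   * ztype h0.2)%N; first by ring.
by rewrite E -[in RHS]IH -[in RHS]Es; ring.
Qed.

End CountTypes.

(** * Sums over types as means over the group *)

Section CharacteristicMap.

Variables (C : numClosedFieldType) (gT : finGroupType).

Definition wtype n (x : wreath gT n) : pfam gT n :=
  [ffun c => [ffun i : 'I_n => inord (mult x i.+1 c)]].

Lemma mult_le n (x : wreath gT n) (i : 'I_n) c : (mult x i.+1 c <= n)%N.
Proof.
rewrite -[X in (_ <= X)%N](sum_mult x) (bigD1 c) //= (bigD1 i) //=.
by rewrite mulSn -!addnA leq_addr.
Qed.

Lemma wtypeE n (x : wreath gT n) i c : wtype x c i = mult x i.+1 c :> nat.
Proof. by rewrite !ffunE inordK // ltnS mult_le. Qed.

Lemma has_typeE n (x : wreath gT n) rho : has_type x rho = (rho == wtype x).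
Proof.
have E (c : Cls gT) (i : 'I_n) : #|[set A in porbits (wperm x) | (#|A| == i.+1) &&
    [exists j in A, cycle_prod x j \in val c]]| = wtype x c i.
  rewrite wtypeE -sum1_card /mult big_mkcond [RHS]big_mkcond; apply: eq_bigr => A _.
  rewrite inE; case: (boolP (A \in _)) => //= AP; have [a _ EA] := imsetP AP.
  have aA : a \in A by rewrite EA porbit_id.
  rewrite (cyc_valE _ (@kindJ _ _ _) AP aA) /kind.
  rewrite (_ : [exists j in A, _] = (cycle_prod x a \in val c));
    first by case: andP.
  apply/existsP/idP => [[j /andP[jA]]|ac]; last by exists a; rewrite aA.
  rewrite EA in jA; have [g ->] := cycle_prod_porbit jA.
  by rewrite (ClsJ c (cycle_prod x a) g).
apply/forallP/eqP => [H|-> c]; last by apply/forallP => i; rewrite E.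
apply/ffunP => c; apply/ffunP => i; apply/val_inj.
by rewrite -[RHS]E; apply/esym/eqP/(forallP (H c)).
Qed.

Lemma same_wtype n (x y : wreath gT n) : same x y = (wtype y == wtype x).
Proof.
apply/idP/eqP => [/sameP H|E].
  by apply/ffunP => c; apply/ffunP => i; rewrite !ffunE H.
by apply/'forall_forallP => c i; rewrite -!wtypeE E.
Qed.

Lemma pfam_size_wtype n (x : wreath gT n) : pfam_size (wtype x) = n.
Proof.
rewrite -[RHS](sum_mult x); apply: eq_bigr => c _; apply: eq_bigr => i _.
by rewrite wtypeE.
Qed.

Lemma Zrho_wtype n (x : wreath gT n) : Zrho (wtype x) = ztype x.
Proof.
apply: eq_bigr => c _; rewrite /pz /plength.
rewrite expn_sum -big_split /=; apply: eq_bigr => i _.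
by rewrite wtypeE.
Qed.

Lemma cfun_wtype n (f : cfun C (wreath gT n)) x y :
  wtype x = wtype y -> f x = f y.
Proof.
move=> E; have [|z <-] := @conj_mult _ _ x y; last by rewrite cfunJ.
by apply/sameP; rewrite same_wtype E.
Qed.

(** By [count_type] the inverse of [Zrho] is the proportion of elements of the given type, and [f]
    is constant on them by [conj_mult]. *)
Lemma mean_wtype (V : lmodType C) n (f : cfun C (wreath gT n)) (F : pfam gT n -> V)
    (G : wreath gT n -> V) :
  (forall x, F (wtype x) = G x) ->
  \sum_(rho : pfam gT n | pfam_size rho == n) ((Zrho rho)%:R^-1 * at_type f rho)
    *: F rho
  = mean (fun x => f x *: G x).
Proof.
move=> FG; rewrite /mean (partition_big (@wtype n) (fun rho => pfam_size rho ==
  n)) /=; last first.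
  by move=> x _; rewrite pfam_size_wtype.
rewrite scaler_sumr; apply: eq_bigr => rho _; rewrite /at_type.
case: pickP => [x|nx].
  rewrite has_typeE => /eqP ->.
  rewrite (eq_bigr (fun=> f x *: F (wtype x))) => [|y /eqP E]; last first.
    by rewrite (cfun_wtype f E) -FG E.
  rewrite sumr_const -scaler_nat !scalerA; congr (_ *: _).
  rewrite mulrA; congr (_ * _); rewrite Zrho_wtype -(count_type x) natrM invfM.
  have -> : #|[set y | same x y]| = #|[pred y | wtype y == wtype x]|.
    by apply: eq_card => y; rewrite !inE same_wtype.
  rewrite -mulrA mulrCA mulVf ?mulr1 // pnatr_eq0 -lt0n; apply/card_gt0P; exists x.
  by rewrite inE.
(* A family that is the type of no element gives zero on both sides: [at_type] defaults to 0 and the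
   fibre of [wtype] is empty. *)
rewrite mulr0 scale0r big_pred0 ?scaler0 // => x.
by rewrite eq_sym -has_typeE nx.
Qed.

Lemma cls_ofJ (g h : gT) : cls_of (g ^ h)%g = cls_of g.
Proof. by apply/val_inj/class_eqP; rewrite /= memJ_class ?inE. Qed.

End CharacteristicMap.

(** * Irreducible characters *)

Section Orthogonality.

Variables (C : numClosedFieldType) (gT : finGroupType).

Local Notation G := [set: gT]%G.
Local Notation rho i := (irr_repr (i : Irr C gT)).

Lemma irr_abs_irreducible i : mx_absolutely_irreducible (rho i).
Proof. exact: group_closure_closed_field (socle_irr _). Qed.

(** Schur's lemma: the kernel and the image of a nonzero intertwiner are submodules, so it is an
    isomorphism and both indices name the same component. *)
Lemma hom_irr_eq0 (i j : Irr C gT) (f : 'M[C]_(_, _)) :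
  i != j -> (forall x, rho i x *m f = f *m rho j x) -> f = 0.
Proof.
move=> neq_ij homf; apply/eqP/negPn/negP => nzf; case/negP: neq_ij.
have [n1_gt0 irr1] := (mx_irrP (rho i)).1 (socle_irr i).
have [n2_gt0 irr2] := (mx_irrP (rho j)).1 (socle_irr j).
have ker0 : kermx f == 0.
  apply/negPn/negP => /(irr1 (kermx f)) full; case/negP: nzf.
  have modK : mxmodule (rho i) (kermx f).
    apply/mxmoduleP => x _; apply/sub_kermxP.
    by rewrite -mulmxA homf mulmxA mulmx_ker mul0mx.
  by rewrite -[f]mul1mx; apply/eqP/sub_kermxP; rewrite sub1mx full.
have freef : row_free f by rewrite -kermx_eq0.
have fullf : row_full f.
  have modf : mxmodule (rho j) <<f>>%MS.
    apply/mxmoduleP => x _; rewrite (eqmxMr _ (genmxE f)) genmxE -homf.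
    exact: submxMl.
  have nz : <<f>>%MS != 0 by rewrite -mxrank_eq0 genmxE mxrank_eq0.
  by have := irr2 _ modf nz; rewrite /row_full genmxE.
apply/socle_rsimP; exists f => [|//|x _]; last exact: homf.
by move: freef fullf; rewrite /row_free /row_full => /eqP -> /eqP.
Qed.

End Orthogonality.

Section SchurAverage.

Variables (C : numClosedFieldType) (gT : finGroupType) (m n : nat).
Variables (V : mx_representation C [set: gT]%G m)
          (W : mx_representation C [set: gT]%G n).

Definition schur_avg (M : 'M_(m, n)) := \sum_(x : gT) V x *m M *m W x^-1%g.

Lemma schur_avg_hom M x : V x *m schur_avg M = schur_avg M *m W x.
Proof.
rewrite /schur_avg mulmx_sumr mulmx_suml (reindex_inj (mulgI x^-1%g)).
apply: eq_bigr => y _; rewrite !mulmxA -repr_mxM ?inE // mulKVg.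
by rewrite invMg invgK repr_mxM ?inE // mulmxA.
Qed.

(** The entry (k, l) of the averaged elementary matrix E_kl is the sum of V(x)_kk W(x^-1)_ll; this
    lets Schur's lemma act on character sums. *)
Lemma sum_mxtrace_schur :
  \sum_(x : gT) \tr (V x) * \tr (W x^-1%g) =
  \sum_k \sum_l schur_avg (delta_mx k l) k l.
Proof.
rewrite (eq_bigr (fun x => \sum_k \sum_l V x k k * W x^-1%g l l)).
  rewrite exchange_big; apply: eq_bigr => k _ /=.
  rewrite exchange_big; apply: eq_bigr => l _ /=.
  rewrite summxE; apply: eq_bigr => x _.
  rewrite -(mul_delta_mx (0 : 'I_1)) mulmxA -colE -mulmxA -rowE.
  by rewrite mxE big_ord1 !mxE.
move=> x _; rewrite /mxtrace mulr_suml; apply: eq_bigr => k _.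
by rewrite mulr_sumr.
Qed.

End SchurAverage.

(** By Schur's lemma [schur_avg] is scalar, and its trace fixes the scalar as |G| tr(M) / n. Only
    the diagonal elementary matrices contribute, each giving |G| / n. *)
Lemma sum_mxtrace_abs_irr (C : numClosedFieldType) (gT : finGroupType) n
    (V : mx_representation C [set: gT]%G n) :
    mx_absolutely_irreducible V ->
  \sum_(x : gT) \tr (V x) * \tr (V x^-1%g) = #|gT|%:R.
Proof.
move=> irrV; have n_gt0 : (0 < n)%N by case/andP: irrV.
have n_neq0 : n%:R != 0 :> C by rewrite pnatr_eq0 -lt0n.
have fE M : schur_avg V V M = (n%:R^-1 * (#|gT|%:R * \tr M))%:M.
  have /is_scalar_mxP[a Ea] : is_scalar_mx (schur_avg V V M).
    apply: (mx_abs_irr_cent_scalar irrV); apply/centgmxP => x _.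
    by rewrite schur_avg_hom.
  rewrite Ea; congr (_%:M); have trf : \tr (schur_avg V V M) = #|gT|%:R * \tr M.
    rewrite /schur_avg raddf_sum /= mulr_natl -sumr_const; apply: eq_bigr => x _.
    by rewrite mxtrace_mulC mulmxA -repr_mxM ?inE // mulVg repr_mx1 mul1mx.
  by rewrite -trf Ea mxtrace_scalar -[a *+ n]mulr_natl mulKf.
rewrite sum_mxtrace_schur (eq_bigr (fun _ => n%:R^-1 * #|gT|%:R)) => [|k _].
  by rewrite sumr_const card_ord -[LHS]mulr_natl mulVKf.
have tr1 : \tr (delta_mx k k : 'M[C]_n) = 1.
  rewrite /mxtrace (bigD1 k) //= mxE !eqxx big1 ?addr0 // => j nj.
  by rewrite mxE (negPf nj).
rewrite (bigD1 k) //= big1 => [|l nlk].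
  by rewrite fE mxE eqxx tr1 addr0 mulr1.
by rewrite fE mxE eq_sym (negPf nlk).
Qed.

Section Basis.

Variables (C : numClosedFieldType) (gT : finGroupType).

Lemma card_neq0 : #|gT|%:R != 0 :> C.
Proof. by rewrite pnatr_eq0 -lt0n; apply/card_gt0P; exists 1%g. Qed.

Lemma chi_orthonormal (i j : Irr C gT) : cfForm (chi i) (chi j) = (i == j)%:R.
Proof.
rewrite /cfForm (eq_bigr (fun x => \tr (irr_repr i x) * \tr (irr_repr j x^-1%g))).
  have [<-|neq_ij] := eqVneq i j.
    by rewrite sum_mxtrace_abs_irr ?mulVf ?card_neq0 //; apply: irr_abs_irreducible.
  rewrite sum_mxtrace_schur big1 ?mulr0 // => k _; rewrite big1 // => l _.
  by rewrite (hom_irr_eq0 neq_ij (schur_avg_hom _ _ _)) mxE.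
by move=> x _; rewrite !ffunE.
Qed.

Lemma cfFormDl (f g h : cfun C gT) : cfForm (f + g) h = cfForm f h + cfForm g h.
Proof.
rewrite /cfForm -mulrDr -big_split; congr (_ * _); apply: eq_bigr => x _.
by rewrite !ffunE mulrDl.
Qed.

Lemma cfFormZl a (f h : cfun C gT) : cfForm (a *: f) h = a * cfForm f h.
Proof.
rewrite /cfForm mulrCA; congr (_ * _); rewrite mulr_sumr; apply: eq_bigr => x _.
by rewrite !ffunE mulrA.
Qed.

Lemma cfForm_suml (I : finType) (F : I -> cfun C gT) h :
  cfForm (\sum_i F i) h = \sum_i cfForm (F i) h.
Proof.
apply: (big_morph (fun f => cfForm f h)) => [f g|]; first exact: cfFormDl.
by rewrite -(scale0r (0 : cfun C gT)) cfFormZl mul0r.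
Qed.

Lemma cfval_sum (I : finType) (F : I -> cfun C gT) x :
  (\sum_i F i) x = \sum_i F i x.
Proof.
apply: (big_morph (fun f : cfun C gT => f x)) => [f g|]; by rewrite ffunE.
Qed.

Lemma irr_tuple_nth (k : 'I_#|Irr C gT|) :
  (irr_tuple C gT)`_k = cfval (chi (enum_val k)).
Proof. by rewrite -tnth_nth tnth_mktuple. Qed.

Lemma irr_tuple_free : free (irr_tuple C gT).
Proof.
apply/freeP => a Ea k; pose F (j : 'I__) := a j *: chi (enum_val j) : cfun C gT.
have F0 : \sum_j F j = 0.
  apply: cfunP => x; rewrite cfval_sum ffunE.
  transitivity ((\sum_j a j *: (irr_tuple C gT)`_j) x); last by rewrite Ea ffunE.
  rewrite sum_ffunE; apply: eq_bigr => j _.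
  by rewrite irr_tuple_nth [LHS]ffunE [RHS]ffunE.
have := cfForm_suml F (chi (enum_val k)).
rewrite F0 (bigD1 k) //= cfFormZl chi_orthonormal eqxx mulr1 big1 => [|j njk].
  by rewrite addr0 => <-; rewrite -(scale0r (0 : cfun C gT)) cfFormZl mul0r.
by rewrite cfFormZl chi_orthonormal (inj_eq enum_val_inj) (negPf njk) mulr0.
Qed.

(** Indicators of classes span the class functions, and there are as many classes as irreducible
    representations, so the free family of characters spans by dimension. *)
Lemma cfun_irr_span (f : cfun C gT) : cfval f \in <<irr_tuple C gT>>%VS.
Proof.
pose ind (c : {set gT}) : {ffun gT -> C^o} := [ffun x => (x \in c)%:R].
pose T := [seq ind c | c <- enum (classes [set: gT])].
have spanT (g : cfun C gT) : cfval g \in <<T>>%VS.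
  have -> : cfval g = \sum_(c <- enum (classes [set: gT])) g (repr c) *: ind c.
    apply/ffunP => x; rewrite sum_ffunE big_enum /=.
    rewrite (bigD1 (x ^: [set: gT])%g) ?mem_classes ?inE //= big1 => [|c /andP[cl
      nc]].
      rewrite !ffunE class_refl addr0 [_ *: _]mulr1.
      have /imsetP[y _ ->] := mem_repr_classes (mem_classes (in_setT x)).
      by rewrite cfunJ.
    rewrite !ffunE; case: (boolP (x \in c)) => [xc|_]; last exact: mulr0.
    case/imsetP: cl nc xc => y _ -> nc /class_eqP E.
    by rewrite E eqxx in nc.
  rewrite big_seq; apply: rpred_sum => c cl; apply/rpredZ/memv_span.
  by apply: map_f.
have sub : (<<irr_tuple C gT>> <= <<T>>)%VS.
  by apply/span_subvP => _ /tnthP[k ->]; rewrite tnth_mktuple spanT.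
have dimT : (\dim <<T>> <= \dim <<irr_tuple C gT>>)%N.
  rewrite (eqnP irr_tuple_free) size_tuple (leq_trans (dim_span _)) //.
  rewrite size_map -cardE -(card_irr_pchar (DecSocleType (regular_repr C [set:
    gT]%G))) //.
    by rewrite /pgroup /pnat cardG_gt0; apply/allP => p _; rewrite inE /= pchar_num.
  exact: group_closure_closed_field.
by have /eqP -> : <<irr_tuple C gT>>%VS == <<T>>%VS; rewrite ?spanT // eqEdim sub.
Qed.

Lemma irr_coefE (f : cfun C gT) : f = \sum_i irr_coef f i *: chi i.
Proof.
apply: cfunP => x; rewrite cfval_sum {1}(coord_span (cfun_irr_span f)) sum_ffunE.
rewrite (reindex_onto enum_rank enum_val) => [|k _]; last exact: enum_valK.
apply: eq_big => [i|i _]; first by rewrite enum_rankK eqxx.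
by rewrite irr_tuple_nth enum_rankK !ffunE.
Qed.

Lemma irr_coef_form (f : cfun C gT) i : irr_coef f i = cfForm f (chi i).
Proof.
rewrite [in RHS](irr_coefE f) cfForm_suml (bigD1 i) //= cfFormZl chi_orthonormal.
rewrite eqxx mulr1 big1 ?addr0 // => j nji.
by rewrite cfFormZl chi_orthonormal (negPf nji) mulr0.
Qed.

Lemma irr_coord_sum (a : 'I_#|Irr C gT| -> C) :
  irr_coord (\sum_k a k *: chi (enum_val k)) =1 a.
Proof.
move=> k; rewrite -[k]enum_valK -/(irr_coef _ _) irr_coef_form enum_valK.
rewrite cfForm_suml (bigD1 k) //= cfFormZl chi_orthonormal eqxx mulr1.
rewrite big1 ?addr0 // => j njk.
by rewrite cfFormZl chi_orthonormal (inj_eq enum_val_inj) (negPf njk) mulr0.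
Qed.

End Basis.

(** * The maps eta_n *)

(** For n > 0 every element is conjugate into a Young subgroup with a single cycle as first
    component ([split_cycle]), and the second component is handled by induction. *)
Lemma wreath_ind (gT : finGroupType) (A : comNzRingType)
    (u v : forall n, wreath gT n -> A) :
    (forall n x z, u n (x ^ z)%g = u n x) -> (forall n x z, v n (x ^ z)%g = v n
      x) ->
    (forall p q n (e : (p + q = n)%N) h, u n (young e h) = u p h.1 * u q h.2) ->
    (forall p q n (e : (p + q = n)%N) h, v n (young e h) = v p h.1 * v q h.2) ->
    (forall x, u 0%N x = v 0%N x) ->
    (forall n (x : wreath gT n.+1), single x -> u n.+1 x = v n.+1 x) ->
  forall n x, u n x = v n x.
Proof.
move=> uJ vJ uY vY uv0 uv1; elim/ltn_ind => -[|n] IHn x; first exact: uv0.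
have AP : porbit (wperm x) ord0 \in porbits (wperm x) by apply: imset_f.
have [A_gt0 le_A] := andP (porbits_card_bound AP).
have e := subnKC le_A; set q := (n.+1 - _)%N in e.
have [z [h [Ez sh _]]] := split_cycle e AP (porbit_id _ _) erefl.
rewrite -(uJ _ x z) -(vJ _ x z) Ez uY vY (IHn q) ?ltn_subrL ?A_gt0 //.
by congr (_ * _); case: #|_| A_gt0 (h.1) sh => // p _ y; apply: uv1.
Qed.

Section TensorCharacter.

Variables (C : numClosedFieldType) (gT : finGroupType).
Variables (d : nat) (V : mx_representation C [set: gT]%G d).

Lemma tens_charE n (x : wreath gT n) :
  tens_char V n x = \sum_(b : {ffun 'I_n -> 'I_d})
    \prod_i V (wbase x i) (b i) (b ((wperm x)^-1 i)%g).
Proof.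
rewrite ffunE /mxtrace /= (reindex_onto enum_rank enum_val) => [|k _]; last first.
  exact: enum_valK.
apply: eq_big => [b|b _]; first by rewrite enum_rankK eqxx.
by rewrite mxE /tens_idx enum_rankK.
Qed.

Lemma big_young (R : Type) (idx : R) (op : Monoid.com_law idx) p q k
    (e : (p + q = k)%N) (F : 'I_k -> R) :
  \big[op/idx]_i F i =
  op (\big[op/idx]_a F (ylft e a)) (\big[op/idx]_b F (yrgt e b)).
Proof.
case: k / e F => F; rewrite big_split_ord /=; congr (op _ _).
  by apply: eq_bigr => a _; congr F; apply: val_inj.
by apply: eq_bigr => a _; congr F; apply: val_inj.
Qed.

Lemma tens_char_young p q n (e : (p + q = n)%N) (h : wreath gT p * wreath gT q) :
  tens_char V n (young e h) = tens_char V p h.1 * tens_char V q h.2.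
Proof.
rewrite !tens_charE mulr_suml.
rewrite (eq_bigr _ (fun b1 _ => mulr_sumr _ _ _ _)) pair_bigA /=.
pose glue (b : {ffun 'I_p -> 'I_d} * {ffun 'I_q -> 'I_d}) : {ffun 'I_n -> 'I_d} :=
  [ffun i => match young_split e i with inl a => b.1 a | inr c => b.2 c end].
pose cut (b : {ffun 'I_n -> 'I_d}) : {ffun 'I_p -> 'I_d} * {ffun 'I_q -> 'I_d} :=
  ([ffun a => b (ylft e a)], [ffun c => b (yrgt e c)]).
have glue_l b a : glue b (ylft e a) = b.1 a by rewrite ffunE young_unsplitK.
have glue_r b a : glue b (yrgt e a) = b.2 a by rewrite ffunE young_unsplitK.
rewrite (reindex_onto glue cut) => [|b _]; last first.
  apply/ffunP => i; have [[a ->]|[c ->]] := ysplitP e i.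
    by rewrite glue_l ffunE.
  by rewrite glue_r ffunE.
apply: eq_big => [b|b _].
  apply/eqP; rewrite [b]surjective_pairing /cut; congr (_, _); apply/ffunP => i.
    by rewrite ffunE glue_l.
  by rewrite ffunE glue_r.
rewrite (big_young _ e); congr (_ * _); apply: eq_bigr => a _.
  rewrite glue_l wbase_young_lft; congr (V _ _ _).
  rewrite -(glue_l b); congr (glue b _); apply: (@perm_inj _ (wperm (young e h))).
  by rewrite permKV wperm_young_lft permKV.
rewrite glue_r wbase_young_rgt; congr (V _ _ _).
rewrite -(glue_r b); congr (glue b _); apply: (@perm_inj _ (wperm (young e h))).
by rewrite permKV wperm_young_rgt permKV.
Qed.

(** Concentrating the whole cycle-product at one point keeps its class, so [conj_single] applies;
    the trace of a tensor power is easy to compute on this form. *)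
Lemma conj_single_base n (x : wreath gT n) a : single x ->
  exists z, (x ^ z)%g =
    Wreath [ffun i => if i == a then cycle_prod x (wperm x a) else 1%g] (wperm x).
Proof.
move=> sx; set g := cycle_prod _ _; set y := Wreath _ _.
apply: (@conj_single _ _ _ _ (wperm x a) (wperm x a) 1%g) => //.
pose w : wreath gT n := Wreath [ffun=> 1%g] (wperm x).
have Ey : y = (Wreath [ffun i => if i == a then g else 1%g] 1%g * w)%g.
  apply: wreathP => [i|] /=; last by rewrite mulg1.
  by rewrite !ffunE mulg1.
have := cycle_prod_mulc w g a; rewrite -Ey /= => ->; rewrite conjg1.
by rewrite [X in (_ * X)%g]big1 ?mulg1 // => i _; rewrite ffunE.
Qed.

(** Once the base is concentrated at [a], the identity matrices at the other points force [b] to be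
    constant along the cycle, and the sum over this constant is the trace of [V] at the
    cycle-product. *)
Lemma tens_char_single n (x : wreath gT n.+1) a : single x ->
  tens_char V n.+1 x = mx_char V (cycle_prod x (wperm x a)).
Proof.
move=> sx; have [z Ez] := conj_single_base a sx.
rewrite -(cfunJ (tens_char V n.+1) x z) Ez tens_charE /= [RHS]ffunE /mxtrace.
set g := cycle_prod _ _; set s := wperm x.
rewrite (partition_big (fun b : {ffun 'I_n.+1 -> 'I_d} => b a) xpredT) //=.
apply: eq_bigr => j _; rewrite (bigD1 [ffun=> j]) ?ffunE //=.
rewrite [X in _ + X]big1 ?addr0 => [|b /andP[/eqP ba nb]].
  rewrite (bigD1 a) //= !ffunE eqxx big1 ?mulr1 // => i ni.
  by rewrite !ffunE (negPf ni) repr_mx1 mxE eqxx.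
(* If [b] could change only on arrival at [a], walking along the cycle from [a] would show it
   constant. *)
have [i ni ib] : exists2 i, i != a & b i != b ((s^-1)%g i).
  apply/exists_inP; apply: contraNT nb => /exists_inPn H.
  apply/eqP/ffunP => i; rewrite ffunE -ba.
  have := singleP a i sx; rewrite porbit_traject => /trajectP[k lt_k ->].
  elim: k lt_k => // k IHk lt_k; rewrite iterS.
  have := H (s (iter k s a)); rewrite permK => /(_ _)/negPn/eqP -> //.
    by apply: IHk; apply: ltnW.
  rewrite -iterS; apply/eqP => E; have := uniq_traject_porbit s a.
  have := lt_k; case: #|_| => // l; rewrite ltnS => le_kl.
  rewrite trajectS /= => /andP[/negP[]]; apply/trajectP; exists k => //.
  by rewrite -iterSr E.
by rewrite (bigD1 i) //= ffunE (negPf ni) repr_mx1 mxE (negPf ib) mul0r.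
Qed.

Lemma tens_char_cprodT n (x : wreath gT n) :
  tens_char V n x = cprodT (fun _ g => mx_char V g) x.
Proof.
have phiJ (k : nat) g h : mx_char V (g ^ h)%g = mx_char V g by rewrite cfunJ.
move: n x; apply: wreath_ind => [n x z|n x z|p q n e h|p q n e h|x|n x sx].
- exact: cfunJ.
- exact: (cprodTJ phiJ).
- exact: tens_char_young.
- exact: (cprodT_young phiJ).
- rewrite tens_charE /cprodT big_pred0 => [|A]; last by apply/imsetP => -[[]].
  rewrite (big_pred1 (ffun0 (card_ord 0))).
    by rewrite big_ord0.
  by move=> b; apply/esym/eqP/ffunP => -[].
rewrite (tens_char_single ord0 sx) /cprodT (big_pred1 [set: 'I_n.+1]) => [|B /=].
  by rewrite (cyc_valE _ phiJ sx (in_setT (wperm x ord0))).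
apply/idP/eqP => [BP|-> //]; have [i _ ->] := imsetP BP.
exact: porbit_single.
Qed.

End TensorCharacter.

Section EvalDensity.
Import mpoly.

Variables (C : numFieldType) (n : nat).

Lemma poly_nat_roots (q : {poly C}) : (forall k : nat, q.[k%:R] = 0) -> q = 0.
Proof.
move=> Hq; apply/eqP/negPn/negP => nzq.
have := @max_poly_roots _ q [seq k%:R | k <- iota 0 (size q)] nzq.
rewrite size_map size_iota ltnn => H; suff: false by [].
apply: H; first by apply/allP => _ /mapP[k _ ->]; apply/rootP.
by rewrite map_inj_uniq ?iota_uniq // => k l /eqP; rewrite eqr_nat => /eqP.
Qed.

Lemma meval_nat_eq0 (P : {mpoly C[n]}) :
  (forall v : 'I_n -> nat, meval (fun i => (v i)%:R) P = 0) ->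
  forall v, meval v P = 0.
Proof.
(* Coordinates of index at least [m] are natural, the others arbitrary. Each step frees one
   coordinate: the value is a polynomial in it that vanishes at all natural numbers. *)
move=> HP; suff H m v : (forall i : 'I_n, (m <= i)%N -> exists k : nat, v i =
  k%:R) ->
    meval v P = 0.
  by move=> v; apply: (H n) => i; rewrite leqNgt ltn_ord.
elim: m v => [|m IHm] v Hv.
  have Hw i : exists k : nat, v i == k%:R by have [k ->] := Hv i isT; exists k.
  rewrite (@meval_eq _ _ v (fun i => (xchoose (Hw i))%:R)) ?HP // => i.
  exact/eqP/(xchooseP (Hw i)).
pose u (t : C) (i : 'I_n) := if i == m :> nat then t else v i.
pose q : {poly C} := \sum_(e <- msupp P) P@_e *:
  \prod_(i < n) (if i == m :> nat then 'X else (v i)%:P) ^+ e i.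
have qE t : q.[t] = meval (u t) P.
  rewrite /q horner_sum mevalE; apply: eq_bigr => e _.
  rewrite hornerZ horner_prod; congr (_ * _); apply: eq_bigr => i _.
  by rewrite horner_exp /u; case: ifP => _; rewrite ?hornerX ?hornerC.
have q0 : q = 0.
  apply: poly_nat_roots => k; rewrite qE; apply: IHm => i.
  rewrite leq_eqVlt /u => /orP[/eqP <-|lt_mi]; first by exists k; rewrite eqxx.
  by rewrite (gtn_eqF lt_mi); apply: Hv.
have [lt_mn|le_nm] := ltnP m n; last first.
  by apply: IHm => i le_mi; have := leq_trans le_nm le_mi; rewrite leqNgt ltn_ord.
rewrite (@meval_eq _ _ v (u (v (Ordinal lt_mn)))) -?qE ?q0 ?horner0 // => i.
by rewrite /u; case: eqP => // E; congr v; apply: val_inj.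
Qed.

End EvalDensity.

Lemma cfunZE (C : numClosedFieldType) (G : finGroupType) a (f : cfun C G) x :
  (a *: f) x = a * f x.
Proof. by rewrite ffunE. Qed.

Section Eta.

Variables (C : numClosedFieldType) (gT : finGroupType).

Lemma cfun_weightJ (f : cfun C gT) (k : nat) g h : f (g ^ h)%g = f g.
Proof. exact: cfunJ. Qed.

(** An explicit candidate for [cf_eta], which is defined only through [eta_spec]; [cf_etaE]
    identifies the two. *)
Definition eta n (f : cfun C gT) : cfun C (wreath gT n) :=
  mk_cfun (@cprodTJ gT C (fun _ g => f g) (cfun_weightJ f) n).

Lemma etaE n f (x : wreath gT n) : eta n f x = cprodT (fun _ g => f g) x.
Proof. by rewrite ffunE. Qed.

Section Polynomiality.
Import mpoly.

(** Each value of [f] is a linear form in its coordinates, and [eta] multiplies one such form for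
    each cycle. *)
Lemma eta_mpoly n (x : wreath gT n) :
  exists P, forall f, eta n f x = meval (irr_coord f) P.
Proof.
pose L g : {mpoly C[#|Irr C gT|]} := \sum_k (chi (enum_val k) g) *: 'X_k.
have LE (f : cfun C gT) g : f g = meval (irr_coord f) (L g).
  rewrite raddf_sum /= {1}(irr_coefE f) cfval_sum.
  rewrite (reindex_onto enum_rank enum_val) => [|k _]; last exact: enum_valK.
  apply: eq_big => [i|i _]; first by rewrite enum_rankK eqxx.
  by rewrite mevalZ mevalXU enum_rankK !ffunE mulrC.
exists (cprodT (fun _ g => L g) x) => f.
rewrite etaE /cprodT rmorph_prod; apply: eq_bigr => B _.
by rewrite /cyc_val; case: pickP => [j _|_] /=; rewrite ?LE ?meval1.
Qed.

End Polynomiality.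

Lemma cfInd_young p q n (e : (p + q = n)%N) (phi : cfun C (wreath gT p * wreath
  gT q)%type)
    (U : wreath gT n -> {set 'I_n} -> C) x :
    (forall x z S, U (x ^ z)%g S = U x (wperm z @: S)) ->
    (forall h, phi h = U (young e h) (yset e)) ->
  cfInd (young e) phi x = \sum_(S : {set 'I_n} | (#|S| == p) && stab x S) U x S.
Proof.
move=> UJ phiE; rewrite ffunE.
rewrite (eq_bigr (fun z => \sum_(h | young e h == (x ^ z)%g) U (young e h) (yset
  e))).
  rewrite (sum_young_conj e UJ) -[X in _ * X]mulr_natl mulrA mulVf ?mul1r //.
  by rewrite pnatr_eq0 -lt0n; apply/card_gt0P; exists 1%g.
by move=> z _; apply: eq_bigr => h _; apply: phiE.
Qed.

(** There is one sign per cycle, and (-1) to the number of cycles is (-1)^n times the signature;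
    this is how the sign character enters. *)
Lemma cprodTN (f : cfun C gT) n (x : wreath gT n) :
  cprodT (fun _ g => (- f) g) x =
  (-1) ^+ n * (-1) ^+ wperm x * cprodT (fun _ g => f g) x.
Proof.
rewrite /cprodT (eq_bigr (fun B => - cyc_val 1 (fun _ g => f g) x B)); last first.
  move=> B BP; have [i _ EB] := imsetP BP;
    have iB : i \in B by rewrite EB porbit_id.
  rewrite (cyc_valE _ (cfun_weightJ f) BP iB).
  by rewrite (cyc_valE _ (cfun_weightJ (- f)) BP iB) ffunE.
rewrite prodrN; congr (_ * _); rewrite /odd_perm card_ord.
by rewrite -[in RHS]signr_odd -signr_addb addbA addbb addFb signr_odd.
Qed.

(** Expanding the product over cycles of V - W assigns each cycle to one of the two Young factors,
    and [cprodTN] turns the signs of -W into (-1)^m and the sign character. *)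
Lemma eta_spec_eta n : eta_spec (@eta n).
Proof.
split=> [x|d d' V W]; first exact: eta_mpoly.
apply: cfunP => x; rewrite cfval_sum etaE.
pose fV (k : nat) g := mx_char V g; pose fW (k : nat) g := (- mx_char W) g.
have fVJ : forall k g h, fV k (g ^ h)%g = fV k g by exact: cfun_weightJ.
have fWJ : forall k g h, fW k (g ^ h)%g = fW k g by exact: cfun_weightJ.
pose U (y : wreath gT n) (S : {set 'I_n}) := cprod fV y S * cprod fW y (~: S).
have UJ y z S : U (y ^ z)%g S = U y (wperm z @: S).
  by rewrite /U cprodJ // cprodCJ.
transitivity (\sum_(S : {set 'I_n} | stab x S) U x S).
  rewrite -prodrD_porbits; apply: eq_bigr => B BP; have [i _ EB] := imsetP BP.
  have iB : i \in B by rewrite EB porbit_id.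
  rewrite (cyc_valE _ fVJ BP iB) (cyc_valE _ fWJ BP iB).
  by rewrite (cyc_valE _ (cfun_weightJ _) BP iB) ffunE.
(* [m] is the size of the complement of [S], as [eta_spec] places the first character on the first n
   - m points. *)
rewrite (partition_big (fun S : {set 'I_n} => inord (n - #|S|) : 'I_n.+1) xpredT)
  //.
apply: eq_bigr => m _; rewrite cfunZE.
have leS (S : {set 'I_n}) : (#|S| <= n)%N by rewrite (leq_trans (max_card _))
  ?card_ord.
set phi := cfExt _ _.
have phiE h : ((-1) ^+ m *: phi) h = U (young (subnK (leq_ord m)) h) (yset (subnK
  (leq_ord m))).
  rewrite /U cprod_young_lft // cprod_young_rgt // cprodTN -tens_char_cprodT.
  rewrite !ffunE /= -tens_char_cprodT !ffunE /= [_ *: _]mulrCA.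
  by congr (_ * _); rewrite mulrA [RHS]mulrAC.
transitivity (cfInd (young (subnK (leq_ord m))) ((-1) ^+ m *: phi) x).
  rewrite (cfInd_young x UJ phiE); apply: eq_bigl => S.
  rewrite andbC; congr (_ && _);
    rewrite -(inj_eq val_inj) /= inordK ?ltnS ?leq_subr //.
  have := leS S; have := leq_ord m; move: #|S| => k le_mn le_kn.
  by apply/eqP/eqP; lia.
rewrite [LHS]ffunE [X in _ = _ * X]ffunE [RHS]mulrCA; congr (_ * _);
  rewrite mulr_sumr; apply: eq_bigr => z _.
by rewrite mulr_sumr; apply: eq_bigr => h _; rewrite cfunZE.
Qed.

Lemma exists_repr (v : Irr C gT -> nat) :
  exists d (V : mx_representation C [set: gT]%G d),
    mx_char V = \sum_i (v i)%:R *: chi i.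
Proof.
pose W i := character.Representation (irr_repr (i : Irr C gT)).
pose R := \big[@character.dadd_grepr C gT [set: gT]%G/character.grepr0]_i
            character.muln_grepr (W i) (v i).
have charE (R1 R2 : character.representation C [set: gT]%G) :
    mx_char (character.mx_repr_of_repr (character.dadd_grepr R1 R2)) =
    mx_char (character.mx_repr_of_repr R1) + mx_char (character.mx_repr_of_repr R2).
  by apply: cfunP => x; rewrite !ffunE mxtrace_block.
have char0 : mx_char (character.mx_repr_of_repr
    (@character.grepr0 C gT [set: gT]%G)) = 0.
  by apply: cfunP => x; rewrite !ffunE mxtrace1.
exists (character.rdegree R), (character.mx_repr_of_repr R).
rewrite (big_morph (fun R => mx_char (character.mx_repr_of_repr R)) charE char0).
apply: eq_bigr => i _.
rewrite (big_morph (fun R => mx_char (character.mx_repr_of_repr R)) charE char0).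
by rewrite sumr_const card_ord scaler_nat.
Qed.

(** [xget] returns a solution of [eta_spec] because [eta] is one. Two solutions are polynomial in
    the coordinates and agree at natural ones, which belong to actual representations; hence they
    agree everywhere. *)
Lemma cf_etaE n (f : cfun C gT) (x : wreath gT n) : cf_eta n f x = cprodT (fun _
  g => f g) x.
Proof.
rewrite -etaE; have : eta_spec (@cf_eta C gT n).
  by apply: classical_sets.xgetPex; exists (@eta n); apply: eta_spec_eta.
have := @eta_spec_eta n; move: (@cf_eta C gT n) => F [polE specE] [polF specF].
have [P EP] := polE x; have [Q EQ] := polF x; rewrite EP EQ.
apply/eqP; rewrite -subr_eq0 -mpoly.mevalB; apply/eqP; apply: meval_nat_eq0 => v.
rewrite mpoly.mevalB; pose f0 := \sum_k (v k)%:R *: chi (enum_val k) : cfun C gT.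
have E : irr_coord f0 =1 (fun k => (v k)%:R) := irr_coord_sum _.
rewrite -!(mpoly.meval_eq _ E) -EP -EQ.
have [d [V EV]] := exists_repr (v \o enum_rank).
have [d' [W EW]] := exists_repr (fun=> 0%N).
have -> : f0 = mx_char V - mx_char W.
  rewrite EV EW [X in _ - X]big1 ?subr0 => [|i _]; last by rewrite scale0r.
  rewrite /f0 (reindex_onto enum_rank enum_val) => [|k _]; last exact: enum_valK.
  apply: eq_big => [i|i _]; first by rewrite enum_rankK eqxx.
  by rewrite enum_rankK.
by rewrite specE specF subrr.
Qed.

(** Reduces every statement on E to the one on H for [- gamma]. *)
Lemma cf_eps_sign n (f : cfun C gT) : (-1) ^+ n *: cf_eps n f = cf_eta n (- f).
Proof.
apply: cfunP => x; rewrite cf_etaE cprodTN -cf_etaE !ffunE [_ *: _]mulrA.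
by rewrite mulrAC.
Qed.

Lemma cf_etaM n (f g : cfun C gT) : cfMul (cf_eta n f) (cf_eta n g) = cf_eta n
  (cfMul f g).
Proof.
apply: cfunP => x; rewrite ffunE !cf_etaE /cprodT -big_split;
  apply: eq_bigr => B BP.
have [i _ EB] := imsetP BP; have iB : i \in B by rewrite EB porbit_id.
by rewrite !(cyc_valE _ (cfun_weightJ _) BP iB) ffunE.
Qed.

End Eta.

(** * Exponentials of operator series *)

Lemma sum_triangle (V : nmodType) n (F : nat -> nat -> V) :
  \sum_(i < n.+1) \sum_(j < (n - i).+1) F i j =
  \sum_(j < n.+1) \sum_(i < (n - j).+1) F i j.
Proof.
have widen (G : nat -> nat -> V) : \sum_(i < n.+1) \sum_(j < (n - i).+1) G i j =
    \sum_(i < n.+1) \sum_(j < n.+1 | (i + j <= n)%N) G i j.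
  apply: eq_bigr => i _; rewrite (big_ord_widen n.+1) ?ltnS ?leq_subr //.
  by apply: eq_bigl => j; rewrite ltnS leq_subRL // -ltnS.
rewrite widen (widen (fun j i => F i j)) (exchange_big_dep xpredT) //=.
by apply: eq_bigr => j _; apply: eq_bigl => i; rewrite addnC.
Qed.

Section OpserExp.

Variables (C : numClosedFieldType) (V : lmodType C) (A : opser V).

Hypothesis A_lin : forall n, linear (A n).
Hypothesis A_comm : forall i j v, A i (A j v) = A j (A i v).

Lemma opserD n u v : A n (u + v) = A n u + A n v.
Proof. by have := A_lin n 1 u v; rewrite !scale1r. Qed.

Lemma opser0 n : A n 0 = 0.
Proof. by apply: (addrI (A n 0)); rewrite -opserD !addr0. Qed.

Lemma opserZ n a v : A n (a *: v) = a *: A n v.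
Proof. by have := A_lin n a v 0; rewrite opser0 !addr0. Qed.

Lemma opser_sum n (I : Type) (r : seq I) (P : pred I) (F : I -> V) :
  A n (\sum_(i <- r | P i) F i) = \sum_(i <- r | P i) A n (F i).
Proof. by apply: (big_morph (A n) (opserD n) (opser0 n)). Qed.

Lemma opser_powS k n v :
  opser_pow A k.+1 n v = \sum_(i < n.+1) A i (opser_pow A k (n - i)%N v).
Proof. exact: erefl. Qed.

Lemma opser_pow_lin k n : linear (opser_pow A k n).
Proof.
elim: k n => [|k IHk] n a u v.
  by rewrite /opser_pow /= /opser_one; case: ifP => // _; rewrite scaler0 addr0.
rewrite !opser_powS scaler_sumr -big_split; apply: eq_bigr => i _ /=.
by rewrite IHk A_lin.
Qed.

Lemma opser_exp_lin n : linear (opser_exp A n).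
Proof.
move=> a u v; rewrite /opser_exp scaler_sumr -big_split; apply: eq_bigr => k _ /=.
by rewrite opser_pow_lin scalerDr !scalerA mulrC.
Qed.

(** The rule (A^k)' = k A' A^(k-1) for the Euler operator w d/dw, read in coefficients; commutation
    brings the differentiated factor to the front. *)
Lemma opser_pow_deriv k n v :
  n%:R *: opser_pow A k n v =
  k%:R *: \sum_(i < n.+1) i%:R *: A i (opser_pow A k.-1 (n - i)%N v).
Proof.
elim: k n => [|k IHk] n.
  rewrite scale0r /opser_pow /= /opser_one; case: eqP => [->|_].
    by rewrite scale0r.
  by rewrite scaler0.
pose W i := A i (opser_pow A k (n - i)%N v).
rewrite opser_powS scaler_sumr.
(* Leibniz rule through n = i + (n - i): the first part differentiates the new factor, the second
   the remaining power. *)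
rewrite (eq_bigr (fun i : 'I__ => i%:R *: W i + (n - i)%:R *: W i)); last first.
  by move=> i _; rewrite -scalerDl -natrD subnKC // -ltnS.
rewrite big_split /=.
set D := \sum_(i < _) i%:R *: _; set R := \sum_(i < _) _.
suff -> : R = k%:R *: D by rewrite -natr1 scalerDl scale1r addrC.
rewrite /R (eq_bigr (fun i : 'I__ => k%:R *: \sum_(j < (n - i).+1)
    j%:R *: A j (A i (opser_pow A k.-1 (n - i - j)%N v)))); last first.
  move=> i _; rewrite -opserZ IHk opserZ opser_sum; congr (_ *: _).
  by apply: eq_bigr => j _; rewrite opserZ A_comm.
rewrite -scaler_sumr (sum_triangle n (fun i j =>
  j%:R *: A j (A i (opser_pow A k.-1 (n - i - j)%N v)))).
have [k0|k_gt0] := posnP k; first by rewrite k0 !scale0r.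
congr (_ *: _); apply: eq_bigr => j _; rewrite -scaler_sumr -opser_sum.
rewrite /W -[in RHS](prednK k_gt0) opser_powS; congr (_ *: A _ _);
  apply: eq_bigr => i _.
by rewrite subnAC.
Qed.

Hypothesis A0 : forall v, A 0 v = 0.

Lemma opser_pow_small k n v : (n < k)%N -> opser_pow A k n v = 0.
Proof.
elim: k n => // k IHk n; rewrite ltnS => le_nk; rewrite opser_powS.
apply: big1 => -[[|i] /= lt_in] _; first exact: A0.
rewrite IHk ?opser0 //; apply: leq_trans le_nk.
by rewrite ltn_subrL (leq_ltn_trans (leq0n i) lt_in).
Qed.

Lemma opser_exp0 v : opser_exp A 0 v = v.
Proof. by rewrite /opser_exp big_ord1 fact0 invr1 scale1r. Qed.

(** The equation w T' = (w A') T for T = exp(A), obtained by summing [opser_pow_deriv], with (k + 1)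
    / (k + 1)! = 1 / k!. *)
Lemma opser_exp_rec n v :
  n%:R *: opser_exp A n v = \sum_(i < n.+1) i%:R *: A i (opser_exp A (n - i)%N v).
Proof.
(* Powers beyond the degree vanish, so coefficients of different degrees can share one truncation
   bound. *)
have expE m N : (m < N)%N ->
    opser_exp A m v = \sum_(k < N) (k`!)%:R^-1 *: opser_pow A k m v.
  move=> lt_mN; rewrite /opser_exp (big_ord_widen N
    (fun k => (k`!)%:R^-1 *: opser_pow A k m v)) // [LHS]big_mkcond /=.
  apply: eq_bigr => k _; case: ltnP => // lt_mk.
  by rewrite opser_pow_small ?scaler0.
rewrite /opser_exp scaler_sumr big_ord_recl fact0 invr1 scale1r.
rewrite opser_pow_deriv scale0r add0r.
transitivity (\sum_(k < n) \sum_(i < n.+1)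
    (k`!)%:R^-1 *: (i%:R *: A i (opser_pow A k (n - i)%N v))).
  apply: eq_bigr => k _; rewrite -scaler_sumr scalerA mulrC -scalerA.
  rewrite opser_pow_deriv scalerA; congr (_ *: _).
  rewrite factS natrM invfM mulrAC mulVf ?mul1r //.
  by rewrite pnatr_eq0.
rewrite exchange_big; apply: eq_bigr => -[[|i] /= lt_in] _.
  by rewrite scale0r big1 // => k _; rewrite scale0r scaler0.
rewrite -/(opser_exp A (n - i.+1)%N v) (@expE _ n); last first.
  by rewrite ltn_subrL (leq_ltn_trans (leq0n i) lt_in).
rewrite opser_sum scaler_sumr; apply: eq_bigr => k _.
by rewrite opserZ !scalerA mulrC.
Qed.

(** The term i = 0 carries the factor 0, so after division by n the recursion expresses [T n]
    through earlier values. *)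
Lemma opser_exp_unique (T : nat -> V) v :
    T 0%N = v ->
    (forall n, n%:R *: T n = \sum_(i < n.+1) i%:R *: A i (T (n - i)%N)) ->
  forall n, T n = opser_exp A n v.
Proof.
move=> T0 recT; elim/ltn_ind => -[|n] IHn; first by rewrite T0 opser_exp0.
have n_neq0 : n.+1%:R != 0 :> C by rewrite pnatr_eq0.
apply: (scalerI n_neq0); rewrite recT opser_exp_rec;
  apply: eq_bigr => -[[|i] /= lt_in] _.
  by rewrite !scale0r.
by rewrite IHn // ltn_subrL.
Qed.

End OpserExp.

(** * Creation operators *)

Section Creation.

Variables (C : numClosedFieldType) (gT : finGroupType).
Variables (S : comAlgType C) (a : nat -> Irr C gT -> S).

(** The power sum a_{-k}(c) for the class c of [g], in an arbitrary commutative algebra where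
    [a k i] stands for a_{-k}(gamma_i). *)
Definition cls_sum k g : S := \sum_i chi i g^-1%g *: a k i.

Lemma cls_sumJ k g h : cls_sum k (g ^ h)%g = cls_sum k g.
Proof. by apply: eq_bigr => i _; rewrite -conjVg cfunJ. Qed.

Definition char_map n (f : cfun C (wreath gT n)) : S :=
  mean (fun x => f x *: cprodT cls_sum x).

Lemma char_map_ind p q n (e : (p + q = n)%N) (f : cfun C (wreath gT p))
    (g : cfun C (wreath gT q)) :
  char_map (cfInd (young e) (cfExt f g)) = char_map f * char_map g.
Proof.
pose Psi := cprodT cls_sum (n := n).
have PsiJ x z : Psi (x ^ z)%g = Psi x by exact: (cprodTJ cls_sumJ).
rewrite -meanM /char_map /mean.
transitivity (#|{: wreath gT n}|%:R^-1 *: (#|{: wreath gT p * wreath gT q}|%:R^-1 *: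
   \sum_(x : wreath gT n) \sum_(z : wreath gT n)
      \sum_(h | young e h == (x ^ z)%g) cfExt f g h *: Psi (x ^ z)%g)).
  congr (_ *: _); rewrite scaler_sumr; apply: eq_bigr => x _.
  rewrite ffunE -scalerA; congr (_ *: _); rewrite scaler_suml;
    apply: eq_bigr => z _.
  by rewrite scaler_suml; apply: eq_bigr => h _; rewrite PsiJ.
rewrite scalerA mulrC -scalerA; congr (_ *: _).
rewrite exchange_big /= (eq_bigr (fun=> \sum_h cfExt f g h *: Psi (young e h))).
  rewrite sumr_const -[X in _ *: X]scaler_nat scalerA mulVf ?scale1r
    ?card_wreath_neq0 //.
  apply: eq_bigr => h _; rewrite ffunE /Psi (cprodT_young cls_sumJ).
  by rewrite -scalerAl -scalerAr scalerA.
move=> z _; rewrite (exchange_big_dep xpredT) //=; apply: eq_bigr => h _.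
rewrite (big_pred1 (young e h ^ z^-1)%g) ?conjgKV // => x.
by rewrite eq_sym -[RHS](inj_eq (conjg_inj z)) conjgKV.
Qed.

Variable gamma : cfun C gT.

Definition lin_gen k : S := \sum_i irr_coef gamma i *: a k i.

(** The weight of a k-cycle is gamma(g) times its power sum. By [single_meanE] p_k is the mean of
    this weight over the group, and the means of gamma(g) chi_i(g^-1) are the coordinates of
    gamma. *)
Lemma char_map_eta_rec n :
  n%:R *: char_map (cf_eta n gamma) =
  \sum_(k < n.+1) (if k == 0%N :> nat then 0 else lin_gen k) *
                  char_map (cf_eta (n - k)%N gamma).
Proof.
pose phi k g : S := gamma g *: cls_sum k g.
have phiJ k g h : phi k (g ^ h)%g = phi k g by rewrite /phi cfunJ cls_sumJ.
have E m : char_map (cf_eta m gamma) = mean (cprodT phi (n := m)).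
  rewrite /char_map /mean; congr (_ *: _); apply: eq_bigr => x _.
  rewrite cf_etaE /cprodT -scaler_prod; apply: eq_bigr => B BP.
  have [i _ EB] := imsetP BP; have iB : i \in B by rewrite EB porbit_id.
  rewrite (cyc_valE _ phiJ BP iB) (cyc_valE _ cls_sumJ BP iB).
  by rewrite (cyc_valE _ (cfun_weightJ gamma) BP iB).
rewrite E mean_cprodT_rec //; apply: eq_bigr => -[[|k] /= lt_kn] _.
  rewrite E /single_mean /mean big1 ?scaler0 // => x _.
  by case: ifP => // /imsetP[[]].
rewrite E single_meanE // /lin_gen; congr (_ * _); rewrite /phi.
rewrite (eq_bigr (fun g => \sum_i (gamma g * chi i g^-1%g) *: a k.+1 i));
  last first.
  by move=> g _; rewrite /cls_sum scaler_sumr; apply: eq_bigr => i _;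
    rewrite scalerA.
rewrite exchange_big scaler_sumr; apply: eq_bigr => i _ /=.
by rewrite -scaler_suml scalerA irr_coef_form.
Qed.

Lemma char_map_eta_exp (A : opser S) :
    (forall n v, A n v = if n == 0%N then 0 else n%:R^-1 *: (lin_gen n * v)) ->
  forall n v, char_map (cf_eta n gamma) * v = opser_exp A n v.
Proof.
move=> AE n v.
apply: (@opser_exp_unique _ _ A _ _ _ (fun n => char_map (cf_eta n gamma) * v)).
- move=> m b u w; rewrite !AE; case: ifP => _; first by rewrite scaler0 addr0.
  by rewrite mulrDr scalerDr -scalerAr !scalerA mulrC.
- move=> i j u; rewrite !AE; do 2!case: ifP => _; rewrite ?mulr0 ?scaler0 //.
  by rewrite -!scalerAr !scalerA mulrC; congr (_ *: _); apply: mulrCA.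
- by move=> u; rewrite AE.
- rewrite -[RHS]mul1r; congr (_ * _); rewrite -[RHS](mean_cst gT 0 (1 : S)).
  rewrite /char_map /mean; congr (_ *: _); apply: eq_bigr => x _.
  by rewrite cf_etaE /cprodT !big_pred0 ?scale1r // => B; apply/imsetP => -[[]].
move=> m; rewrite scalerAl char_map_eta_rec mulr_suml;
  apply: eq_bigr => -[[|k] /= lt_kn] _.
  by rewrite scale0r !mul0r.
by rewrite AE /= scalerA mulfV ?pnatr_eq0 // scale1r mulrA.
Qed.

End Creation.

(** * Annihilation operators *)

Lemma sum_card_porbits_sub (gT : finGroupType) n (x : wreath gT n) (S : {set
  'I_n}) :
  stab x S -> (\sum_(B in porbits (wperm x) | B \subset S) #|B|)%N = #|S|.
Proof.
move=> stS; rewrite -[RHS]sum1_card (partition_big (porbit (wperm x))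
  (fun B => (B \in porbits (wperm x)) && (B \subset S))) /=.
  apply: eq_bigr => B /andP[/imsetP[i _ ->] /subsetP sBS]; rewrite -sum1_card.
  apply: eq_bigl => j; rewrite eq_porbit_mem andb_idl //; exact: sBS.
move=> i iS; rewrite imset_f //=; apply/subsetP => j ij.
by rewrite (stab_porbit stS ij).
Qed.

Lemma wpermV (gT : finGroupType) n (x : wreath gT n) :
  wperm x^-1%g = (wperm x)^-1%g.
Proof. by []. Qed.

(** Inversion runs through the cycle backwards; seen as a base entry of a power of [x] at a fixed
    point, the cycle-product is inverted. Two one-step moves of the starting point account for [g]
    and [h]. *)
Lemma cycle_prodV (gT : finGroupType) n (x : wreath gT n) j :
  exists g, cycle_prod x^-1%g j = ((cycle_prod x j)^-1 ^ g)%g.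
Proof.
set s := wperm x; have [g Eg] := cycle_prod_perm x j.
have [h Eh] := cycle_prod_perm x (s j); exists (g * h)%g.
have El i : porbit s (s i) = porbit s i by have := porbit_perm s 1 i; rewrite expg1.
have fixl : wperm (x ^+ #|porbit s j|)%g (s j) = s j.
  by rewrite wpermX -/s permX -(El j) iter_porbit.
rewrite conjVg conjgM -Eg -Eh !cycle_prod_wbaseX wpermV -/s porbitV invgK permK !El.
by rewrite expgVn /= ffunE fixl.
Qed.

Section Annihilation.

Variables (C : numClosedFieldType) (gT : finGroupType).
Variables (S : comAlgType C) (a : nat -> Irr C gT -> S).
Variables (theta : cfun C gT) (delta : nat -> S -> S).

Hypothesis delta_lin : forall k, linear (delta k).
Hypothesis deltaM : forall k u v, delta k (u * v) = delta k u * v + u * delta k v.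
Hypothesis delta_comm : forall i j v, delta i (delta j v) = delta j (delta i v).
Hypothesis delta0 : forall v, delta 0 v = 0.
Hypothesis delta_gen : forall k m i, (0 < m)%N ->
  delta k (a m i) = if m == k then (k%:R * cfForm theta (chi i))%:A else 0.

Local Notation psi := (cls_sum a).

Let theta_inv (k : nat) g : C := theta g^-1%g.

Let theta_invJ k g h : theta_inv k (g ^ h)%g = theta_inv k g.
Proof. by rewrite /theta_inv -conjVg cfunJ. Qed.

Let psiJ := cls_sumJ a.

Lemma deltaD k u v : delta k (u + v) = delta k u + delta k v.
Proof. exact: (opserD delta_lin). Qed.

Lemma deltaZ k c v : delta k (c *: v) = c *: delta k v.
Proof. exact: (opserZ delta_lin). Qed.

Lemma delta_sum k (I : Type) (r : seq I) (P : pred I) (F : I -> S) :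
  delta k (\sum_(i <- r | P i) F i) = \sum_(i <- r | P i) delta k (F i).
Proof. exact: (opser_sum delta_lin). Qed.

Lemma delta_eq0 k : delta k 0 = 0.
Proof. exact: (opser0 delta_lin). Qed.

Lemma delta_scalar k c : delta k c%:A = 0.
Proof.
rewrite deltaZ; suff -> : delta k 1 = 0 by rewrite scaler0.
have := deltaM k 1 1; rewrite !mulr1 mul1r => E.
by apply: (addrI (delta k 1)); rewrite -E addr0.
Qed.

Lemma delta_cls_sum k m g : (0 < m)%N ->
  delta k (psi m g) = if m == k then (k%:R * theta_inv k g)%:A else 0.
Proof.
move=> m_gt0; rewrite /cls_sum delta_sum.
under eq_bigr do rewrite deltaZ delta_gen //.
case: ifP => _; last by rewrite big1 // => i _; rewrite scaler0.
rewrite /theta_inv {2}(irr_coefE theta) cfval_sum mulr_sumr scaler_suml.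
apply: eq_bigr => i _; rewrite scalerA; congr (_ *: _).
by rewrite cfunZE irr_coef_form mulrCA [_ * cfForm _ _]mulrC.
Qed.

(* z P'(z) = sum_k z^k delta_k (P(z)) *)
Definition deriv_coef (P : {poly S}) := forall n,
  n%:R *: P`_n = \sum_(k < n.+1) delta k P`_(n - k).

(** Both sides obey the Leibniz rule: n = i + (n - i) on the left, [deltaM] on the right. *)
Lemma deriv_coefM P Q : deriv_coef P -> deriv_coef Q -> deriv_coef (P * Q).
Proof.
move=> dP dQ n; rewrite coefM scaler_sumr.
rewrite (eq_bigr (fun i : 'I_n.+1 => i%:R *: (P`_i * Q`_(n - i)) +
   (n - i)%:R *: (P`_i * Q`_(n - i)))); last first.
  by move=> i _; rewrite -scalerDl -natrD subnKC // -ltnS.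
rewrite big_split /= [X in X + _](reindex_inj rev_ord_inj) /=.
rewrite (eq_bigr (fun j : 'I_n.+1 => \sum_(k < (n - j).+1) delta k P`_(n - j - k)
  * Q`_j)).
  rewrite (sum_triangle n (fun j k => delta k P`_(n - j - k) * Q`_j)).
  rewrite [X in _ + X](eq_bigr (fun i : 'I_n.+1 => \sum_(k < (n - i).+1)
    P`_i * delta k Q`_(n - i - k))).
    rewrite (sum_triangle n (fun i k => P`_i * delta k Q`_(n - i - k))) -big_split.
    apply: eq_bigr => k _; rewrite coefM delta_sum /=.
    rewrite [X in X + _](reindex_inj rev_ord_inj) -big_split;
      apply: eq_bigr => i _ /=.
    have le_i : (i <= n - k)%N by rewrite -ltnS.
    rewrite deltaM subSS; congr (delta k P`_ _ * _ + _ * delta k Q`_ _).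
      by rewrite subnAC subKn.
    by rewrite subnAC.
  by move=> i _; rewrite scalerAr dQ mulr_sumr.
move=> j _; rewrite subSS subKn -1?ltnS // scalerAl dP mulr_suml.
by [].
Qed.

(** Each cycle is either kept as a power sum or contracted against theta, the exponent of X counting
    the contracted points. *)
Definition cycle_poly n (w : wreath gT n) : {poly S} :=
  \prod_(B in porbits (wperm w))
    ((cyc_val 1 theta_inv w B)%:A *: 'X^#|B| + (cyc_val 1 psi w B)%:P).

(** By [deriv_coefM] one factor is enough. For a cycle of length b, its term of degree b is a scalar
    killed by every derivation, while [delta b] sends the power sum to b times that scalar. *)
Lemma cycle_poly_deriv n (w : wreath gT n) : deriv_coef (cycle_poly w).
Proof.
apply: (big_ind deriv_coef) => [m|P Q|B BP]; [|exact: deriv_coefM|].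
  rewrite coef1; case: m => [|m] /=.
    by rewrite scale0r big_ord1 delta0.
  rewrite mulr0n scaler0 big1 // => k _; rewrite coef1.
  by case: eqP => _; rewrite ?delta_eq0 // mulr1n -(scale1r 1) delta_scalar.
have [i _ EB] := imsetP BP; have iB : i \in B by rewrite EB porbit_id.
rewrite (cyc_valE _ psiJ BP iB) (cyc_valE _ theta_invJ BP iB).
have /andP[B_gt0 _] := porbits_card_bound BP.
set g := cycle_prod _ _; set b := #|B| in B_gt0 *; move=> m.
have E l : ((theta_inv b g)%:A *: 'X^b + (psi b g)%:P)`_l =
    (if l == b then (theta_inv b g)%:A else 0) + (if l == 0%N then psi b g else
      0) :> S.
  by rewrite coefD coefZ coefXn coefC; case: eqP => _; rewrite ?mulr1 ?mulr0.
rewrite E (eq_bigr (fun k : 'I_m.+1 => if k == m :> nat then delta m (psi b g)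
  else 0)).
  rewrite -big_mkcond (big_pred1 ord_max) => [|k]; last by rewrite /= -val_eqE.
  rewrite delta_cls_sum // eq_sym; case: eqP => [<-|_].
    by rewrite (gtn_eqF B_gt0) addr0 scalerA.
  by rewrite add0r; case: eqP => [->|_]; rewrite ?scale0r ?scaler0.
move=> k _; rewrite E deltaD.
have -> : delta k (if (m - k)%N == b then (theta_inv b g)%:A else 0) = 0.
  by case: ifP => _; rewrite ?delta_scalar ?delta_eq0.
rewrite add0r subn_eq0; have := ltn_ord k; rewrite ltnS => le_km.
by rewrite eqn_leq le_km; case: ifP => [le_mk|_]; rewrite ?delta_eq0 //;
   congr (delta _ _); apply/eqP; rewrite eqn_leq le_km.
Qed.

Lemma cycle_poly_coef n (w : wreath gT n) m :
  (cycle_poly w)`_m = \sum_(A : {set 'I_n} | (#|A| == m) && stab w A)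
     (cprod theta_inv w A)%:A * cprod psi w (~: A).
Proof.
rewrite /cycle_poly prodrD_porbits coef_sum.
rewrite [RHS](eq_bigl (fun A => stab w A && (#|A| == m))) => [|A];
  last exact: andbC.
rewrite [RHS]big_mkcondr; apply: eq_bigr => A stA.
have EX : \prod_(B in porbits (wperm w) | B \subset A) 'X^#|B| = 'X^#|A| :> {poly
  S}.
  rewrite -(sum_card_porbits_sub stA).
  by apply/esym/(big_morph (fun k => 'X^k)) => [k l|]; rewrite ?exprD ?expr0.
rewrite -rmorph_prod /= -/(cprod psi w (~: A)) !scaler_prod big1_eq EX.
rewrite -/(cprod theta_inv w A) coefMC coefZ coefXn eq_sym.
by case: eqP => _; rewrite ?mulr1 ?mulr0 ?mul0r.
Qed.

Lemma cycle_poly_coef0 n (w : wreath gT n) : (cycle_poly w)`_0 = cprodT psi w.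
Proof.
rewrite -horner_coef0 /cycle_poly horner_prod; apply: eq_bigr => B BP.
have /andP[B_gt0 _] := porbits_card_bound BP.
by rewrite hornerD hornerZ hornerXn hornerC expr0n (gtn_eqF B_gt0) mulr0 add0r.
Qed.

Variable A : opser S.
Hypothesis AE : forall n v, A n v = if n == 0%N then 0 else n%:R^-1 *: delta n v.

Lemma ann_opser_linear n : linear (A n).
Proof.
move=> c u v; rewrite !AE; case: ifP => _; first by rewrite scaler0 addr0.
by rewrite delta_lin scalerDr !scalerA mulrC.
Qed.

(** Averaging [cycle_poly_deriv] against [F] gives the recursion of the exponential; the constant
    coefficients give its initial value. *)
Lemma ann_opser_exp N (F : cfun C (wreath gT N)) n :
  mean (fun w => F w *: (cycle_poly w)`_n) = opser_exp A n (char_map a F).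
Proof.
move: n; apply: (@opser_exp_unique _ _ A) => [|i j v|v||n].
- exact: ann_opser_linear.
- rewrite !AE; do 2!case: ifP => _; rewrite ?delta_eq0 ?scaler0 //.
  by rewrite !deltaZ !scalerA delta_comm mulrC.
- by rewrite AE.
- by rewrite /char_map /mean; congr (_ *: _); apply: eq_bigr => w _;
  rewrite cycle_poly_coef0.
transitivity (mean (fun w => \sum_(k < n.+1) F w *: delta k (cycle_poly w)`_(n -
  k))).
  rewrite -meanZ /mean; congr (_ *: _); apply: eq_bigr => w _.
  by rewrite scalerA mulrC -scalerA cycle_poly_deriv scaler_sumr.
rewrite /mean exchange_big scaler_sumr; apply: eq_bigr => k _ /=.
rewrite AE; case: eqP => [->|/eqP k_neq0].
  by rewrite scale0r big1 ?scaler0 // => w _; rewrite delta0 scaler0.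
rewrite scalerA mulfV ?pnatr_eq0 // scale1r deltaZ delta_sum; congr (_ *: _).
by apply: eq_bigr => w _; rewrite deltaZ.
Qed.

Lemma cprodT_inv n (f : cfun C gT) (x : wreath gT n) :
  cprodT (fun _ g => f g) x^-1%g = cprodT (fun _ g => f g^-1%g) x.
Proof.
have fJ (k : nat) g h : f (g ^ h)^-1%g = f g^-1%g by rewrite -conjVg cfunJ.
rewrite /cprodT [wperm _]/= porbitsV; apply: eq_bigr => B BP.
have [i _ EB] := imsetP BP; have iB : i \in B by rewrite EB porbit_id.
rewrite (cyc_valE _ fJ BP iB) (cyc_valE _ (cfun_weightJ f) _ iB) ?porbitsV //.
by have [g ->] := cycle_prodV x i; rewrite cfunJ.
Qed.

(** Contracting the first block and averaging over the second is the Young side of [mean_young]; the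
    other side sums over the stable sets of size [n], as in [cycle_poly_coef]. *)
Lemma char_map_contract n k (F : cfun C (wreath gT (n + k))) :
  char_map a (cfContract (cf_eta n theta) (cfRes (@youngM gT n k _ erefl) F)) =
  opser_exp A n (char_map a F).
Proof.
rewrite -ann_opser_exp.
pose U w (B : {set 'I_(n + k)}) : S :=
  F w *: ((cprod theta_inv w B)%:A * cprod psi w (~: B)).
have UJ x z B : U (x ^ z)%g B = U x (wperm z @: B).
  by rewrite /U cfunJ cprodJ // cprodCJ.
transitivity (mean (fun w => \sum_(B : {set 'I_(n + k)} | (#|B| == n) && stab w
  B) U w B)).
  rewrite (mean_young erefl UJ) card_prod natrM invfM mulrC -scalerA.
  rewrite /char_map /mean; congr (_ *: _).
  rewrite -(pair_bigA _ (fun x y => U (young erefl (x, y)) (yset erefl)))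
    exchange_big /=.
  rewrite scaler_sumr; apply: eq_bigr => y _.
  rewrite ffunE /cfForm -scalerA; congr (_ *: _).
  (* The form pairs [x] with its inverse; the reindexing moves the inverse onto theta, whence
     [theta_inv]. *)
  rewrite scaler_suml (reindex_inj invg_inj) /=; apply: eq_bigr => x _.
  rewrite /U cprod_young_lft // cprod_young_rgt // -cprodT_inv -cf_etaE !ffunE /=
    invgK.
  by rewrite -scalerAl mul1r scalerA mulrC.
rewrite /mean; congr (_ *: _); apply: eq_bigr => w _.
by rewrite cycle_poly_coef scaler_sumr.
Qed.

Lemma ann_opser_exp_small N (F : cfun C (wreath gT N)) n :
  (N < n)%N -> opser_exp A n (char_map a F) = 0.
Proof.
move=> lt_Nn; rewrite -ann_opser_exp /mean big1 ?scaler0 // => w _.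
rewrite cycle_poly_coef big_pred0 ?scaler0 // => B.
by apply/negbTE/negP => /andP[/eqP EB _]; have := max_card (mem B);
  rewrite EB card_ord leqNgt lt_Nn.
Qed.

End Annihilation.

(** * The characteristic map *)

Section TotalMap.

Import classical_sets fsbigop.

Variables (C : numClosedFieldType) (gT : finGroupType).
Variables (S : comAlgType C) (a : nat -> Irr C gT -> S).

Definition total_map (F : RGamma C gT) : S :=
  (\sum_(n \in [set: nat]%classic) char_map a (F n))%R.

Lemma char_map0 n : char_map a (0 : cfun C (wreath gT n)) = 0.
Proof.
rewrite /char_map /mean big1 ?scaler0 // => x _.
by rewrite ffunE scale0r.
Qed.

Lemma char_map_lin n : linear (char_map a (n := n)).
Proof.
move=> c f g; rewrite /char_map -meanZ /mean -scalerDr -big_split.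
congr (_ *: _); apply: eq_bigr => x _.
by rewrite !ffunE scalerDl scalerA.
Qed.

Lemma total_mapE (F : RGamma C gT) N : (forall n, (N <= n)%N -> F n = 0) ->
  total_map F = \sum_(n < N) char_map a (F n).
Proof.
move=> HN; rewrite -(big_mkord xpredT (fun n => char_map a (F n))).
rewrite /total_map (@fsbigE _ _ _ _ _ (iota 0 N)) ?iota_uniq //.
  by rewrite /index_iota subn0; apply: eq_bigl => n; rewrite in_setT.
by move=> n _; rewrite mem_iota /= add0n -leqNgt => /HN ->; apply: char_map0.
Qed.

Lemma total_map_lin : linear total_map.
Proof.
move=> c F F'; have [N HN] := RGfin F; have [N' HN'] := RGfin F'.
have le1 := leq_maxl N N'; have le2 := leq_maxr N N'; set M := maxn N N' in le1 le2.
have F0 n : (M <= n)%N -> F n = 0 by move/(leq_trans le1)/HN.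
have F0' n : (M <= n)%N -> F' n = 0 by move/(leq_trans le2)/HN'.
rewrite (total_mapE F0) (total_mapE F0') (@total_mapE _ M).
  rewrite scaler_sumr -big_split; apply: eq_bigr => n _; exact: char_map_lin.
by move=> n le_n; rewrite /= F0 // F0' // scaler0 addr0.
Qed.

Lemma ind_compE n m (f : cfun C (wreath gT n)) (F : RGamma C gT) :
  char_map a (ind_comp f F (n + m)) = char_map a f * char_map a (F m).
Proof.
rewrite /ind_comp; case: {-}_ / idP => [le_n|]; last by rewrite leq_addr.
by rewrite char_map_ind addKn.
Qed.

Lemma ind_comp_small n k (f : cfun C (wreath gT n)) (F : RGamma C gT) :
  (k < n)%N -> ind_comp f F k = 0.
Proof.
move=> lt_kn; rewrite /ind_comp; case: {-}_ / idP => // le_nk.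
by have := le_nk; rewrite leqNgt lt_kn.
Qed.

Lemma total_map_ind n (f : cfun C (wreath gT n)) (F : RGamma C gT) :
  total_map (ind_op f F) = char_map a f * total_map F.
Proof.
have [N HN] := RGfin F; rewrite (total_mapE HN) (@total_mapE _ (n + N)%N);
  last first.
  move=> k le_k; have le_n : (n <= k)%N by apply: leq_trans le_k; apply: leq_addr.
  rewrite /= /ind_comp; case: {-}_ / idP => // e; rewrite HN ?cfExt0 ?cfInd0 //.
  by rewrite leq_subRL.
rewrite big_split_ord /= big1 ?add0r => [|k _]; last first.
  by rewrite ind_comp_small // char_map0.
by rewrite mulr_sumr; apply: eq_bigr => k _; rewrite ind_compE.
Qed.

Lemma total_map_H_cre gamma (A : opser S) :
    (forall n v, A n v = if n == 0%N then 0 else n%:R^-1 *: (lin_gen a gamma n *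
      v)) ->
  forall n F, total_map (H_cre n gamma F) = opser_exp A n (total_map F).
Proof.
by move=> AE n F; rewrite total_map_ind (char_map_eta_exp AE).
Qed.

Lemma E_cre_sign n gamma (F : RGamma C gT) :
  (-1) ^+ n *: E_cre n gamma F = H_cre n (- gamma) F.
Proof.
apply: RGammaP => k; rewrite /= -cf_eps_sign /ind_comp.
case: {-}_ / idP => [le_nk|]; last by rewrite scaler0.
apply: cfunP => x; rewrite !ffunE mulr_sumr [LHS]mulr_sumr mulr_sumr.
apply: eq_bigr => z _; rewrite [RHS]mulr_sumr !mulr_sumr; apply: eq_bigr => h _.
by rewrite !ffunE; rewrite mulrCA; congr (_ * _); rewrite mulrA.
Qed.

Lemma lin_genN gamma k : lin_gen a (- gamma) k = - lin_gen a gamma k.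
Proof.
rewrite /lin_gen -sumrN; apply: eq_bigr => i _.
by rewrite !irr_coef_form -scaleN1r cfFormZl mulN1r scaleNr.
Qed.

Lemma total_map_E_cre gamma (A : opser S) :
    (forall n v, A n v = if n == 0%N then 0 else n%:R^-1 *: (lin_gen a gamma n *
      v)) ->
  forall n F, total_map ((-1) ^+ n *: E_cre n gamma F) =
              opser_exp (opser_opp A) n (total_map F).
Proof.
move=> AE n F; rewrite E_cre_sign; apply: total_map_H_cre => m v.
rewrite /opser_opp AE; case: ifP => _; first exact: oppr0.
by rewrite lin_genN mulNr scalerN.
Qed.

Section Image.

Let im v := exists F, total_map F = v.

Lemma im_lin c u v : im u -> im v -> im (c *: u + v).
Proof. by move=> [F <-] [F' <-]; exists (c *: F + F'); rewrite total_map_lin. Qed.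

Lemma im0 : im 0.
Proof.
by exists 0; rewrite (@total_mapE _ 0) ?big_ord0.
Qed.

Lemma im_sum (I : finType) (P : pred I) (E : I -> S) :
  (forall i, P i -> im (E i)) -> im (\sum_(i | P i) E i).
Proof.
move=> H; apply: big_ind => //; first exact: im0.
by move=> u v iu iv; rewrite -[u]scale1r; apply: im_lin.
Qed.

Lemma lin_gen_chi k i : lin_gen a (chi i) k = a k i.
Proof.
rewrite /lin_gen (bigD1 i) //= irr_coef_form chi_orthonormal eqxx scale1r.
rewrite big1 ?addr0 // => j nj.
by rewrite irr_coef_form chi_orthonormal eq_sym (negPf nj) scale0r.
Qed.

(* For h_m = ch (eta_m (chi i)), a_n = n h_n - sum_(0 < k < n) a_k h_{n-k}. *)
Lemma im_gen k i v : (0 < k)%N -> im v -> im (a k i * v).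
Proof.
elim/ltn_ind: k v => -[//|n] IHn v _ [F EF]; pose h m
  := char_map a (cf_eta m (chi i)).
have imh m u : im u -> im (h m * u).
  by case=> G <-; exists (H_cre m (chi i) G); rewrite total_map_ind.
have imv : im v by exists F.
have E := char_map_eta_rec a (chi i) n.+1;
  rewrite big_ord_recr /= subnn lin_gen_chi in E.
have h0 : h 0%N = 1.
  have := char_map_eta_exp (A := fun n v => if n == 0%N then 0 else
    n%:R^-1 *: (lin_gen a (chi i) n * v)) (fun _ _ => erefl) 0 1.
  by rewrite mulr1 opser_exp0.
rewrite -/(h 0%N) h0 mulr1 in E.
have -> : a n.+1 i * v = (-1) *: (\sum_(k < n.+1) (if k == 0%N :> nat then 0 else
    lin_gen a (chi i) k) * h (n.+1 - k)%N * v) + n.+1%:R *: (h n.+1 * v).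
  rewrite scalerAl -/(h n.+1) in E *; rewrite E mulrDl scaleN1r -mulr_suml.
  by rewrite addrA addNr add0r.
apply: im_lin; last by rewrite -[_ *: _]addr0; apply: im_lin;
  [apply: imh|apply: im0].
apply: im_sum => -[[|k] /= lt_k] _; first by rewrite !mul0r; apply: im0.
by rewrite lin_gen_chi -mulrA; apply: IHn => //; apply: imh.
Qed.

Lemma im1 : im 1.
Proof.
pose Fc n : cfun C (wreath gT n) := if n == 0%N then cf_eta n 0 else 0.
have Ffin : exists N, forall n, (N <= n)%N -> Fc n = 0 by exists 1%N => -[].
exists (MkRGamma Ffin); rewrite (@total_mapE _ 1); last by case.
rewrite big_ord1 /=.
have := char_map_eta_exp (A := fun n v => if n == 0%N then 0 else
    n%:R^-1 *: (lin_gen a 0 n * v)) (fun _ _ => erefl) 0 1.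
by rewrite mulr1 opser_exp0.
Qed.

Hypothesis gen_ind : forall P : S -> Prop, P 1 ->
  (forall c u v, P u -> P v -> P (c *: u + v)) ->
  (forall m i v, (0 < m)%N -> P v -> P (a m i * v)) -> forall v, P v.

Lemma total_map_surj v : exists F, total_map F = v.
Proof.
apply: (gen_ind (P := im)); [exact: im1|exact: im_lin|].
by move=> m i u m_gt0; apply: im_gen.
Qed.

End Image.

Section Annihilation.

Variables (xi gamma : cfun C gT) (delta : nat -> S -> S).

Hypothesis delta_lin : forall k, linear (delta k).
Hypothesis deltaM : forall k u v, delta k (u * v) = delta k u * v + u * delta k v.
Hypothesis delta0 : forall v, delta 0 v = 0.
Hypothesis delta_gen : forall k m i, (0 < m)%N ->
  delta k (a m i) = if m == k then (k%:R * form_xi xi gamma (chi i))%:A else 0.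
Hypothesis gen_ind : forall P : S -> Prop, P 1 ->
  (forall c u v, P u -> P v -> P (c *: u + v)) ->
  (forall m i v, (0 < m)%N -> P v -> P (a m i * v)) -> forall v, P v.

(** Each derivation sends a generator to a scalar, which the other one kills; the two cross terms of
    the Leibniz rule are then exchanged. *)
Lemma delta_comm i j v : delta i (delta j v) = delta j (delta i v).
Proof.
move: v; apply: gen_ind => [|c u v Eu Ev|m k v m_gt0 Ev].
- by rewrite -(scale1r (1 : S)) !(delta_scalar delta_lin deltaM, delta_eq0
  delta_lin).
- by rewrite !delta_lin Eu Ev.
have Dg l : exists c, delta l (a m k) = c%:A.
  rewrite delta_gen //; case: ifP => _; first by eexists.
  by exists 0; rewrite scale0r.
have [c Ec] := Dg i; have [d Ed] := Dg j.
rewrite !deltaM !(deltaD delta_lin) !deltaM Ec Ed !(delta_scalar delta_lin deltaM).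
by rewrite !mul0r !add0r Ev addrCA.
Qed.

(** Components of degree below [n] are killed by [small]. The one of degree n + k becomes the
    component k by [char_map_contract] for theta = xi gamma, as eta_n is multiplicative
    ([cf_etaM]). *)
Lemma total_map_H_ann (A : opser S) :
    (forall n v, A n v = if n == 0%N then 0 else n%:R^-1 *: delta n v) ->
  forall n F, total_map (H_ann xi n gamma F) = opser_exp A n (total_map F).
Proof.
move=> AE n F; have [N HN] := RGfin F.
have HN' k : (n + N <= k)%N -> F k = 0.
  by move=> le_k; apply: HN; apply: leq_trans le_k; apply: leq_addl.
rewrite (total_mapE HN') (@total_mapE _ N); last first.
  move=> k le_k; rewrite /= /res_comp HN;
    last by rewrite (leq_trans le_k) ?leq_addl.
  apply: cfunP => x; rewrite !ffunE /cfForm big1 ?mulr0 // => z _.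
  by rewrite !ffunE mulr0.
have small := ann_opser_exp_small delta_lin deltaM delta_comm delta0 delta_gen AE.
have contr := char_map_contract delta_lin deltaM delta_comm delta0 delta_gen AE.
have Alin : forall m, linear (A m) := ann_opser_linear delta_lin AE.
have Elin := opser_exp_lin Alin n.
rewrite (opser_sum (A := fun=> opser_exp A n) (fun=> Elin) 0).
rewrite big_split_ord /= [X in X + _]big1 ?add0r => [|k _]; last exact: small.
apply: eq_bigr => k _; rewrite -contr; congr char_map.
by rewrite /= /res_comp cf_etaM.
Qed.

End Annihilation.

Lemma E_ann_sign xi n gamma (F : RGamma C gT) :
  (-1) ^+ n *: E_ann xi n gamma F = H_ann xi n (- gamma) F.
Proof.
apply: RGammaP => k; rewrite /= -cf_eps_sign /res_comp.
apply: cfunP => x; rewrite cfunZE !ffunE /cfForm mulrCA; congr (_ * _).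
rewrite mulr_sumr; apply: eq_bigr => z _; rewrite !ffunE [LHS]mulrA; congr (_ * _).
exact: mulrCA.
Qed.

(** Passing to [- gamma] replaces each derivation by its opposite, so the case of H applies. *)
Lemma total_map_E_ann xi gamma (delta : nat -> S -> S) :
    (forall k, linear (delta k)) ->
    (forall k u v, delta k (u * v) = delta k u * v + u * delta k v) ->
    (forall v, delta 0 v = 0) ->
    (forall k m i, (0 < m)%N -> delta k (a m i) =
       if m == k then (k%:R * form_xi xi gamma (chi i))%:A else 0) ->
    (forall P : S -> Prop, P 1 ->
       (forall c u v, P u -> P v -> P (c *: u + v)) ->
       (forall m i v, (0 < m)%N -> P v -> P (a m i * v)) -> forall v, P v) ->
  forall A : opser S,
    (forall n v, A n v = if n == 0%N then 0 else n%:R^-1 *: delta n v) ->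
  forall n F, total_map ((-1) ^+ n *: E_ann xi n gamma F) =
              opser_exp (opser_opp A) n (total_map F).
Proof.
move=> delta_lin deltaM delta0 delta_gen gen_ind A AE n F; rewrite E_ann_sign.
apply: (@total_map_H_ann xi (- gamma) (fun k v => - delta k v)) => //.
- by move=> k c u v; rewrite delta_lin opprD scalerN.
- by move=> k u v; rewrite deltaM opprD mulNr mulrN.
- by move=> v; rewrite delta0 oppr0.
- move=> k m i m_gt0; rewrite delta_gen //; case: ifP => _; last exact: oppr0.
  rewrite -scaleNr -mulrN; congr ((_ * _) *: _).
  rewrite /form_xi -mulN1r -cfFormZl; congr cfForm; apply: cfunP => x.
  by rewrite cfunZE !ffunE mulN1r mulrN.
move=> k v; rewrite /opser_opp AE; case: ifP => _; first exact: oppr0.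
by rewrite scalerN.
Qed.

End TotalMap.

Section TypeProduct.

Variables (C : numClosedFieldType) (gT : finGroupType).
Variables (S : comAlgType C) (a : nat -> Irr C gT -> S).

(** A type remembers only classes, so the power sums are first moved to class representatives, which
    [cls_sumJ] permits. *)
Lemma cprodT_cls_sum n (x : wreath gT n) :
  \prod_c \prod_(j < n) (\sum_i chi i (cls_rep c)^-1%g *: a j.+1 i) ^+ wtype x c j =
  cprodT (cls_sum a) x.
Proof.
transitivity (cprodT (fun k g =>
    \sum_i chi i (cls_rep (cls_of g))^-1%g *: a k i) x); last first.
  apply: eq_bigr => B BP; have [i _ EB] := imsetP BP.
  have iB : i \in B by rewrite EB porbit_id.
  rewrite (cyc_valE _ (cls_sumJ a) BP iB) (@cyc_valE _ _ _ _ _ _ _ _ i) //.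
    have [g ->] := cls_conj (mem_cls_of (cycle_prod x i)) (cls_rep_mem _).
    exact: cls_sumJ.
  by move=> k g h; rewrite cls_ofJ.
rewrite (cprodT_mult (fun k c => \sum_i chi i (cls_rep c)^-1%g *: a k i)).
by apply: eq_bigr => c _; apply: eq_bigr => j _; rewrite wtypeE.
Qed.

End TypeProduct.

(** * The symmetric algebra S_Gamma and the four identities *)

Section SGammaInstance.

Import finmap monalg.

Lemma cmonom_ind (I : choiceType) (Q : {cmonom I} -> Prop) :
  Q (onecm I) -> (forall i m, Q m -> Q (mulcm (ucm i) m)) -> forall m, Q m.
Proof.
move=> Q1 QM m; have [n] := ubnP (mdeg m); elim: n m => // n IHn m le_mn.
have [/mdeg_eq0I->|m_neq0] := eqVneq (mdeg m) 0%N; first exact: Q1.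
have [v vm] : exists v, v \in finsupp m.
  have [E|[v vm]] := fset_0Vmem (finsupp m); last by exists v.
  by rewrite mdegE E big_seq_fset0 in m_neq0.
have Em : m = mulcm (ucm v) (divcm m (ucm v)).
  apply/eqP/cmP => j; rewrite mulcmE divcmE ucmE; case: eqP => [<-|_].
    by rewrite subnKC // lt0n cmE_neq0.
  by rewrite add0n subn0.
have lt_n : (mdeg (divcm m (ucm v)) < n)%N.
  have E : mdeg m = (mdeg (ucm v) + mdeg (divcm m (ucm v)))%N.
    by rewrite {1}Em; apply: mdegM.
  by move: le_mn; rewrite E mdegU add1n ltnS.
by rewrite Em; apply: QM; apply: IHn.
Qed.

Variables (C : numClosedFieldType) (gT : finGroupType).

Local Notation SG := (SGamma C gT).

Lemma a_rho_wtype n (x : wreath gT n) :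
  a_rho C (wtype x) = cprodT (cls_sum (@a_gen C gT : nat -> Irr C gT -> (SG :
    comAlgType C))) x.
Proof. exact: (cprodT_cls_sum (@a_gen C gT : nat -> Irr C gT -> (SG : comAlgType
  C))). Qed.

Lemma ch_total_map (F : RGamma C gT) :
  ch F = total_map (@a_gen C gT : nat -> Irr C gT -> (SG : comAlgType C)) F.
Proof.
apply: fsbigop.eq_fsbigr => n _.
exact: (mean_wtype (F n) (@a_rho_wtype n)).
Qed.

Lemma SmonM (m1 m2 : {cmonom (SVar C gT)}) :
  Smon m1 * Smon m2 = Smon (mulcm m1 m2) :> SG.
Proof. by rewrite /Smon malgM_def fgmulUU mulr1. Qed.

Lemma SGamma_ind (P : SG -> Prop) : P 1 ->
    (forall c u v, P u -> P v -> P (c *: u + v)) ->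
    (forall m i v, (0 < m)%N -> P v -> P (a_gen m i * v)) ->
  forall v, P v.
Proof.
move=> P1 Plin Pgen; have P0 : P 0.
  by have := Plin (-1) 1 1 P1 P1; rewrite scaleN1r addNr.
have Pmon m : P (Smon m).
  apply: (@cmonom_ind _ (fun m => P (Smon m))) m => [|[k i] m Pm]; first exact: P1.
  (* The variable [(k, i)] is [a_gen k.+1 i], whence the positive index. *)
  rewrite -SmonM; exact: (Pgen k.+1 i _ isT Pm).
move=> v; rewrite [v]monalgE; apply: (big_ind P) => [|u w Pu Pw|m _].
- exact: P0.
- by have := Plin 1 u w Pu Pw; rewrite scale1r.
have -> : << v@_m *g m >> = v@_m *: Smon m + 0 :> SG.
  apply/malgP => k; rewrite addr0 (mcoeffU m v@_m k) (mcoeffZ v@_m (Smon m) k).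
  by rewrite (mcoeffU m 1 k) mulr_natr.
exact: Plin (Pmon m) P0.
Qed.

Section Derivation.

Variables (xi gamma : cfun C gT).

Let d n (v : SVar C gT) : SG :=
  if v.1.+1 == n then (n%:R * form_xi xi gamma (chi v.2))%:A else 0.

Lemma a_ann_linear n : linear (a_ann xi n gamma).
Proof.
move=> c u v; apply: (etrans (SderivD _ _ _)); congr (_ + _).
exact: SderivZ.
Qed.

Lemma a_annM n u v : a_ann xi n gamma (u * v) =
  a_ann xi n gamma u * v + u * a_ann xi n gamma v.
Proof. exact: SderivM. Qed.

Lemma a_ann_gen k m i : (0 < m)%N -> a_ann xi k gamma (a_gen m i) =
  if m == k then (k%:R * form_xi xi gamma (chi i))%:A else 0.
Proof. by move=> m_gt0; apply: etrans (Sderiv_var _ _) _; rewrite /= prednK. Qed.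

(** All variables have positive degree: [v.1.+1 == 0] computes to false, so the derivation vanishes
    on each of them. *)
Lemma a_ann0 v : a_ann xi 0 gamma v = 0.
Proof.
apply: (big_ind (fun u : SG => u = 0)) => // [_ _ -> ->|m _]; first exact: addr0.
apply: (etrans _ (scaler0 _ _)); congr (_ *: _).
apply: (big_ind (fun u : SG => u = 0)) => // [_ _ -> ->|k _]; first exact: addr0.
apply: (etrans _ (scaler0 _ _)); congr (_ *: _); exact: mul0r.
Qed.

End Derivation.

Lemma ch_surj v : exists F : RGamma C gT, ch F = v.
Proof.
have [F EF] := @total_map_surj C gT SG (@a_gen C gT) SGamma_ind v.
by exists F; rewrite ch_total_map.
Qed.

(* As [ch_inv] selects a preimage, surjectivity of [ch] is enough. *)
Lemma ch_op_eq (T : RGamma C gT -> RGamma C gT) (A : SG -> SG) :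
  (forall F, ch (T F) = A (ch F)) -> ch_op T =1 A.
Proof.
move=> TA v; rewrite /ch_op TA; congr A.
exact: (classical_sets.xgetPex _ (ch_surj v)).
Qed.

Local Notation gen := (@a_gen C gT : nat -> Irr C gT -> (SG : comAlgType C)).

Lemma ch_H_plus (gamma : cfun C gT) :
  ch_ser (H_plus gamma) =2 opser_exp (a_plus gamma).
Proof.
move=> n; apply: ch_op_eq => F; rewrite !ch_total_map.
exact: (@total_map_H_cre C gT SG gen gamma (a_plus gamma) (fun _ _ => erefl)).
Qed.

Lemma ch_E_plus (gamma : cfun C gT) :
  ch_ser (E_plus gamma) =2 opser_exp (opser_opp (a_plus gamma)).
Proof.
move=> n; apply: ch_op_eq => F; rewrite !ch_total_map.
exact: (@total_map_E_cre C gT SG gen gamma (a_plus gamma) (fun _ _ => erefl)).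
Qed.

Lemma ch_H_minus (xi gamma : cfun C gT) :
  ch_ser (H_minus xi gamma) =2 opser_exp (a_minus xi gamma).
Proof.
move=> n; apply: ch_op_eq => F; rewrite !ch_total_map.
exact: (@total_map_H_ann C gT SG gen xi gamma
  (fun k => a_ann xi k gamma) (a_ann_linear xi gamma) (a_annM xi gamma)
  (a_ann0 xi gamma) (a_ann_gen xi gamma) SGamma_ind (a_minus xi gamma) (fun _ _
    => erefl)).
Qed.

Lemma ch_E_minus (xi gamma : cfun C gT) :
  ch_ser (E_minus xi gamma) =2 opser_exp (opser_opp (a_minus xi gamma)).
Proof.
move=> n; apply: ch_op_eq => F; rewrite !ch_total_map.
exact: (@total_map_E_ann C gT SG gen xi gamma
  (fun k => a_ann xi k gamma) (a_ann_linear xi gamma) (a_annM xi gamma)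
  (a_ann0 xi gamma) (a_ann_gen xi gamma) SGamma_ind (a_minus xi gamma) (fun _ _
    => erefl)).
Qed.

End SGammaInstance.

(* R[i] is the field of complex numbers. *)
Theorem theorem6p3 (R : realType) (gT : finGroupType) (xi : cfun R[i] gT)
    (xi_self_dual : self_dual xi) (gamma : cfun R[i] gT) :
  [/\ ch_ser (H_plus gamma) =2 opser_exp (a_plus gamma),
      ch_ser (E_plus gamma) =2 opser_exp (opser_opp (a_plus gamma)),
      ch_ser (H_minus xi gamma) =2 opser_exp (a_minus xi gamma) &
      ch_ser (E_minus xi gamma) =2 opser_exp (opser_opp (a_minus xi gamma))].
Proof.
by split; [exact: ch_H_plus|exact: ch_E_plus|exact: ch_H_minus|exact: ch_E_minus].
Qed.
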